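(* Let $M=\mathbb P^1(\mathbb C)$ and $\mathcal O_E=\mathcal O(l_1)\oplus\mathcal O(l_2)\oplus\mathcal O(l_3)$ with integers $l_1\le l_2\le l_3$ and $l_2+l_3<-2$. Put $c_{ij}:=-l_i-l_j-4$ and $d_{ij}:=-l_i-l_j-2$. With respect to the identification $$\textstyle H^1(M,Der_2(\Lambda E))\cong\bigoplus_{1\le i<j\le3}\left(\frac1z\mathbb C[\frac1z]_{\le c_{ij}}\oplus\frac1z\mathbb C[\frac1z]_{\le d_{ij}}\right)\cong\bigoplus_{1\le i<j\le3}\frac1z\mathbb C[\frac1z]_{\le c_{ij}+d_{ij}+1}$$ the $U(E)$-action on $H^1(M,Der_2(\Lambda E))$ has as its set of orbits: - $\mathbb V_3^{c_{12}+d_{12}+1}$ in the case $l_1=l_2=l_3$, - $\mathbb V_1^{c_{12}+d_{12}+1}\times\mathbb V_2^{c_{13}+d_{13}+1}$ in the case $l_1=l_2<l_3$, - $\mathbb V_2^{c_{12}+d_{12}+1}\times\mathbb V_1^{c_{23}+d_{23}+1}$ in the case $l_1<l_2=l_3$, - $\mathbb V_1^{c_{12}+d_{12}+1}\times\mathbb V_1^{c_{13}+d_{13}+1}\times\mathbb V_1^{c_{23}+d_{23}+1}$ in the case $l_1<l_2<l_3$.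
   Context: $\mathcal O(k)$ is the line bundle of degree $k$ on $\mathbb P^1(\mathbb C)$. With coordinate $z=z_0/z_1$, $\frac1z\mathbb C[\frac1z]_{\le n}$ is $\frac1z$ times the polynomials in $\frac1z$ of degree $\le n$ ($\{0\}$ if $n<0$), and $H^1(M,\mathcal O(k))\cong\frac1z\mathbb C[\frac1z]_{\le-k-2}$. $Der_2(\Lambda E)$ is the sheaf of even $\mathbb C$-linear derivations of $\mathcal O_{\Lambda E}$ raising the exterior degree by $2$; in rank $3$, $H^1(M,G_E)\cong H^1(M,Der_2(\Lambda E))$ classifies supermanifold structures, where $G_E$ is the sheaf of even algebra automorphisms of $\mathcal O_{\Lambda E}$ that are the identity up to terms raising the degree by at least $2$. Group. Let $m_i=\#\{j\mid l_j=i\}$. $U(E):=\prod_iU(m_i)\subset\prod_iGL(m_i,\mathbb C)\subset H^0(M,Aut(E))$ acts on $H^1(M,Der_2(\Lambda E))$ by conjugation. Identification. Since $l_2+l_3<-2$ there is an exact sequence $0\to H^1(M,Hom_{\mathcal O_M}(\Lambda^1E,\Lambda^3E))\to H^1(M,Der_2(\Lambda E))\to H^1(M,Der(\mathcal O_M)\otimes\mathcal O_{\Lambda^2E})\to0$ (restriction of derivations to $\mathcal O_M$); it is split $U(E)$-equivariantly by the orthogonal complement for a $U(E)$-invariant Hermitian metric. Using $Der(\mathcal O_M)\cong\mathcal O(2)$ and $Hom_{\mathcal O_M}(\Lambda^1E,\Lambda^3E)\cong\mathcal O_{\Lambda^2E}$ gives $H^1(M,Der_2(\Lambda E))\cong\bigoplus_{i<j}\big(H^1(M,\mathcal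 O(l_i+l_j+2))\oplus H^1(M,\mathcal O(l_i+l_j))\big)$, which is the first identification. The second identifies $\frac1z\mathbb C[\frac1z]_{\le c_{ij}}\oplus\frac1z\mathbb C[\frac1z]_{\le d_{ij}}\cong\frac1z\mathbb C[\frac1z]_{\le c_{ij}+d_{ij}+1}$ via $(p,q)\mapsto p+z^{-c_{ij}-1}q$. Orbit sets. For $k,n\ge0$, $\mathbb V_k^n:=\{U(k)(v)\mid v\in(\frac1z\mathbb C[\frac1z]_{\le n})^k\}$ is the set of orbits of $U(k)$ acting on $(\frac1z\mathbb C[\frac1z]_{\le n})^k=\mathbb C^k\otimes\frac1z\mathbb C[\frac1z]_{\le n}$ by the standard representation on $\mathbb C^k$; $\mathbb V_k^n=\{0\}$ otherwise. *)

(* Defs.v *)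
From HB Require Import structures.
From mathcomp Require Import all_boot all_order all_algebra.
From mathcomp Require Import all_classical all_reals all_analysis.
From mathcomp Require Import spectral generic_quotient ring_quotient complex.

(* The field of complex numbers is [R[i]], for an arbitrary [R : realType]. *)

Set Implicit Arguments.
Unset Strict Implicit.
Unset Printing Implicit Defensive.

Import Order.TTheory GRing.Theory Num.Theory.
Import numFieldNormedType.Exports.

Local Open Scope classical_set_scope.
Local Open Scope ring_scope.
Local Open Scope complex_scope.
Local Open Scope quotient_scope.

(* [Some z] is the point [z : 1] and [None] is the point [1 : 0], so that the
   coordinate of [Some z] is z = z_0 / z_1. *)
Definition P1 (R : realType) : Type := option R[i].

Section Holomorphic.
Variable K : numFieldType.

(* For K = R[i] this is holomorphy, of class C^1 in the complex sense; [K^o]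
   carries the norm topology. *)
Definition holomorphic_on (V : set K) (f : K -> K) : Prop :=
  forall z, V z -> derivable (f : K^o -> K^o) z 1 /\
    {for z, continuous (derive1 (f : K^o -> K^o) : K^o -> K^o)}.

Lemma holomorphic_on0 (V : set K) : holomorphic_on V (fun=> 0).
Proof.
move=> z _; split; first by exact: derivable_cst.
have -> : derive1 ((fun=> 0) : K^o -> K^o) = (fun=> 0).
  by apply/funext => x; rewrite derive1_cst.
by apply: (@cst_continuous K^o K^o 0 z).
Qed.

Lemma holomorphic_on_lin (V : set K) (a : K) (f g : K -> K) :
  open (V : set K^o) -> holomorphic_on V f -> holomorphic_on V g ->
  holomorphic_on V (fun z => a * f z + g z).
Proof.
move=> Vo hf hg z Vz; have [df cf] := hf z Vz; have [dg cg] := hg z Vz.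
have D x : V x -> derivable (fun z : K^o => a *: (f z : K^o) + g z : K^o) x 1
    /\ 'D_1 (fun z : K^o => a *: (f z : K^o) + g z : K^o) x =
       a *: 'D_1 (f : K^o -> K^o) x + 'D_1 (g : K^o -> K^o) x.
  move=> /[dup] /hf[dfx _] /hg[dgx _].
  have dZ := @derivableZ K K^o K^o f a x 1 dfx.
  split; first exact: (@derivableD K K^o K^o _ _ x 1 dZ dgx).
  rewrite -(@deriveZ K K^o K^o f a x 1 dfx).
  exact: (@deriveD K K^o K^o _ _ x 1 dZ dgx).
split; first exact: (D z Vz).1.
have near_eq : {near (z : K^o), (fun x : K^o =>
    a *: derive1 (f : K^o -> K^o) x + derive1 (g : K^o -> K^o) x : K^o) =1
    derive1 (fun z : K^o => a *: (f z : K^o) + g z : K^o)}.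
  have Vn : nbhs (z : K^o) V by exact: open_nbhs_nbhs.
  by apply: filterS Vn => x Vx; rewrite !derive1E (D x Vx).2.
have c : ((fun x : K^o => a *: derive1 (f : K^o -> K^o) x +
    derive1 (g : K^o -> K^o) x : K^o) y @[y --> (z : K^o)] -->
    (a *: derive1 (f : K^o -> K^o) z + derive1 (g : K^o -> K^o) z : K^o)).
  have c1 := @cvgZl_tmp K K^o _ _ _ a _ _ cf.
  exact: (cvgD (c1 _) cg).
rewrite /prop_for /continuous_at -(nbhs_singleton near_eq).
exact: cvg_trans (near_eq_cvg near_eq) c.
Qed.

Lemma open_neq0 : open ([set x | x != 0] : set K^o).
Proof.
have -> : ([set x | x != 0] : set K^o) = ~` [set 0].
  by apply/seteqP; split => x /= /eqP.
by rewrite openC; apply: accessible_closed_set1; apply: hausdorff_accessible;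
  exact: norm_hausdorff.
Qed.

End Holomorphic.

Section ProjectiveLine.
Variable R : realType.
Local Notation C := R[i].
Local Notation P1 := (P1 R).

Definition chart1 (z : C) : P1 := Some z.
(* the chart around [1 : 0], with coordinate w = 1 / z *)
Definition chart0 (w : C) : P1 := if w == 0 then None else Some w^-1.

Definition P1_open (V : set P1) : Prop :=
  open (chart1 @^-1` V : set C^o) /\ open (chart0 @^-1` V : set C^o).

Definition U0 : set P1 := range chart0.
Definition U1 : set P1 := range chart1.
Definition U01 : set P1 := U0 `&` U1.

(* O(k) is trivialised by z_1^k over U1 and by z_0^k over U0.  A section over V
   is recorded by one function on P^1, extended by 0 outside V: its value at
   [Some z] is the coefficient of z_1^k and its value at [None] is the
   coefficient of z_0^k.  [frame_coef0] is the coefficient of z_0^k as a function of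
   w = 1 / z. *)
Definition frame_coef1 (f : P1 -> C) (z : C) : C := f (Some z).
Definition frame_coef0 (k : int) (f : P1 -> C) (w : C) : C :=
  if w == 0 then f None else w ^ k * f (Some w^-1).

Definition O_sec (k : int) (V : set P1) (f : P1 -> C) : Prop :=
  [/\ forall p, ~ V p -> f p = 0,
      holomorphic_on (chart1 @^-1` V) (frame_coef1 f) &
      holomorphic_on (chart0 @^-1` V) (frame_coef0 k f)].

Definition restr (A : lmodType C) (V : set P1) (f : P1 -> A) : P1 -> A :=
  fun p => if `[< V p >] then f p else 0.

Lemma restr_lin (A : lmodType C) (V : set P1) (a : C) (f g : P1 -> A) :
  restr V (a *: f + g) = a *: restr V f + restr V g.
Proof.
apply/funext => p.
rewrite /restr -[RHS]/(a *: (if _ then _ else _) + (if _ then _ else _)).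
by case: ifP => // _; rewrite scaler0 addr0.
Qed.

Lemma P1_openU1 : P1_open U1.
Proof.
split.
  suff -> : chart1 @^-1` U1 = setT by exact: openT.
  by apply/seteqP; split => // z _; exists z.
suff -> : chart0 @^-1` U1 = [set w | w != 0] by exact: (@open_neq0 C).
apply/seteqP; split => w /=; first by case=> z _; rewrite /chart0; case: eqP.
by move=> w0; exists w^-1; rewrite // /chart0 (negbTE w0).
Qed.

Lemma P1_openU0 : P1_open U0.
Proof.
split.
  suff -> : chart1 @^-1` U0 = [set w | w != 0] by exact: (@open_neq0 C).
  apply/seteqP; split => z /=.
    by case=> w _; rewrite /chart0; case: eqP => // /eqP w0 [<-]; rewrite invr_eq0.
  move=> z0; exists z^-1; rewrite // /chart0 invr_eq0 (negbTE z0) invrK //.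
suff -> : chart0 @^-1` U0 = setT by exact: openT.
by apply/seteqP; split => // z _; exists z.
Qed.

Lemma P1_openU01 : P1_open U01.
Proof.
have [a b] := P1_openU0; have [c d] := P1_openU1.
by rewrite /P1_open !preimage_setI; split; apply: openI.
Qed.

Lemma O_sec0 k V : O_sec k V (fun=> 0).
Proof.
split=> //; first exact: holomorphic_on0.
rewrite (_ : frame_coef0 _ _ = fun=> 0); first exact: holomorphic_on0.
by apply/funext => w; rewrite /frame_coef0 mulr0 if_same.
Qed.

Lemma O_sec_lin k V (a : C) (f g : P1 -> C) : P1_open V ->
  O_sec k V f -> O_sec k V g -> O_sec k V (fun p => a * f p + g p).
Proof.
move=> [V1 V0] [f0 f1 f2] [g0 g1 g2]; split.
- by move=> p Vp; rewrite f0 // g0 // mulr0 addr0.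
- exact: (@holomorphic_on_lin C _ a (frame_coef1 f) (frame_coef1 g) V1 f1 g1).
have -> : frame_coef0 k (fun p => a * f p + g p) =
    fun w => a * frame_coef0 k f w + frame_coef0 k g w.
  by apply/funext => w; rewrite /frame_coef0; case: ifP => // _; rewrite mulrDr mulrCA.
exact: (@holomorphic_on_lin C _ a (frame_coef0 k f) (frame_coef0 k g) V0 f2 g2).
Qed.

(* A presheaf of vector spaces on P^1, all sections living in one ambient
   space. *)
Record presheaf := Presheaf {
  amb : lmodType C;
  sec : set P1 -> set amb;
  res : set P1 -> amb -> amb;
  sec0 : forall U, sec U 0;
  sec_lin : forall U (a : C) x y, P1_open U -> sec U x -> sec U y ->
    sec U (a *: x + y);
  res_lin : forall U (a : C) x y, res U (a *: x + y) = a *: res U x + res U y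
}.

End ProjectiveLine.

Arguments U0 R : clear implicits.
Arguments U1 R : clear implicits.
Arguments U01 R : clear implicits.

(* H^1(M, F) := F(U0 n U1) / (F(U0) + F(U1)), the Cech cohomology of the
   covering of M by the two affine lines.  The covering is Stein, so that this
   is H^1(M, F) for the coherent sheaves occurring below. *)
Section Cohomology.
Variables (R : realType) (F : presheaf R).
Local Notation C := R[i].

Definition cocycle_pred : {pred amb F} := [pred x | `[< sec (U01 R) x >]].

Fact cocycle_pred_submod : GRing.submod_closed cocycle_pred.
Proof.
split; first by apply/asboolP; exact: sec0.
by move=> a x y /asboolP hx /asboolP hy; apply/asboolP; apply: sec_lin => //;
  exact: P1_openU01.
Qed.
HB.instance Definition _ :=
  GRing.isSubmodClosed.Build C (amb F) cocycle_pred cocycle_pred_submod.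

Definition cocycle := {x : amb F | cocycle_pred x}.
HB.instance Definition _ := SubChoice.on cocycle.
HB.instance Definition _ := [SubChoice_isSubLmodule of cocycle by <:].

Definition coboundary : {pred cocycle} := [pred x | `[< exists a b,
  [/\ sec (U0 R) a, sec (U1 R) b &
      val x = res (U01 R) a + res (U01 R) b] >]].

Fact coboundary_lin (a : C) (x y : cocycle) :
  x \in coboundary -> y \in coboundary -> a *: x + y \in coboundary.
Proof.
move=> /asboolP[x0 [x1 [hx0 hx1 ex]]] /asboolP[y0 [y1 [hy0 hy1 ey]]].
apply/asboolP; exists (a *: x0 + y0), (a *: x1 + y1); split.
- by apply: sec_lin => //; exact: P1_openU0.
- by apply: sec_lin => //; exact: P1_openU1.
by rewrite linearP /= ex ey !res_lin scalerDr addrACA.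
Qed.

Fact coboundary0 : 0 \in coboundary.
Proof.
apply/asboolP; exists 0, 0; split; try exact: sec0.
by have := res_lin (U01 R) (-1) (0 : amb F) 0; rewrite scaler0 addr0 scaleN1r => ->;
  rewrite raddf0 addNr addr0.
Qed.

Fact coboundary_zmod : zmod_closed coboundary.
Proof.
split; first exact: coboundary0.
move=> x y hx hy; rewrite addrC -scaleN1r; exact: coboundary_lin.
Qed.
HB.instance Definition _ :=
  GRing.isZmodClosed.Build cocycle coboundary coboundary_zmod.

Definition H1 : Type := Quotient.quot (coboundary : zmodClosed cocycle).
HB.instance Definition _ := GRing.Zmodule.on H1.

Definition H1_class (x : cocycle) : H1 :=
  \pi_(Quotient.quot (coboundary : zmodClosed cocycle)) x.
Definition H1_repr (x : H1) : cocycle :=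
  repr (x : Quotient.quot (coboundary : zmodClosed cocycle)).
Definition H1_scale (a : C) (x : H1) : H1 := H1_class (a *: H1_repr x).

Lemma H1_reprK : cancel H1_repr H1_class.
Proof. by move=> x; rewrite /H1_class /H1_repr reprK. Qed.

Lemma H1_classD : {morph H1_class : x y / x + y}.
Proof. by move=> x y; rewrite /H1_class raddfD. Qed.

Lemma H1_class_eq (x y : cocycle) : (x - y \in coboundary) -> H1_class x = H1_class y.
Proof.
by move=> xy; apply/eqP; rewrite /H1_class -Quotient.idealrBE.
Qed.

Lemma H1_class_inv (x y : cocycle) : H1_class x = H1_class y -> x - y \in coboundary.
Proof. by move=> /eqP; rewrite /H1_class -Quotient.idealrBE. Qed.

Lemma H1_classZ (a : C) (x : cocycle) : H1_class (a *: x) = H1_scale a (H1_class x).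
Proof.
apply: H1_class_eq; rewrite -scalerBr -[_ *: _]addr0.
apply: coboundary_lin coboundary0; apply: H1_class_inv.
by rewrite H1_reprK.
Qed.

Lemma H1_scaleA a b (x : H1) : H1_scale a (H1_scale b x) = H1_scale (a * b) x.
Proof. by rewrite -[x]H1_reprK -!H1_classZ scalerA. Qed.
Lemma H1_scale1 : left_id 1 H1_scale.
Proof. by move=> x; rewrite -[x]H1_reprK -H1_classZ scale1r. Qed.
Lemma H1_scaleDr : right_distributive H1_scale +%R.
Proof.
move=> a x y; rewrite -[x]H1_reprK -[y]H1_reprK -H1_classD -!H1_classZ.
by rewrite scalerDr H1_classD.
Qed.
Lemma H1_scaleDl (x : H1) : {morph H1_scale^~ x : a b / a + b}.
Proof.
by move=> a b; rewrite -[x]H1_reprK -!H1_classZ scalerDl H1_classD.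
Qed.
HB.instance Definition _ := GRing.Zmodule_isLmodule.Build C H1
  H1_scaleA H1_scale1 H1_scaleDr H1_scaleDl.

Definition represents (a : amb F) (x : H1) : Prop :=
  exists2 z : cocycle, val z = a & H1_class z = x.

End Cohomology.

Section LineBundles.
Variable R : realType.
Local Notation C := R[i].
Local Notation P1 := (P1 R).

Definition O_sheaf (k : int) : presheaf R.
Proof.
apply: (@Presheaf R (P1 -> C^o) (O_sec k) (@restr R C^o)).
- by move=> U; exact: O_sec0.
- by move=> U a x y; exact: O_sec_lin.
- exact: restr_lin.
Defined.

(* (1/z) C[1/z]_{<= n}, an element being written as a polynomial in 1/z *)
Definition tail_poly (n : int) : set {poly C} :=
  [set p | exists2 q : {poly C}, p = 'X * q &
    q != 0 -> ((size q)%:Z - 1 <= n)%R].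

Definition tail_fun (p : {poly C}) : P1 -> C :=
  restr (U01 R) (fun x => if x is Some z then p.[z^-1] else 0 : C^o).

(* the isomorphism H^1(M, O(k)) = (1/z) C[1/z]_{<= -k-2} *)
Definition H1_O_ident (k : int) (y : H1 (O_sheaf k)) (p : {poly C}) : Prop :=
  tail_poly (- k - 2) p /\ represents (tail_fun p : amb (O_sheaf k)) y.

End LineBundles.

Section Exterior.
Variable R : realType.
Local Notation C := R[i].

(* The exterior algebra of C^3: [a S] is the coefficient of the product of the
   e_i, i in S, in increasing order. *)
Definition ext : Type := {ffun {set 'I_3} -> C^o}.
HB.instance Definition _ := GRing.Lmodule.on ext.

Definition ebase (S : {set 'I_3}) : ext := [ffun T => (T == S)%:R].

Definition inversions (A B : {set 'I_3}) : nat :=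
  #|[set p : 'I_3 * 'I_3 | [&& p.1 \in A, p.2 \in B & (p.2 < p.1)%N]]|.

Definition wedge (a b : ext) : ext :=
  [ffun S : {set 'I_3} => \sum_(A in powerset S)
     (-1) ^+ inversions A (S :\: A) * a A * b (S :\: A)].

(* the algebra endomorphism of the exterior algebra induced by g *)
Definition ext_map (g : 'M[C]_3) (a : ext) : ext :=
  \sum_(S : {set 'I_3}) a S *:
    \big[wedge/ebase finset.set0]_(j <- enum S)
       (\sum_(i < 3) g i j *: ebase [set i]%SET).

Lemma wedge_linl (c : C) (a a' b : ext) :
  wedge (c *: a + a') b = c *: wedge a b + wedge a' b.
Proof.
have Z (x : C^o) : c *: x = c * x by [].
apply/ffunP => S; rewrite !ffunE /= scaler_sumr -big_split; apply: eq_bigr => A _.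
by rewrite !ffunE /= !Z mulrDr mulrDl !mulrA [c * _]mulrC.
Qed.

Lemma wedge_linr (c : C) (a b b' : ext) :
  wedge a (c *: b + b') = c *: wedge a b + wedge a b'.
Proof.
have Z (x : C^o) : c *: x = c * x by [].
apply/ffunP => S; rewrite !ffunE /= scaler_sumr -big_split; apply: eq_bigr => A _.
by rewrite !ffunE /= !Z mulrDr [in LHS]mulrCA.
Qed.

End Exterior.

(* c_ij and d_ij in terms of l_i and l_j *)
Definition cdeg (a b : int) : int := - a - b - 4.
Definition ddeg (a b : int) : int := - a - b - 2.

(* the pairs i < j, indexed by 'I_3 *)
Definition pair_of (r : 'I_3) : 'I_3 * 'I_3 :=
  tnth [tuple (ord0, inord 1); (ord0, inord 2); (inord 1, inord 2)] r.

Section Supermanifold.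
Variables (R : realType) (l : 'I_3 -> int).
Local Notation C := R[i].
Local Notation P1 := (P1 R).
Local Notation ext := (ext R).

(* The exterior algebra of E is the sum over S of the line bundles
   O(\sum_(i in S) l i), with frame the product of the e_i, i in S, where e_i is
   the frame of O(l i) over the chart under consideration. *)
Definition ext_deg (S : {set 'I_3}) : int := \sum_(i in S) l i.

Definition LE_sec (V : set P1) (f : P1 -> ext) : Prop :=
  forall S, O_sec (ext_deg S) V (fun p => f p S).

Definition homogeneous (k : nat) (f : P1 -> ext) : Prop :=
  forall p (S : {set 'I_3}), #|S| != k -> f p S = 0.

(* Der_2(U): an even derivation of the sheaf of superalgebras over U is a
   family D V, for V open in U, compatible with restriction.  To have unique
   representatives, D V f := 0 whenever f is not a section over such a V. *)
Definition Der2_sec (U : set P1) (D : set P1 -> (P1 -> ext) -> P1 -> ext) :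
    Prop :=
  (forall V f, ~ [/\ P1_open V, V `<=` U & LE_sec V f] -> D V f = 0) /\
  forall V, P1_open V -> V `<=` U ->
  [/\ forall f, LE_sec V f -> LE_sec V (D V f),
      forall (a : C) f g, LE_sec V f -> LE_sec V g ->
        D V (a *: f + g) = a *: D V f + D V g,
      forall f g, LE_sec V f -> LE_sec V g ->
        D V (fun p => wedge (f p) (g p)) =
        (fun p => wedge (D V f p) (g p) + wedge (f p) (D V g p)),
      forall k f, LE_sec V f -> homogeneous k f ->
        homogeneous (k + 2)%N (D V f) &
      forall W f, P1_open W -> W `<=` V -> LE_sec V f ->
        D W (restr W f) = restr W (D V f)].

Lemma LE_sec0 V : LE_sec V 0.
Proof.
move=> S; rewrite (_ : (fun _ => _) = fun=> 0); first exact: O_sec0.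
by apply/funext => p; rewrite ffunE.
Qed.

Lemma LE_sec_lin V (a : C) (f g : P1 -> ext) : P1_open V ->
  LE_sec V f -> LE_sec V g -> LE_sec V (a *: f + g).
Proof.
move=> Vo hf hg S.
rewrite (_ : (fun _ => _) = fun p => a * f p S + g p S); first exact: O_sec_lin.
by apply/funext => p; rewrite !ffunE.
Qed.

Lemma Der2_sec0 U : Der2_sec U 0.
Proof.
have E V f : (0 : set P1 -> (P1 -> ext) -> P1 -> ext) V f = 0 by [].
have E0 p : (0 : P1 -> ext) p = 0 by [].
have w0l b : wedge 0 b = 0 :> ext.
  by have := wedge_linl (-1) 0 0 b; rewrite scaler0 addr0 scaleN1r addNr.
have w0r b : wedge b 0 = 0 :> ext.
  by have := wedge_linr (-1) b 0 0; rewrite scaler0 addr0 scaleN1r addNr.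
split=> [V f _|V Vo VU]; [exact: E|split].
- by move=> f _; rewrite E; exact: LE_sec0.
- by move=> a f g _ _; rewrite !E scaler0 addr0.
- by move=> f g _ _; apply/funext => p; rewrite !E !E0 w0l w0r addr0.
- by move=> k f _ _ p S _; rewrite E E0 ffunE.
- move=> W f _ _ _; rewrite !E; apply/funext => p.
  by rewrite /restr E0; case: ifP.
Qed.

Lemma Der2_sec_lin U (a : C) D D' : P1_open U ->
  Der2_sec U D -> Der2_sec U D' -> Der2_sec U (a *: D + D').
Proof.
have E (c : C) X Y (V : set P1) (f : P1 -> ext) : (c *: X + Y : set P1 -> (P1 -> ext) -> P1 -> ext) V f =
    c *: X V f + Y V f by [].
have E1 (c : C) (f g : P1 -> ext) p : (c *: f + g) p = c *: f p + g p by [].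
move=> _ [D0 D1] [D0' D1']; split.
  by move=> V f nf; rewrite E D0 // D0' // scaler0 addr0.
move=> V Vo VU; have [A1 A2 A3 A4 A5] := D1 V Vo VU.
have [B1 B2 B3 B4 B5] := D1' V Vo VU; split.
- by move=> f hf; rewrite E; exact: (LE_sec_lin a Vo (A1 f hf) (B1 f hf)).
- move=> b f g hf hg; rewrite !E (A2 b f g hf hg) (B2 b f g hf hg).
  by rewrite !scalerDr !scalerA [a * b]mulrC addrACA.
- move=> f g hf hg; rewrite !E (A3 f g hf hg) (B3 f g hf hg).
  apply/funext => p.
  change (a *: (wedge (D V f p) (g p) + wedge (f p) (D V g p)) +
      (wedge (D' V f p) (g p) + wedge (f p) (D' V g p)) =
    wedge (a *: D V f p + D' V f p) (g p) +
      wedge (f p) (a *: D V g p + D' V g p)).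
  by rewrite wedge_linl wedge_linr scalerDr addrACA.
- move=> k f hf hk p S hS; rewrite E E1 !ffunE.
  by rewrite (A4 k f hf hk p S hS) (B4 k f hf hk p S hS) scaler0 addr0.
move=> W f Wo WV hf; rewrite !E (A5 W f Wo WV hf) (B5 W f Wo WV hf).
by rewrite restr_lin.
Qed.

Definition Der2_sheaf : presheaf R.
Proof.
apply: (@Presheaf R (set P1 -> (P1 -> ext) -> P1 -> ext) Der2_sec
  (fun U D V => if `[< V `<=` U >] then D V else 0)).
- exact: Der2_sec0.
- by move=> U a x y; exact: Der2_sec_lin.
- move=> U a x y; apply/funext => V /=.
  have E (c : C) X Y : (c *: X + Y : set P1 -> (P1 -> ext) -> P1 -> ext) V =
    c *: X V + Y V by [].
  by rewrite !E; case: ifP => // _; rewrite scaler0 addr0.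
Defined.

Local Notation H := (H1 Der2_sheaf).

(* U(E): unitary matrices which are block diagonal for the grouping of the
   indices i by the value of l i.  The frames of E over the two charts differ
   by diag(z^(l i)), which commutes with such matrices, so that they act on O_E
   by the same matrix in both frames. *)
Definition UE : set 'M[C]_3 :=
  [set g | g \is unitarymx /\ forall i j, l i != l j -> g i j = 0].

Definition Der2_conj (g : 'M[C]_3) (D : set P1 -> (P1 -> ext) -> P1 -> ext) :
    set P1 -> (P1 -> ext) -> P1 -> ext :=
  fun V f p => ext_map g (D V (fun x => ext_map (invmx g) (f x)) p).

(* y is the class g x: some representative D of x is conjugated by g to a
   representative of y. *)
Definition UE_act (g : 'M[C]_3) (x y : H) : Prop :=
  exists D : amb Der2_sheaf,
    represents D x /\ represents (Der2_conj g D : amb Der2_sheaf) y.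

Definition UE_orbit (x : H) : set H :=
  [set y | exists2 g, UE g & UE_act g x y].

Definition invariant_metric (h : H -> H -> C) : Prop :=
  [/\ forall (a : C) x x' y, h (a *: x + x') y = a * h x y + h x' y,
      forall x y, h y x = Num.conj (h x y),
      forall x, x != 0 -> 0 < h x x &
      forall g x y x' y', UE g -> UE_act g x x' -> UE_act g y y' ->
        h x' y' = h x y].

Local Notation i_ r := (pair_of r).1.
Local Notation j_ r := (pair_of r).2.
Local Notation S_ r := [set i_ r; j_ r]%SET.

Definition z_coord : P1 -> ext :=
  restr (U01 R) (fun x => if x is Some z then z *: ebase R finset.set0 else 0).

(* The class of a derivation D in H^1(M, Der(O_M) (x) Lambda^2 E) corresponds
   to p: over U01 the restriction of D to O_M is D(z) d/dz, and d/dz is the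
   frame of Der(O_M) = O(2) over U1. *)
Definition restriction_ident (x : H) (p : 'I_3 -> {poly C}) : Prop :=
  exists2 D : amb Der2_sheaf, represents D x & forall r,
    exists2 y : H1 (O_sheaf R (l (i_ r) + l (j_ r) + 2)),
      represents ((fun s => D (U01 R) z_coord s (S_ r)) : amb (O_sheaf R _)) y
      & H1_O_ident y (p r).

(* D is the image of the section e |-> omega /\ e of Hom(Lambda^1 E, Lambda^3 E),
   where omega is a section of Lambda^2 E over U01 *)
Definition vertical (omega : P1 -> ext) (D : amb Der2_sheaf) : Prop :=
  [/\ LE_sec (U01 R) omega, homogeneous 2 omega &
    forall V f, P1_open V -> V `<=` U01 R -> LE_sec V f ->
      (homogeneous 0 f -> D V f = 0) /\
      (homogeneous 1 f -> D V f = fun s => wedge (restr V omega s) (f s))].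

(* the image of H^1(M, Hom(Lambda^1 E, Lambda^3 E)) in H^1(M, Der_2) *)
Definition H1_vertical : set H :=
  [set x | exists omega D, represents D x /\ vertical omega D].

(* The class of D corresponds to q under Lambda^2 E = Hom(Lambda^1 E, Lambda^3 E),
   omega |-> (e |-> omega /\ e). *)
Definition vertical_ident (x : H) (q : 'I_3 -> {poly C}) : Prop :=
  exists omega D, [/\ represents D x, vertical omega D & forall r,
    exists2 y : H1 (O_sheaf R (l (i_ r) + l (j_ r))),
      represents ((fun s => omega s (S_ r)) : amb (O_sheaf R _)) y
      & H1_O_ident y (q r)].

(* The first identification: x is split along the image of
   H^1(M, Hom(Lambda^1 E, Lambda^3 E)) and its h-orthogonal complement. *)
Definition H1_Der2_ident (h : H -> H -> C) (x : H) (p q : 'I_3 -> {poly C}) :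
    Prop :=
  exists xh xv, [/\ x = xh + xv, forall v, H1_vertical v -> h xh v = 0,
    H1_vertical xv, restriction_ident xh p & vertical_ident xv q].

Local Notation c_ r := (cdeg (l (i_ r)) (l (j_ r))).
Local Notation d_ r := (ddeg (l (i_ r)) (l (j_ r))).

(* Phi is the composite of the first identification, which determines p and q,
   with (p, q) |-> p + z^(-c-1) q; 'X stands for 1 / z. *)
Definition is_identification (h : H -> H -> C) (Phi : H -> 'cV[{poly C}]_3) :
    Prop :=
  [/\ forall (a : C) x y, Phi (a *: x + y) = a%:P *: Phi x + Phi y,
      injective Phi,
      range Phi = [set v | forall r, tail_poly (c_ r + d_ r + 1) (v r 0)] &
      forall x, exists p q, H1_Der2_ident h x p q /\
        forall r, Phi x r 0 = p r + 'X^(absz (c_ r + 1)) * q r].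

End Supermanifold.

Section OrbitSets.
Variable R : realType.
Local Notation C := R[i].

(* \mathbb V_k^n, the polynomials being in 1 / z *)
Definition orbit_set (k : nat) (n : int) : set (set 'cV[{poly C}]_k) :=
  if (0 <= n)%R then
    [set [set map_mx polyC g *m v | g in [set g : 'M[C]_k | g \is unitarymx]]
      | v in [set v : 'cV[{poly C}]_k | forall i, tail_poly n (v i 0)]]
  else [set [set 0]].

Definition orbit_prod (k m : nat) (A : set (set 'cV[{poly C}]_k))
    (B : set (set 'cV[{poly C}]_m)) : set (set 'cV[{poly C}]_(k + m)) :=
  [set [set col_mx u v | u in X & v in Y] | X in A & Y in B].

End OrbitSets.

Arguments orbit_set R k n : clear implicits.

(* Main.v *)
(* A section D of Der_2 over U0 n U1 is given by D z = a and D e_j = b /\ e_j for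
   two families a, b of functions on C^*, sections of Lambda^2 E.  Passing to the
   chart w = 1 / z multiplies the (i, j) components of a and b by powers of z with
   exponents k + 2 and k, where k = l_i + l_j, and adds to b a multiple of a.  As
   k + 2 < 0, Laurent series show that every class has a unique representative
   a = P(1/z), b = Q(1/z) with P and Q tails of the prescribed degrees.  A matrix g
   in U(E) acts on P and on Q by its second compound Lambda^2 g.

   For an invariant metric, every P has a unique lift (P, S(P)) orthogonal to the
   vertical classes (0, Q).  By uniqueness S is linear and U(E)-equivariant, hence
   so is the identification (P, Q) |-> P + z^(-c-1) (Q - S(P)).

   Since Lambda^2 (Lambda^2 B) = det B . B, the matrices Lambda^2 g for g in U(E)
   are exactly the unitary matrices which are block diagonal for the grouping of
   the pairs by l_i + l_j; these blocks give the factors of the orbit sets. *)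

Require Import Defs.
From HB Require Import structures.
From mathcomp Require Import all_boot all_order all_algebra.
From mathcomp Require Import all_classical all_reals all_analysis.
From mathcomp Require Import spectral generic_quotient ring_quotient complex.
From mathcomp Require Import zify ring lra.

Set Implicit Arguments.
Unset Strict Implicit.
Unset Printing Implicit Defensive.

Import Order.TTheory GRing.Theory Num.Theory.
Import numFieldNormedType.Exports.

Local Open Scope classical_set_scope.
Local Open Scope ring_scope.
Local Open Scope complex_scope.

Local Notation Re := complex.Re.
Local Notation Im := complex.Im.
Local Notation pi := trigo.pi.

(** * Cauchy's formula and Laurent series over R[i] *)

(** The function theory rests on means over circles. The r-derivative of the mean of G over |z| = r
    is the mean of G'(z) e^{it}, which is 1/(ir) times the mean of an angular derivative over a full
    period, hence 0. Comparing circles then leads up to Laurent series.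

    That a and b determine D uses no continuity of D: at a point p one writes phi = phi(p) + (z - p)
    phi1, and Leibniz gives D phi = phi1(p) D z at p.

    As the chart change adds a multiple of a to b, normal forms are triangular: uniqueness for a
    must also show that the section over U0 used to correct a vanishes, since otherwise it would
    disturb b.

    P and Q carry the same action of Lambda^2 g, so an invariant metric may mix them and S need not
    be 0. Hence equivariance of S is drawn from uniqueness of the lift and not from a formula.

    A unitary B in block form is reached by c Lambda^2 B with c^2 det B = 1. The blocks match
    because two distinct pairs share exactly one index, so sums of pair degrees recover the l_i up
    to the constant l_1 + l_2 + l_3. *)

Section Cabs.
Variable R : realType.
Local Notation C := R[i].
Implicit Types z w : C.

(** The norm of [R[i]] takes its values in [R[i]]; integrals and linear arithmetic need it as an
    element of [R]. *)
Definition cabs z : R := Re `|z|.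

Lemma cabsE z : `|z| = (cabs z)%:C.
Proof. by rewrite /cabs RRe_real // normr_real. Qed.

Lemma cabsM z w : cabs (z * w) = cabs z * cabs w.
Proof. by apply: complexI; rewrite rmorphM -!cabsE normrM. Qed.

Lemma cabsV z : cabs z^-1 = (cabs z)^-1.
Proof. by apply: complexI; rewrite fmorphV -!cabsE normfV. Qed.

Lemma ler_cabsD z w : cabs (z + w) <= cabs z + cabs w.
Proof. by rewrite -lecR rmorphD -!cabsE ler_normD. Qed.

Lemma cabs_ge0 z : 0 <= cabs z.
Proof. by rewrite -lecR -cabsE; exact: normr_ge0. Qed.

Lemma cabs0 : cabs 0 = 0.
Proof. by rewrite /cabs normr0. Qed.

Lemma cabs1 : cabs 1 = 1.
Proof. by rewrite /cabs normr1. Qed.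

Lemma cabs_eq0 z : (cabs z == 0) = (z == 0).
Proof. by rewrite -(inj_eq (@complexI R)) -cabsE normr_eq0. Qed.

Lemma cabs_gt0 z : (0 < cabs z) = (z != 0).
Proof. by rewrite lt0r cabs_eq0 cabs_ge0 andbT. Qed.

Lemma cabsN z : cabs (- z) = cabs z.
Proof. by rewrite /cabs normrN. Qed.

Lemma cabsB z w : cabs (z - w) = cabs (w - z).
Proof. by rewrite -cabsN opprB. Qed.

Lemma cabsX z n : cabs (z ^+ n) = cabs z ^+ n.
Proof. by elim: n => [|n IH]; rewrite ?cabs1 // !exprS cabsM IH. Qed.

Lemma cabsR (r : R) : cabs r%:C = `|r|.
Proof. by apply: complexI; rewrite -cabsE normc_def /= expr0n addr0 sqrtr_sqr. Qed.

Lemma ler_cabs_dist z w : cabs z - cabs w <= cabs (z - w).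
Proof. by rewrite lerBlDr; have := ler_cabsD (z - w) w; rewrite subrK. Qed.

Lemma normr_Re_le z : `|Re z| <= cabs z.
Proof. by rewrite -lecR -cabsE normc_ge_Re. Qed.

Lemma normr_Im_le z : `|Im z| <= cabs z.
Proof.
have := normr_Re_le (z * 'i%C); rewrite ReiNIm normrN cabsM.
suff -> : cabs 'i%C = 1 :> R by rewrite mulr1.
by apply: complexI; rewrite -cabsE normc_def /= expr0n expr1n add0r sqrtr1.
Qed.

Lemma cabs_le_ReIm z : cabs z <= `|Re z| + `|Im z|.
Proof.
rewrite {1}[z]complexE (le_trans (ler_cabsD _ _)) // cabsM !cabsR.
suff -> : cabs 'i%C = 1 :> R by rewrite mul1r.
by apply: complexI; rewrite -cabsE normc_def /= expr0n expr1n add0r sqrtr1.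
Qed.

Lemma ltc0P (e : C) : 0 < e -> exists2 d : R, 0 < d & e = d%:C.
Proof.
move=> e0; have /complex_realP[d ed] : e \is Num.real by rewrite realE (ltW e0).
by exists d; rewrite // -ltcR -ed.
Qed.

Lemma cvgcP T (F : set_system T) (FF : Filter F) (f : T -> C^o) (l : C^o) :
  f @ F --> l <-> forall e : R, 0 < e -> \forall x \near F, cabs (l - f x) < e.
Proof.
split=> [/cvgrPdist_lt h e e0|h]; last apply/cvgrPdist_lt => e /ltc0P[d d0 ->].
  have /h : 0 < e%:C :> C by rewrite ltcR.
  by apply: filterS => x; rewrite cabsE ltcR.
by have := h d d0; apply: filterS => x; rewrite cabsE ltcR.
Qed.

Lemma nbhscP (z : C^o) (P : set C) :
  nbhs z P <-> exists2 d : R, 0 < d & forall w, cabs (w - z) < d -> P w.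
Proof.
split=> [/(@nbhs_normP C C^o z P)[e /= /ltc0P[d d0 ->] h]|[d d0 h]].
  by exists d => // w wz; apply: h; rewrite /= distrC cabsE ltcR.
apply/(@nbhs_normP C C^o z P); exists d%:C => /=; first by rewrite ltcR.
by move=> w; rewrite /= distrC cabsE ltcR => /h.
Qed.

Lemma continuousc_at (f : C -> C) (z : C) :
  {for z, continuous (f : C^o -> C^o)} <->
  forall e : R, 0 < e -> exists2 d : R, 0 < d &
    forall w, cabs (w - z) < d -> cabs (f w - f z) < e.
Proof.
have E := @cvgcP (C^o) (nbhs (z : C^o)) _ f (f z).
split=> [/E h e /h/nbhscP[d d0 hd]|h].
  by exists d => // w /hd; rewrite cabsB.
apply/E => e /h[d d0 hd]; apply/nbhscP; exists d => // w /hd.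
by rewrite cabsB.
Qed.

Lemma Re_continuous : continuous (@complex.Re R : C^o -> R^o).
Proof.
move=> z; apply/(@cvgrPdist_lt R R^o (C^o) (nbhs z) _ (@complex.Re R) (Re z)).
move=> e e0; apply/nbhscP; exists e => // w wz.
by rewrite distrC -raddfB (le_lt_trans (normr_Re_le _)).
Qed.

Lemma Im_continuous : continuous (@complex.Im R : C^o -> R^o).
Proof.
move=> z; apply/(@cvgrPdist_lt R R^o (C^o) (nbhs z) _ (@complex.Im R) (Im z)).
move=> e e0; apply/nbhscP; exists e => // w wz.
by rewrite distrC -raddfB (le_lt_trans (normr_Im_le _)).
Qed.

Lemma cvgc_ReIm T (F : set_system T) (FF : Filter F) (f : T -> C^o) (l : C^o) :
  (Re (f x) @[x --> F] --> (Re l : R^o)) -> (Im (f x) @[x --> F] --> (Im l : R^o)) ->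
  f @ F --> l.
Proof.
move=> /cvgrPdist_lt hr /cvgrPdist_lt hi; apply/cvgcP => e e0.
have e2 : 0 < e / 2 by lra.
apply: filterS (filterI (hr _ e2) (hi _ e2)) => x /= [a b].
apply: (le_lt_trans (cabs_le_ReIm _)); rewrite !raddfB /=; lra.
Qed.

End Cabs.

(** * Means of real functions over a full period *)

Section RealMean.
Variable R : realType.
Local Notation mu := (@lebesgue_measure R).

Definition rmean (g : R -> R) : R :=
  (pi *+ 2)^-1 * \int[mu]_(t in `[0, pi *+ 2]) g t.

Lemma twopi_gt0 : 0 < pi *+ 2 :> R.
Proof. by rewrite pmulrn_lgt0 // pi_gt0. Qed.

Lemma cont_integrable (g : R -> R) : continuous g ->
  mu.-integrable `[0, pi *+ 2] (EFin \o g).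
Proof.
move=> cg; apply: continuous_compact_integrable; first exact: segment_compact.
exact: continuous_subspaceT.
Qed.

Lemma rmean_lin (a b : R) (f g : R -> R) : continuous f -> continuous g ->
  rmean (fun t => a * f t + b * g t) = a * rmean f + b * rmean g.
Proof.
move=> cf cg; have If := cont_integrable cf; have Ig := cont_integrable cg.
have cZ (c : R) (h : R -> R) : continuous h -> continuous (fun t => c * h t).
  by move=> ch t; exact: (cvgMl_tmp (ch t)).
rewrite /rmean RintegralD //; try by apply: cont_integrable; exact: cZ.
by rewrite !RintegralZl //; ring.
Qed.

Lemma rmean_cst c : rmean (fun=> c) = c.
Proof.
rewrite /rmean Rintegral_cst //= lebesgue_measure_itv /= lte_fin twopi_gt0.
by rewrite oppr0 addr0 /= mulrCA mulVf ?mulr1 // gt_eqF // twopi_gt0.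
Qed.

Lemma rmean_le (f g : R -> R) : continuous f -> continuous g ->
  (forall t, 0 <= t <= pi *+ 2 -> f t <= g t) -> rmean f <= rmean g.
Proof.
move=> cf cg fg; rewrite /rmean ler_pM2l ?invr_gt0 ?twopi_gt0 //.
apply: le_Rintegral; [by []|exact: cont_integrable|exact: cont_integrable|].
by move=> t; rewrite /= in_itv; exact: fg.
Qed.

Lemma rmean_bound (g : R -> R) B : continuous g ->
  (forall t, 0 <= t <= pi *+ 2 -> `|g t| <= B) -> `|rmean g| <= B.
Proof.
move=> cg gB; rewrite ler_norml.
have cc (c : R) : continuous (fun _ : R => c) by move=> c'; exact: cvg_cst.
by apply/andP; split; [rewrite -[- B]rmean_cst|rewrite -[leRHS]rmean_cst];
  apply: rmean_le => // t ht; have := gB t ht;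
  rewrite ler_norml => /andP[].
Qed.

(** The fundamental theorem of calculus over a period; this is where the closedness of a circle
    enters. *)
Lemma rmean_deriv (g g' : R -> R) : (forall t : R, is_derive t 1 g (g' t)) ->
  continuous g' -> g (pi *+ 2) = g 0 -> rmean g' = 0.
Proof.
move=> dg cg' per; rewrite /rmean /Rintegral.
have dg1 (t : R) : derivable g t 1 by [].
have cg (t : R) : {for t, continuous g}.
  by apply/differentiable_continuous/derivable1_diffP.
rewrite (@continuous_FTC2 R g' g 0 (pi *+ 2)) ?twopi_gt0 //.
- by rewrite per /= subrr mulr0.
- exact: continuous_subspaceT.
- split=> //; [move: (cg 0)|move: (cg (pi *+ 2))] => h.
    exact: cvg_at_right_filter.
  exact: cvg_at_left_filter.
- by move=> t _; rewrite derive1E derive_val.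
Qed.

(** Dominated convergence: the constant M is integrable because the range of t is bounded. *)
Lemma rmean_param_cont (f : R -> R -> R) M :
  (forall x, continuous (f x)) -> (forall y, continuous (f ^~ y)) ->
  (forall x y, 0 <= y <= pi *+ 2 -> `|f x y| <= M) -> continuous (fun x => rmean (f x)).
Proof.
move=> c1 c2 hM x.
have [v1 v2] : x - 1 < x < x + 1 /\ True by split => //; apply/andP; split; lra.
suff h : {for x, continuous (fun x => \int[mu]_(t in `[0, pi *+ 2]) f x t)}.
  exact: (cvgMl_tmp h).
have := @continuity_under_integral R _ _ mu f `[0, pi *+ 2] _ (x - 1) (x + 1) _ _ (fun=> M).
move=> h; apply: h => //.
- by move=> z _; apply: cont_integrable.
- by apply: aeW => y _ z _; exact: c2.
- by apply: cont_integrable => z; exact: cvg_cst.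
- by move=> z _; apply: aeW => y; rewrite /= in_itv; exact: hM.
- by rewrite inE /= in_itv.
Qed.

Lemma rmean_param_deriv (f f' : R -> R -> R) M a b x : a < x < b ->
  (forall x, continuous (f x)) ->
  (forall x y : R, a < x < b -> is_derive x 1 (f ^~ y) (f' x y)) ->
  (forall x y, a < x < b -> 0 <= y <= pi *+ 2 -> `|f' x y| <= M) ->
  is_derive x 1 (fun x => rmean (f x)) (rmean (f' x)).
Proof.
move=> xab cf df hM.
have M0 : 0 <= M.
  apply: le_trans (normr_ge0 (f' x 0)) (hM x 0 xab _).
  by rewrite lexx /= ltW // twopi_gt0.
have I z : `]a, b[%classic z -> a < z < b by rewrite /= in_itv.
have P1 z y : a < z < b -> partial1of2 f z y = f' z y.
  by move=> /(df z y) dz; rewrite partial1of2E derive_val.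
have H1 := @cvg_differentiation_under_integral R _ _ mu f `[0, pi *+ 2] _ x a b.
have {}H1 : h^-1 *: (\int[mu]_(y in `[0, pi *+ 2]) f (h + x) y - \int[mu]_(y in `[0, pi *+ 2]) f x y) @[h --> 0^'] --> \int[mu]_(y in `[0, pi *+ 2]) f' x y.
  rewrite -(@eq_Rintegral _ _ _ mu _ (f' x) (partial1of2 f x)); last by move=> y _; rewrite P1.
  apply: (H1 _ _ _ _ (fun=> M)) => //.
  - by move=> z _; apply: cont_integrable.
  - by move=> z y /I zab _; case: (df z y zab).
  - by apply: cont_integrable => z; exact: cvg_cst.
  - by move=> z y /I zab; rewrite /= in_itv /= P1 // => hy; apply: hM.
have H2 : is_derive x 1 (fun x => \int[mu]_(y in `[0, pi *+ 2]) f x y) (\int[mu]_(y in `[0, pi *+ 2]) f' x y).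
  apply: DeriveDef; first by apply/cvg_ex; exists (\int[mu]_(y in `[0, pi *+ 2]) f' x y); under eq_fun do rewrite [_ *: 1]mulr1.
  by rewrite -derive1E; apply/cvg_lim.
exact: (is_deriveZ (pi *+ 2)^-1 H2).
Qed.

End RealMean.

(** A form without quotients, common to real and complex derivatives. The chain rule along a curve,
    where a real increment meets a complex derivative, is proved from it in [pderiv_comp]. *)
Lemma is_derive_litP (K : numFieldType) (f : K^o -> K^o) (x d : K^o) :
  is_derive x 1 f d <-> forall e : K, 0 < e -> exists2 delta : K, 0 < delta &
    forall h : K, `|h| < delta -> `|f (h + x) - f x - d * h| <= e * `|h|.
Proof.
have E (h : K) : h != 0 -> forall e : K, (`|d - h^-1 *: (f (h *: 1 + x) - f x)| <= e) =
    (`|f (h + x) - f x - d * h| <= e * `|h|).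
  move=> h0 e; rewrite [h *: 1]mulr1.
  rewrite (_ : d - _ = - (h^-1 * (f (h + x) - f x - d * h))).
    by rewrite normrN normrM normfV ler_pdivrMl ?normr_gt0 // [`|h| * e]mulrC.
  rewrite mulrBr opprB [d * h]mulrC mulKf // /GRing.scale //=.
split=> [df e e0|H].
  have dc := @ex_derive _ _ _ _ _ _ _ df.
  have : h^-1 *: (f (h *: 1 + x) - f x) @[h --> 0^'] --> (d : K^o).
    by rewrite -(@derive_val _ _ _ _ _ _ _ df).
  move=> /cvgrPdist_le/(_ e e0).
  rewrite near_withinE => /(@nbhs_norm0P K K^o _)[delta /= d0 hd].
  exists delta => // h hdelta; have [->|h0] := eqVneq h 0.
    by rewrite add0r subrr mulr0 subr0 normr0 mulr0.
  by rewrite -E //; apply: hd.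
have lim : h^-1 *: (f (h *: 1 + x) - f x) @[h --> 0^'] --> (d : K^o).
  apply/cvgrPdist_le => e e0; have [delta d0 hd] := H e e0.
  rewrite near_withinE; apply/(@nbhs_norm0P K K^o _); exists delta => //= h hh h0.
  by rewrite E //; apply: hd.
apply: DeriveDef; first by apply/cvg_ex; exists d.
by apply/cvg_lim.
Qed.

(** * Holomorphic functions with an explicit derivative *)

Section Hol.
Variable R : realType.
Local Notation C := R[i].
Implicit Types (z w : C) (f g : C -> C).

Lemma is_derivecP f z (d : C) :
  is_derive (z : C^o) 1 (f : C^o -> C^o) d <->
  forall e : R, 0 < e -> exists2 delta : R, 0 < delta &
    forall h, cabs h < delta -> cabs (f (h + z) - f z - d * h) <= e * cabs h.
Proof.
rewrite is_derive_litP; split=> H.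
  move=> e e0; have [|delta /ltc0P[b b0 ->] hb] := H e%:C; first by rewrite ltcR.
  exists b => // h hh; have := hb h; rewrite !cabsE -rmorphM /= lecR; apply.
  by rewrite ltcR.
move=> e /ltc0P[a a0 ->]; have [b b0 hb] := H a a0.
exists b%:C; first by rewrite ltcR.
by move=> h; rewrite !cabsE -rmorphM /= lecR ltcR; exact: hb.
Qed.

(** Carrying f' as data lets the closure lemmas compute it. Its continuity bounds f' on compact
    annuli, as differentiation under the integral sign requires. *)
Record hol (V : set C) (f f' : C -> C) : Prop := Hol { holP : forall z, V z ->
  is_derive (z : C^o) 1 (f : C^o -> C^o) (f' z) /\
  {for z, continuous (f' : C^o -> C^o)} }.
Coercion holP : hol >-> Funclass.
Arguments holP {V f f'} _ z _.

Lemma is_derivec_cont f z (d : C) : is_derive (z : C^o) 1 (f : C^o -> C^o) d ->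
  {for z, continuous (f : C^o -> C^o)}.
Proof.
by move=> df; apply/differentiable_continuous/derivable1_diffP.
Qed.

Lemma hol_holomorphic V f f' : open (V : set C^o) -> hol V f f' ->
  holomorphic_on V f.
Proof.
move=> Vo h z Vz; split; first exact: (@ex_derive _ _ _ _ _ _ _ (h z Vz).1).
have E : {near (z : C^o), f' =1 derive1 (f : C^o -> C^o)}.
  have Vn : nbhs (z : C^o) V by exact: open_nbhs_nbhs.
  by apply: filterS Vn => x Vx; rewrite derive1E (@derive_val _ _ _ _ _ _ _ (h x Vx).1).
have [_ c] := h z Vz.
rewrite /prop_for /continuous_at -(nbhs_singleton E).
exact: cvg_trans (near_eq_cvg E) c.
Qed.

Lemma holomorphic_hol V f : holomorphic_on V f -> hol V f (derive1 (f : C^o -> C^o)).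
Proof.
move=> h; apply: Hol => z Vz; have [a b] := h z Vz; split; last exact: b.
by apply: DeriveDef; [exact: a|rewrite derive1E].
Qed.

Lemma hol_eq V f f' g : open (V : set C^o) -> hol V f f' -> (forall z, V z -> f z = g z) ->
  hol V g f'.
Proof.
move=> Vo h fg; apply: Hol => z Vz; have [d c] := h z Vz; split; last exact: c.
apply: near_eq_is_derive d.
have Vn : nbhs (z : C^o) V by exact: open_nbhs_nbhs.
by apply: filterS Vn => x Vx; rewrite fg.
Qed.

Lemma hol_eq' V f f' g' : open (V : set C^o) -> hol V f f' -> (forall z, V z -> f' z = g' z) ->
  hol V f g'.
Proof.
move=> Vo h fg; apply: Hol => z Vz; have [d c] := h z Vz; split; first by rewrite -fg //; exact: d.
have Vn : nbhs (z : C^o) V by exact: open_nbhs_nbhs.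
have E : {near (z : C^o), f' =1 g'} by apply: filterS Vn => x Vx; rewrite fg.
rewrite /prop_for /continuous_at -(nbhs_singleton E).
exact: cvg_trans (near_eq_cvg E) c.
Qed.

Lemma hol_ext V f f' g g' : f =1 g -> f' =1 g' -> hol V f f' -> hol V g g'.
Proof. by move=> /funext-> /funext->. Qed.

Lemma hol_sub V W f f' : W `<=` V -> hol V f f' -> hol W f f'.
Proof. by move=> WV h; apply: Hol => z /WV; exact: h. Qed.

Lemma hol_cst V c : hol V (fun=> c) (fun=> 0).
Proof. by apply: Hol => z _; split; [exact: is_derive_cst|exact: cst_continuous]. Qed.

Lemma hol_id V : hol V id (fun=> 1).
Proof. by apply: Hol => z _; split; [exact: is_derive_id|exact: cst_continuous]. Qed.

Lemma holD V f f' g g' : hol V f f' -> hol V g g' ->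
  hol V (fun z => f z + g z) (fun z => f' z + g' z).
Proof.
move=> hf hg; apply: Hol => z Vz; have [a b] := hf z Vz; have [c d] := hg z Vz; split.
  exact: is_deriveD.
exact: (continuousD b d).
Qed.

Lemma holM V f f' g g' : hol V f f' -> hol V g g' ->
  hol V (fun z => f z * g z) (fun z => f' z * g z + f z * g' z).
Proof.
move=> hf hg; apply: Hol => z Vz; have [a b] := hf z Vz; have [c d] := hg z Vz; split.
  have H := @is_deriveM C (C^o) f g z 1 (f' z) (g' z) a c.
  by apply: (is_derive_eq H); rewrite /GRing.scale /= [g z * _]mulrC addrC.
have cf := is_derivec_cont a; have cg := is_derivec_cont c.
exact: (continuousD (continuousM b cg) (continuousM cf d)).
Qed.

Lemma hol_sum V (I : finType) (P : pred I) (f f' : I -> C -> C) :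
  (forall i, hol V (f i) (f' i)) ->
  hol V (fun z => \sum_(i | P i) f i z) (fun z => \sum_(i | P i) f' i z).
Proof.
move=> h.
have H (s : seq I) : hol V (fun z => \sum_(i <- s | P i) f i z) (fun z => \sum_(i <- s | P i) f' i z).
  elim: s => [|a s IH].
    by apply: (hol_ext _ _ (hol_cst V 0)) => z; rewrite big_nil.
  have [Pa|Pa] := boolP (P a).
    by apply: (hol_ext _ _ (holD (h a) IH)) => z; rewrite big_cons Pa.
  by apply: (hol_ext _ _ IH) => z; rewrite big_cons (negbTE Pa).
exact: H.
Qed.

Lemma holV V f f' : (forall z, V z -> f z != 0) -> hol V f f' ->
  hol V (fun z => (f z)^-1) (fun z => - f' z / f z ^+ 2).
Proof.
move=> f0 hf; apply: Hol => z Vz; have [a b] := hf z Vz; have fz := f0 z Vz.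
have cf := is_derivec_cont a; split.
  have df : differentiable (f : C^o -> C^o) (z : C^o).
    by apply/derivable1_diffP; exact: (@ex_derive _ _ _ _ _ _ _ a).
  have H := differentiableV df fz.
  apply: DeriveDef; first exact/derivable1_diffP.
  rewrite deriveE // diffV //= -deriveE // (@derive_val _ _ _ _ _ _ _ a).
  by rewrite /GRing.scale /= mulrC mulNr mulrN.
have c2 := continuousM cf cf.
have n2 : f z * f z != 0 by rewrite mulf_neq0.
exact: (continuousM (continuousN b) (continuousV n2 c2)).
Qed.

Lemma hol_comp V f f' g g' : hol V g g' -> hol (g @` V) f f' ->
  hol V (fun z => f (g z)) (fun z => f' (g z) * g' z).
Proof.
move=> hg hf; apply: Hol => z Vz; have [a b] := hg z Vz.
have [c d] := hf (g z) (ex_intro2 _ _ z Vz erefl).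
have cg := is_derivec_cont a; split; last first.
  by apply: (continuousM _ b); apply: (continuous_comp cg d).
have da : differentiable (g : C^o -> C^o) (z : C^o).
  by apply/derivable1_diffP; exact: (@ex_derive _ _ _ _ _ _ _ a).
have dc : differentiable (f : C^o -> C^o) (g z : C^o).
  by apply/derivable1_diffP; exact: (@ex_derive _ _ _ _ _ _ _ c).
have dfg := differentiable_comp da dc.
apply: DeriveDef; first exact/derivable1_diffP.
change ('D_1 ((f : C^o -> C^o) \o (g : C^o -> C^o)) (z : C^o) = f' (g z) * g' z).
rewrite deriveE; last exact: dfg.
rewrite (diff_comp da dc) /=.
have E1 : 'd (g : C^o -> C^o) (z : C^o) (1 : C^o) = g' z.
  by rewrite -(deriveE _ da) (@derive_val _ _ _ _ _ _ _ a).
have E2 := @deriv1E C (C^o) f (g z) (@ex_derive _ _ _ _ _ _ _ c).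
have E3 := congr1 (fun F : C -> C => F (g' z)) E2.
have E4 : derive1 (f : C^o -> C^o) (g z) = f' (g z).
  by rewrite derive1E (@derive_val _ _ _ _ _ _ _ c).
apply: (etrans (congr1 _ E1)); apply: (etrans E3).
by rewrite /= E4 mulrC.
Qed.

Lemma holX V n : hol V (fun z => z ^+ n) (fun z => n%:R * z ^+ n.-1).
Proof.
elim: n => [|n IH].
  by apply: (hol_ext _ _ (hol_cst V 1)) => z; rewrite ?mul0r.
apply: (hol_ext _ _ (holM (hol_id V) IH)) => z; first by rewrite exprS.
case: n {IH} => [|n]; first by rewrite mul0r mulr0 addr0 mul1r.
by rewrite mul1r /= mulrCA -exprS [n.+2%:R]mulrS mulrDl mul1r.
Qed.

End Hol.

(** * Circles, complex means and derivatives of curves *)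

Section Cauchy.
Variable R : realType.
Local Notation C := R[i].
Implicit Types (z w : C) (f g : C -> C).

(** The point e^{it}, given by coordinates because its t-derivative is taken separately on real and
    imaginary parts. *)
Definition cis (t : R) : C := cos t +i* sin t.

Lemma cabs_cis t : cabs (cis t) = 1.
Proof. by apply: complexI; rewrite -cabsE normc_def /= cos2Dsin2 sqrtr1. Qed.

Lemma cis_periodic : cis (pi *+ 2) = cis 0.
Proof. by rewrite /cis cos2pi sin2pi cos0 sin0. Qed.

Lemma cabs_circle (r : R) t : 0 <= r -> cabs (r%:C * cis t) = r.
Proof. by move=> r0; rewrite cabsM cabs_cis mulr1 cabsR ger0_norm. Qed.

Definition mean (psi : R -> C) : C :=
  rmean (fun t => Re (psi t)) +i* rmean (fun t => Im (psi t)).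

Lemma cont_Re (psi : R -> C) : continuous (psi : R -> C^o) ->
  continuous (fun t => Re (psi t)).
Proof. by move=> c t; exact: (continuous_comp (c t) (@Re_continuous R _)). Qed.

Lemma cont_Im (psi : R -> C) : continuous (psi : R -> C^o) ->
  continuous (fun t => Im (psi t)).
Proof. by move=> c t; exact: (continuous_comp (c t) (@Im_continuous R _)). Qed.

Lemma eq_mean (f g : R -> C) : f =1 g -> mean f = mean g.
Proof. by move=> /funext->. Qed.

Lemma ReMc z w : Re (z * w) = Re z * Re w - Im z * Im w.
Proof. by case: z; case: w. Qed.

Lemma ImMc z w : Im (z * w) = Im z * Re w + Re z * Im w.
Proof. by case: z => a b; case: w => c d /=; rewrite addrC. Qed.

Lemma mean_lin (a b : C) (f g : R -> C) :
  continuous (f : R -> C^o) -> continuous (g : R -> C^o) ->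
  mean (fun t => a * f t + b * g t) = a * mean f + b * mean g.
Proof.
move=> cf cg.
have [[[c1 c2] c3] c4] := (cont_Re cf, cont_Im cf, cont_Re cg, cont_Im cg).
have cl (x y : R) (h k : R -> R) : continuous h -> continuous k ->
    continuous (fun t => x * h t + y * k t).
  by move=> ch ck t; exact: (continuousD (cvgMl_tmp (a:=x) (ch t)) (cvgMl_tmp (a:=y) (ck t))).
have D h k : continuous h -> continuous k -> rmean (fun t => h t + k t) = rmean h + rmean k :> R.
  move=> ch ck; have := rmean_lin 1 1 ch ck; rewrite !mul1r => <-.
  by congr rmean; apply/funext => t; rewrite !mul1r.
apply/eqP; rewrite eq_complex; apply/andP; split; apply/eqP.
  rewrite raddfD /= !ReMc /=.
  rewrite (_ : (fun t => _) = fun t => (Re a * Re (f t) + (- Im a) * Im (f t)) + (Re b * Re (g t) + (- Im b) * Im (g t))).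
    by rewrite D ?rmean_lin ?mulNr //; apply: cl.
  by apply/funext => t; rewrite !mulNr raddfD /= !ReMc.
rewrite raddfD /= !ImMc /=.
rewrite (_ : (fun t => _) = fun t => (Im a * Re (f t) + Re a * Im (f t)) + (Im b * Re (g t) + Re b * Im (g t))).
  by rewrite D ?rmean_lin //; apply: cl.
by apply/funext => t; rewrite raddfD /= !ImMc.
Qed.

Lemma mean_cst c : mean (fun=> c) = c.
Proof. by rewrite /mean !rmean_cst; case: c. Qed.

(** The factor 2 comes from bounding real and imaginary part separately; it is harmless in all
    limits below. *)
Lemma mean_bound (psi : R -> C) B : continuous (psi : R -> C^o) ->
  (forall t, 0 <= t <= pi *+ 2 -> cabs (psi t) <= B) -> cabs (mean psi) <= B *+ 2.
Proof.
move=> c hB; apply: (le_trans (cabs_le_ReIm _)); rewrite mulr2n /=.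
apply: lerD; apply: rmean_bound; try exact: cont_Re; try exact: cont_Im.
  by move=> t ht; apply: le_trans (normr_Re_le _) (hB t ht).
by move=> t ht; apply: le_trans (normr_Im_le _) (hB t ht).
Qed.

Definition pderiv (gamma : R -> C) (t : R) (d : C) :=
  is_derive t 1 (fun s => Re (gamma s)) (Re d) /\
  is_derive t 1 (fun s => Im (gamma s)) (Im d).

Lemma pderivP gamma t d : pderiv gamma t d <->
  forall e : R, 0 < e -> exists2 delta : R, 0 < delta &
    forall h : R, `|h| < delta -> cabs (gamma (h + t) - gamma t - d * h%:C) <= e * `|h|.
Proof.
have E1 (h : R) : Re (gamma (h + t) - gamma t - d * h%:C) =
    Re (gamma (h + t)) - Re (gamma t) - Re d * h.
  by rewrite !raddfB /= ReMc /= mulr0 subr0.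
have E2 (h : R) : Im (gamma (h + t) - gamma t - d * h%:C) =
    Im (gamma (h + t)) - Im (gamma t) - Im d * h.
  by rewrite !raddfB /= ImMc /= mulr0 addr0.
split=> [[/(is_derive_litP (K:=R)) hr /(is_derive_litP (K:=R)) hi] e e0|H].
  have e2 : 0 < e / 2 by lra.
  have [d1 d10 h1] := hr _ e2; have [d2 d20 h2] := hi _ e2.
  exists (Num.min d1 d2); first by rewrite lt_min d10.
  move=> h; rewrite lt_min => /andP[/h1 k1 /h2 k2].
  apply: (le_trans (cabs_le_ReIm _)); rewrite E1 E2; lra.
split; apply/(is_derive_litP (K:=R)) => e /H[delta d0 hd]; exists delta => // h /hd k.
  by rewrite -E1; apply: le_trans (normr_Re_le _) k.
by rewrite -E2; apply: le_trans (normr_Im_le _) k.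
Qed.

(** The error splits as (f(gamma + k) - f(gamma) - D k) + D (k - d h), where k is the increment of
    the curve; each summand gets half of e. *)
Lemma pderiv_comp f gamma t D d : is_derive (gamma t : C^o) 1 (f : C^o -> C^o) D ->
  pderiv gamma t d -> pderiv (fun s => f (gamma s)) t (D * d).
Proof.
move=> /is_derivecP df /pderivP dg; apply/pderivP => e e0.
have K1 : 0 < cabs d + 1 by have := cabs_ge0 d; lra.
have K2 : 0 < cabs D + 1 by have := cabs_ge0 D; lra.
have [|d1 d10 h1] := df (e / 2 / (cabs d + 1)); first by rewrite !divr_gt0.
have [|d2 d20 h2] := dg (e / 2 / (cabs D + 1)); first by rewrite !divr_gt0.
have [//|d3 d30 h3] := dg 1.
(* The last term keeps |k| below d1, through |k| <= (|d| + 1) |h|, which is the estimate of gamma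
   with error 1. *)
exists (Num.min (Num.min d2 d3) (d1 / (cabs d + 1))).
  by rewrite !lt_min d20 d30 divr_gt0.
move=> h; rewrite !lt_min => /andP[/andP[/h2 k2 /h3 k3] k1].
pose k := gamma (h + t) - gamma t.
have kh : cabs k <= (cabs d + 1) * `|h|.
  have := ler_cabsD (k - d * h%:C) (d * h%:C); rewrite subrK cabsM cabsR.
  rewrite -/k in k3; lra.
have {}k1 : cabs k < d1.
  by apply: le_lt_trans kh _; rewrite mulrC -ltr_pdivlMr.
have := h1 k k1; rewrite /k subrK -/k => {}h1.
rewrite -/k in k2.
have -> : f (gamma (h + t)) - f (gamma t) - D * d * h%:C =
  (f (gamma (h + t)) - f (gamma t) - D * k) + D * (k - d * h%:C) by ring.
apply: (le_trans (ler_cabsD _ _)); rewrite cabsM.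
have a1 : e / 2 / (cabs d + 1) * cabs k <= e / 2 * `|h|.
  have e2 : 0 <= e / 2 by lra.
  by rewrite mulrAC ler_pdivrMr // (le_trans (ler_wpM2l e2 kh)) // [(cabs d + 1) * _]mulrC mulrA.
have a2 : cabs D * cabs (k - d * h%:C) <= e / 2 * `|h|.
  apply: (@le_trans _ _ (cabs D * (e / 2 / (cabs D + 1) * `|h|))).
    by rewrite ler_wpM2l ?cabs_ge0.
  have e2 : 0 <= e / 2 by lra.
  rewrite mulrA ler_wpM2r // mulrA ler_pdivrMr // mulrC ler_wpM2l //; lra.
by lra.
Qed.

Lemma pderiv_cis (r : R) t : pderiv (fun t => r%:C * cis t) t (r%:C * 'i%C * cis t).
Proof.
split.
  rewrite (_ : (fun s => _) = fun s => r * cos s); last first.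
    by apply/funext => s; rewrite ReMc /= mul0r subr0.
  apply: (is_derive_eq (is_deriveZ r (is_derive_cos t))).
  by rewrite !ReMc !ImMc /= /GRing.scale /=; ring.
rewrite (_ : (fun s => _) = fun s => r * sin s); last first.
  by apply/funext => s; rewrite ImMc /= mul0r add0r.
apply: (is_derive_eq (is_deriveZ r (is_derive_sin t))).
by rewrite !ImMc !ReMc /= /GRing.scale /=; ring.
Qed.

Lemma pderiv_ray (c : C) (x : R) : pderiv (fun x => x%:C * c) x c.
Proof.
split.
  rewrite (_ : (fun s => _) = fun s => Re c * s); last first.
    by apply/funext => s; rewrite ReMc /= mul0r subr0 mulrC.
  apply: (is_derive_eq (is_deriveZ (Re c) (is_derive_id x 1))).
  by rewrite /GRing.scale /= mulr1.
rewrite (_ : (fun s => _) = fun s => Im c * s); last first.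
  by apply/funext => s; rewrite ImMc /= mul0r add0r mulrC.
apply: (is_derive_eq (is_deriveZ (Im c) (is_derive_id x 1))).
by rewrite /GRing.scale /= mulr1.
Qed.

Lemma circle_continuous (T : topologicalType) (u v : T -> R) :
  continuous u -> continuous v -> continuous (fun p => (u p)%:C * cis (v p) : C^o).
Proof.
move=> cu cv p.
have c1 : {for p, continuous (fun p => cos (v p))}.
  by apply: (@continuous_comp _ _ _ v (@cos R)); [exact: cv|exact: continuous_cos].
have c2 : {for p, continuous (fun p => sin (v p))}.
  by apply: (@continuous_comp _ _ _ v (@sin R)); [exact: cv|exact: continuous_sin].
apply: cvgc_ReIm.
  under eq_fun do rewrite ReMc /= mul0r subr0.
  by rewrite ReMc /= mul0r subr0; exact: (cvgM (cu p) c1).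
under eq_fun do rewrite ImMc /= mul0r add0r.
by rewrite ImMc /= mul0r add0r; exact: (cvgM (cu p) c2).
Qed.

End Cauchy.

(** * Cauchy's theorem for annuli *)

Section CauchyTheorem.
Variable R : realType.
Local Notation C := R[i].
Implicit Types (z w : C) (f g G : C -> C).

Section Clamp.
Variables a b : R.
Hypothesis ab : a <= b.

(** Clamping the radius turns a function on a closed annulus into a continuous function of all radii
    and angles, the form in which means depending on a parameter are treated. *)
Definition clamp (x : R) : R := Num.max a (Num.min x b).

Lemma clamp_itv x : a <= clamp x <= b.
Proof.
rewrite /clamp le_max lexx /= ge_max ab /= ge_min lexx orbT //.
Qed.

Lemma clamp_id x : a <= x <= b -> clamp x = x.
Proof. by move=> /andP[ax xb]; rewrite /clamp min_l // max_r. Qed.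

Lemma clamp_continuous : continuous clamp.
Proof.
move=> x; apply: (@continuous_max R R (fun=> a) (fun x => Num.min x b)).
  exact: cvg_cst.
by apply: (@continuous_min R R id (fun=> b)); [exact: cvg_id|exact: cvg_cst].
Qed.

Variable G : C -> C.
Hypothesis a0 : 0 <= a.
Hypothesis cG : forall z, a <= cabs z <= b -> {for z, continuous (G : C^o -> C^o)}.

Definition Gcl (p : R * R) : C := G ((clamp p.1)%:C * cis p.2).

Lemma Gcl_cont_comp (T : topologicalType) (u v : T -> R) :
  continuous u -> continuous v -> continuous (fun p => Gcl (u p, v p) : C^o).
Proof.
move=> cu cv p; apply: (@continuous_comp _ _ _ (fun p => (clamp (u p))%:C * cis (v p) : C^o) (G : C^o -> C^o)).
  apply: (@circle_continuous _ _ (fun p => clamp (u p))) => // q.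
  by apply: (@continuous_comp _ _ _ u clamp); [exact: cu|exact: clamp_continuous].
apply: cG; have /andP[h1 h2] := clamp_itv (u p).
by rewrite cabs_circle ?h1 // (le_trans a0).
Qed.

Lemma Gcl_continuous : continuous (Gcl : R * R -> C^o).
Proof.
have c1 : continuous (@fst R R) by move=> p; exact: cvg_fst.
have c2 : continuous (@snd R R) by move=> p; exact: cvg_snd.
have := Gcl_cont_comp c1 c2.
by rewrite (_ : (fun p => Gcl (p.1, p.2)) = Gcl) //; apply/funext; case.
Qed.

Lemma Gcl_cont1 t : continuous (fun x => Gcl (x, t) : C^o).
Proof.
by apply: (@Gcl_cont_comp _ id (fun=> t)) => x; [exact: cvg_id|exact: cvg_cst].
Qed.

Lemma Gcl_cont2 x : continuous (fun t => Gcl (x, t) : C^o).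
Proof.
by apply: (@Gcl_cont_comp _ (fun=> x) id) => t; [exact: cvg_cst|exact: cvg_id].
Qed.

Lemma Gcl_bound : exists M, forall x t, 0 <= t <= pi *+ 2 -> cabs (Gcl (x, t)) <= M.
Proof.
pose A : set (R * R) := `[a, b] `*` `[0, pi *+ 2].
have cA : compact A by apply: compact_setX; exact: segment_compact.
have A0 : A !=set0.
  exists (a, 0); split; rewrite /= in_itv /= lexx //=.
  by rewrite ltW // twopi_gt0.
have cabs_cont : continuous (fun z : C^o => cabs z).
  move=> z; apply/(@cvgrPdist_lt R R^o (C^o) (nbhs z) _ (@cabs R) (cabs z)).
  move=> e e0; apply/nbhscP; exists e => // w wz.
  have h1 := ler_cabs_dist z w; have h2 := ler_cabs_dist w z.
  rewrite [cabs (z - w)]cabsB in h1; rewrite ltr_norml; lra.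
have cF : {within A, continuous (fun p => cabs (Gcl p))}.
  apply: continuous_subspaceT => p.
  by apply: (@continuous_comp _ _ _ (Gcl : R * R -> C^o)); [exact: Gcl_continuous|exact: cabs_cont].
have [c _ hc] := @compact_EVT_max _ R _ A A0 cA cF.
exists (cabs (Gcl c)) => x t ht.
have -> : Gcl (x, t) = Gcl (clamp x, t) by rewrite /Gcl /= (clamp_id (clamp_itv x)).
by apply: hc; rewrite inE; split; rewrite /= in_itv //=; exact: clamp_itv.
Qed.

End Clamp.

Lemma circle_continuous1 (r : R) : continuous (fun t => r%:C * cis t : C^o).
Proof.
by apply: (@circle_continuous _ _ (fun=> r) id) => t; [exact: cvg_cst|exact: cvg_id].
Qed.

Lemma circle_comp_continuous (r : R) G : 0 <= r ->
  (forall z, cabs z = r -> {for z, continuous (G : C^o -> C^o)}) ->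
  continuous (fun t => G (r%:C * cis t) : C^o).
Proof.
move=> r0 cG t; apply: (@continuous_comp _ _ _ (fun t : R => r%:C * cis t : C^o) (G : C^o -> C^o)).
  exact: circle_continuous1.
by apply: cG; rewrite cabs_circle.
Qed.

Lemma is_derive_eq_near (f g : R -> R) (x d a b : R) : a < x < b ->
  (forall y, a < y < b -> f y = g y) -> is_derive x 1 f d -> is_derive x 1 g d.
Proof.
move=> xab fg; apply: near_eq_is_derive.
have : x \in `]a, b[ by rewrite in_itv.
move=> /near_in_itvoo; apply: filterS => y; rewrite in_itv /=; exact: fg.
Qed.

(** The integrand is the t-derivative of G(r e^{it}) divided by ir, and that function is
    periodic. *)
Lemma mean_deriv0 (r : R) G (G' : C -> C) : 0 < r ->
  (forall z, cabs z = r -> is_derive (z : C^o) 1 (G : C^o -> C^o) (G' z)) ->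
  (forall z, cabs z = r -> {for z, continuous (G' : C^o -> C^o)}) ->
  mean (fun t => G' (r%:C * cis t) * cis t) = 0.
Proof.
move=> r0 dG cG'.
pose c : C := (r%:C * 'i%C)^-1.
have ri0 : r%:C * 'i%C != 0 :> C.
  rewrite mulf_neq0 //; last by rewrite eq_complex /= oner_eq0 andbF.
  by rewrite eq_complex /= gt_eqF.
have D t : pderiv (fun s => c * G (r%:C * cis s)) t (G' (r%:C * cis t) * cis t).
  have rt : cabs (r%:C * cis t) = r by rewrite cabs_circle // ltW.
  have d1 : is_derive (r%:C * cis t : C^o) 1 (fun z => c * G z : C^o) (c * G' (r%:C * cis t)).
    exact: (is_deriveZ c (dG _ rt)).
  have := pderiv_comp d1 (pderiv_cis r t).
  suff -> : c * G' (r%:C * cis t) * (r%:C * 'i%C * cis t) = G' (r%:C * cis t) * cis t by [].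
  by rewrite mulrACA /c mulVf // mul1r.
have cc : continuous (fun t => G' (r%:C * cis t) * cis t : C^o).
  move=> t; apply: (@continuousM C R (fun t => G' (r%:C * cis t)) (@cis R)).
    exact: (circle_comp_continuous (ltW r0) cG').
  have := @circle_continuous1 1 t.
  by rewrite /continuous_at; under eq_fun do rewrite mul1r; rewrite mul1r.
have mr : rmean (fun t => Re (G' (r%:C * cis t) * cis t)) = 0.
  apply: (@rmean_deriv R (fun t => Re (c * G (r%:C * cis t)))).
  - by move=> t; case: (D t).
  - exact: cont_Re.
  - by rewrite cis_periodic.
have mi : rmean (fun t => Im (G' (r%:C * cis t) * cis t)) = 0.
  apply: (@rmean_deriv R (fun t => Im (c * G (r%:C * cis t)))).
  - by move=> t; case: (D t).
  - exact: cont_Im.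
  - by rewrite cis_periodic.
by rewrite /mean mr mi.
Qed.

(** The mean over the circle of radius x is continuous on [r1, r2] and has derivative 0 inside by
    [mean_deriv0]. Since only continuity is asked at the boundary, r1 may be 0, and a boundary
    circle may pass through a point where G is merely continuous. *)
Lemma cauchy_annulus (r1 r2 : R) G (G' : C -> C) : 0 <= r1 -> r1 < r2 ->
  (forall z, r1 <= cabs z <= r2 -> {for z, continuous (G : C^o -> C^o)}) ->
  hol [set z | r1 < cabs z < r2] G G' ->
  mean (fun t => G (r1%:C * cis t)) = mean (fun t => G (r2%:C * cis t)).
Proof.
move=> r10 r12 cG hG.
have r12' := ltW r12.
pose F x t := Gcl r1 r2 G (x, t).
have [M hM] := Gcl_bound r12' r10 cG.
(* P is the real or the imaginary part; both go through one argument. *)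
have main (P : C -> R) : P = (@complex.Re R) \/ P = (@complex.Im R) ->
    rmean (fun t => P (F r1 t)) = rmean (fun t => P (F r2 t)).
  move=> PRI.
  have P0 : P 0 = 0 by case: PRI => ->.
  have cP (psi : R -> C) : continuous (psi : R -> C^o) -> continuous (fun t => P (psi t)).
    by case: PRI => ->; [exact: cont_Re|exact: cont_Im].
  have nP z : `|P z| <= cabs z by case: PRI => ->; [exact: normr_Re_le|exact: normr_Im_le].
  have dP (gamma : R -> C) t d : pderiv gamma t d -> is_derive t 1 (fun s => P (gamma s)) (P d).
    by case=> a b; case: PRI => ->.
  have Pm (psi : R -> C) : mean psi = 0 -> rmean (fun t => P (psi t)) = 0.
    by move=> h; case: PRI => ->; have := congr1 (@complex.Re R) h; have := congr1 (@complex.Im R) h.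
  pose I x := rmean (fun t => P (F x t)).
  have cI : continuous I.
    apply: (@rmean_param_cont R (fun x t => P (F x t)) M).
    - by move=> x; apply: cP; exact: (Gcl_cont2 r12' r10 cG).
    - by move=> t; apply: cP; exact: (Gcl_cont1 r12' r10 cG).
    - by move=> x t ht; apply: le_trans (nP _) (hM x t ht).
  have dI x : x \in `]r1, r2[ -> is_derive x 1 I 0.
    rewrite in_itv /= => /andP[x1 x2].
    (* G' is controlled only in the open annulus, so its bound is taken on a closed annulus inside,
       around the circle of radius x. *)
    pose a := (r1 + x) / 2; pose b := (x + r2) / 2.
    have a1 : r1 < a by rewrite /a; lra.
    have a2 : a < x by rewrite /a; lra.
    have b1 : x < b by rewrite /b; lra.
    have b2 : b < r2 by rewrite /b; lra.
    have ab : a <= b by lra.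
    have a0 : 0 <= a by lra.
    have inV z : a <= cabs z <= b -> [set z | r1 < cabs z < r2] z.
      by move=> /andP[za zb] /=; apply/andP; split; lra.
    have cG' z : a <= cabs z <= b -> {for z, continuous (G' : C^o -> C^o)}.
      by move=> /inV /hG[].
    have [M' hM'] := Gcl_bound ab a0 cG'.
    have x0 : 0 < x by lra.
    rewrite -(Pm (fun t => G' (x%:C * cis t) * cis t)); last first.
      apply: (mean_deriv0 (G := G)) => // z zx; apply hG; rewrite /= zx; lra.
    apply: (@rmean_param_deriv R (fun x t => P (F x t)) (fun x t => P (G' (x%:C * cis t) * cis t)) M' a b).
    - by rewrite a2 b1.
    - by move=> y; apply: cP; exact: (Gcl_cont2 r12' r10 cG).
    - move=> y t /andP[ya yb].
      apply: (@is_derive_eq_near (fun y => P (G (y%:C * cis t))) _ _ _ a b).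
      + by rewrite ya yb.
      + by move=> u uab; rewrite /F /Gcl /= clamp_id //; lra.
      apply: dP; apply: pderiv_comp (pderiv_ray _ _).
      by apply hG; apply: inV; rewrite cabs_circle; lra.
    - move=> y t yab ht; apply: (le_trans (nP _)); rewrite cabsM cabs_cis mulr1.
      by have := hM' y t ht; rewrite /Gcl /= clamp_id //; lra.
  have [|c _] := @MVT R I (fun=> 0) r1 r2 r12 dI; last first.
    by rewrite mul0r => /eqP; rewrite subr_eq0 => /eqP.
  exact: continuous_subspaceT.
have E x t : r1 <= x <= r2 -> F x t = G (x%:C * cis t).
  by move=> h; rewrite /F /Gcl /= clamp_id.
have e1 : (fun t => G (r1%:C * cis t)) = F r1 by apply/funext => t; rewrite E ?lexx.
have e2 : (fun t => G (r2%:C * cis t)) = F r2 by apply/funext => t; rewrite E ?lexx ?andbT.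
rewrite e1 e2 /mean.
by rewrite (main (@complex.Re R)) ?(main (@complex.Im R)); [|right|left].
Qed.

End CauchyTheorem.

(** * Cauchy integrals and their derivatives *)

Section CauchyIntegral.
Variable R : realType.
Local Notation C := R[i].
Implicit Types (z w : C) (f g phi : C -> C).

Record ccont (f : R -> C) : Prop := Ccont { ccontP : continuous (f : R -> C^o) }.

Lemma ccontM (f g : R -> C) : ccont f -> ccont g -> ccont (fun t => f t * g t).
Proof. by move=> [cf] [cg]; split=> t; apply: (@continuousM C R f g); [exact: cf|exact: cg]. Qed.

Lemma ccontD (f g : R -> C) : ccont f -> ccont g -> ccont (fun t => f t + g t).
Proof. by move=> [cf] [cg]; split=> t; apply: (@continuousD C C^o R f g); [exact: cf|exact: cg]. Qed.

Lemma ccont_cst (c : C) : ccont (fun=> c).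
Proof. by split=> t; exact: cvg_cst. Qed.

Lemma ccontZ (c : C) (f : R -> C) : ccont f -> ccont (fun t => c * f t).
Proof. by move=> cf; apply: (@ccontM (fun=> c)); [exact: ccont_cst|exact: cf]. Qed.

Lemma ccont_circle (r : R) f : 0 <= r ->
  (forall z, cabs z = r -> {for z, continuous (f : C^o -> C^o)}) ->
  ccont (fun t => f (r%:C * cis t)).
Proof. by move=> r0 cf; split; exact: circle_comp_continuous. Qed.

(** This is the contour integral of f(z) / (z - w)^m dz / (2 pi i): on a circle dz / i = z dt,
    whence the factor z in the numerator. *)
Definition cauchy_int (m : nat) (r : R) f w : C :=
  mean (fun t => f (r%:C * cis t) * (r%:C * cis t / (r%:C * cis t - w) ^+ m)).

Definition cont_circle (r : R) f :=
  forall z, cabs z = r -> {for z, continuous (f : C^o -> C^o)}.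

Lemma circle_bound r f : 0 <= r -> cont_circle r f -> exists2 M, 0 <= M &
  forall t, 0 <= t <= pi *+ 2 -> cabs (f (r%:C * cis t)) <= M.
Proof.
move=> r0 cf; have [|M hM] := @Gcl_bound R r r (lexx r) f r0 _.
  by move=> z rz; apply: cf; apply/eqP; rewrite eq_le andbC.
have H t : 0 <= t <= pi *+ 2 -> cabs (f (r%:C * cis t)) <= M.
  by move=> ht; have := hM r t ht; rewrite /Gcl /= clamp_id ?lexx.
exists M => //; apply: le_trans (H 0 _); first exact: cabs_ge0.
by rewrite lexx /= ltW // twopi_gt0.
Qed.

Lemma dist_circle_ge (r : R) w t : 0 <= r -> `|r - cabs w| <= cabs (r%:C * cis t - w).
Proof.
move=> r0; have := ler_cabs_dist (r%:C * cis t) w; have := ler_cabs_dist w (r%:C * cis t).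
by rewrite [cabs (w - _)]cabsB cabs_circle // ler_norml => h1 h2; apply/andP; split; lra.
Qed.

Lemma kernel_cont m r w : 0 <= r -> cabs w != r ->
  ccont (fun t => r%:C * cis t / (r%:C * cis t - w) ^+ m).
Proof.
move=> r0 wr.
apply: (@ccont_circle r (fun z => z / (z - w) ^+ m)) => // z zr.
have zw : z - w != 0.
  by rewrite subr_eq0; apply: contra wr => /eqP <-; rewrite zr.
have V0 : forall x, [set x | x != w] x -> (x - w) ^+ m != 0.
  by move=> x /= xw; rewrite expf_neq0 // subr_eq0.
have h1 : hol [set x | x != w] (fun x => x - w) (fun=> 1).
  apply: (hol_ext _ _ (holD (hol_id _) (hol_cst _ (- w)))) => // x; by rewrite addr0.
have h2 := hol_comp h1 (holX _ m).
have := (holM (hol_id _) (holV V0 h2)) z; rewrite /= -subr_eq0 => /(_ zw)[d _].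
exact: is_derivec_cont d.
Qed.

(** For a = 1/(z - w - h) and b = 1/(z - w) this expands the kernel 1/(z - w)^m to first order in h.
    The error bound depends on z only through k, hence is uniform on the circle. Passing from m to m
    + 1 adds the term (m + 1) h^2 a b^{m+2}, which accounts for the sum in K. *)
Lemma kernel_expand m (a b h : C) (k : R) : a - b = h * a * b ->
  cabs a <= k -> cabs b <= k ->
  exists2 K : R, 0 <= K & K = (\sum_(i < m) i.+1%:R) * k ^+ m.+2 /\
   cabs (a ^+ m - b ^+ m - m%:R * b ^+ m.+1 * h) <= K * cabs h ^+ 2.
Proof.
move=> abh ak bk; have k0 : 0 <= k by apply: le_trans (cabs_ge0 a) ak.
exists ((\sum_(i < m) i.+1%:R) * k ^+ m.+2).
  by rewrite mulr_ge0 ?exprn_ge0 // sumr_ge0.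
split=> //; elim: m => [|m IH].
  by rewrite !expr0 subrr mul0r mul0r subr0 cabs0 big_ord0 mul0r mul0r.
have -> : a ^+ m.+1 - b ^+ m.+1 - m.+1%:R * b ^+ m.+2 * h =
    a * (a ^+ m - b ^+ m - m%:R * b ^+ m.+1 * h) + m.+1%:R * (h ^+ 2 * (a * b ^+ m.+2)).
  have -> : h ^+ 2 * (a * b ^+ m.+2) = (a - b) * h * b ^+ m.+1 by rewrite abh !exprS; ring.
  rewrite [m.+1%:R]mulrS.
  transitivity (a * a ^+ m - a * b ^+ m + (a - b) * b ^+ m - (1 + m%:R) * b ^+ m.+2 * h).
    by rewrite !exprS; ring.
  transitivity (a * a ^+ m - a * b ^+ m + (h * a * b) * b ^+ m - (1 + m%:R) * b ^+ m.+2 * h).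
    by rewrite abh.
  by rewrite !exprS; ring.
apply: (le_trans (ler_cabsD _ _)); rewrite big_ord_recr /= mulrDl mulrDl; apply: lerD.
  rewrite cabsM; apply: (le_trans (ler_pM (cabs_ge0 _) (cabs_ge0 _) ak IH)).
  rewrite [k ^+ m.+3]exprS le_eqVlt; apply/orP; left; apply/eqP.
  by move: (\sum_(i < m) _) (k ^+ m.+2) => x y; ring.
rewrite cabsM [cabs (h ^+ 2 * _)]cabsM [cabs (a * _)]cabsM.
have -> : cabs (m.+1%:R : C) = m.+1%:R.
  by rewrite -[m.+1%:R : C](rmorph_nat (real_complex R)) cabsR ger0_norm.
rewrite -mulrA ler_wpM2l // mulrC !cabsX ler_wpM2r ?exprn_ge0 ?cabs_ge0 //.
by rewrite [k ^+ _]exprS ler_pM ?exprn_ge0 ?cabs_ge0 // lerXn2r ?nnegrE ?cabs_ge0.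
Qed.

Lemma cauchy_int_derive m r f w : 0 < r -> cont_circle r f -> cabs w != r ->
  is_derive (w : C^o) 1 (cauchy_int m r f : C^o -> C^o) (m%:R * cauchy_int m.+1 r f w).
Proof.
move=> r0 cf wr; have r0' := ltW r0.
have [M M0 hM] := circle_bound r0' cf.
pose d := `|r - cabs w|.
have d0 : 0 < d by rewrite normr_gt0 subr_eq0 eq_sym.
(* For |h| < d/2 the point w + h stays at distance at least d/2 from the circle, so k bounds both
   kernels. *)
pose k := 2 / d.
have k0 : 0 <= k by rewrite divr_ge0 // ltW.
pose K := (\sum_(i < m) i.+1%:R) * k ^+ m.+2.
have K0 : 0 <= K by rewrite mulr_ge0 ?exprn_ge0 // sumr_ge0.
have cfc := ccont_circle r0' cf.
have cI n v : cabs v != r -> ccont (fun t =>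
    f (r%:C * cis t) * (r%:C * cis t / (r%:C * cis t - v) ^+ n)).
  by move=> vr; exact: (ccontM cfc (kernel_cont n r0' vr)).
have alg1 (h A B D : C) : A - B - m%:R * D * h = 1 * (1 * A + -1 * B) + - (m%:R * h) * D.
  by ring.
have alg2 (h F z a b c : C) : 1 * (1 * (F * (z * a)) + -1 * (F * (z * b))) +
    - (m%:R * h) * (F * (z * c)) = F * z * (a - b - m%:R * c * h) by ring.
have alg3 (u v : C) : u != 0 -> v != 0 -> u^-1 - v^-1 = (v - u) * u^-1 * v^-1.
  by move=> u0 v0; rewrite mulrBl mulfV // mulrBl mul1r mulrAC mulfV // mul1r.
have inv_le (x : R) : d / 2 <= x -> x^-1 <= k.
  move=> dx; have x0 : 0 < x by have := d0; lra.
  by rewrite /k -[2 / d]invrK invf_div lef_pV2 // posrE divr_gt0.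
apply/is_derivecP => e e0.
pose L := M * r * K *+ 2.
have L0 : 0 <= L by apply: mulrn_wge0; apply: mulr_ge0 => //; apply: mulr_ge0.
(* L may be 0, hence the denominator L + 1. *)
exists (Num.min (d / 2) (e / (L + 1))).
  by rewrite lt_min !divr_gt0 //; lra.
move=> h; rewrite lt_min => /andP[hd he].
have vr : cabs (h + w) != r.
  apply/eqP => hr; move: hd; rewrite ltNge => /negP; apply.
  have h1 := ler_cabs_dist (h + w) w; have h2 := ler_cabs_dist w (h + w).
  rewrite [cabs (w - _)]cabsB addrK in h1 h2.
  have : d <= cabs h by rewrite /d ler_norml -hr; apply/andP; split; lra.
  by have := d0; lra.
have -> : cauchy_int m r f (h + w) - cauchy_int m r f w - m%:R * cauchy_int m.+1 r f w * h =
  mean (fun t => f (r%:C * cis t) * (r%:C * cis t) *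
     ((r%:C * cis t - (h + w))^-1 ^+ m - (r%:C * cis t - w)^-1 ^+ m
      - m%:R * (r%:C * cis t - w)^-1 ^+ m.+1 * h)).
  rewrite /cauchy_int.
  have c1 := cI m _ vr; have c2 := cI m _ wr; have c3 := cI m.+1 _ wr.
  have e1 := mean_lin 1 (-1) (ccontP c1) (ccontP c2).
  have c12 := ccontD (ccontZ 1 c1) (ccontZ (-1) c2).
  have e2 := mean_lin 1 (- (m%:R * h)) (ccontP c12) (ccontP c3).
  rewrite alg1 -e1 -e2; apply: eq_mean => t.
  by rewrite !exprVn alg2.
have bound : cabs (mean (fun t => f (r%:C * cis t) * (r%:C * cis t) *
     ((r%:C * cis t - (h + w))^-1 ^+ m - (r%:C * cis t - w)^-1 ^+ m
      - m%:R * (r%:C * cis t - w)^-1 ^+ m.+1 * h))) <= (M * r * (K * cabs h ^+ 2)) *+ 2.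
  apply: mean_bound.
    have c1 := cI m _ vr; have c2 := cI m _ wr; have c3 := cI m.+1 _ wr.
    have c4 := ccontD (ccontZ 1 (ccontD (ccontZ 1 c1) (ccontZ (-1) c2))) (ccontZ (- (m%:R * h)) c3).
    move: (ccontP c4); set F := (X in continuous X -> _); suff -> : F = (fun t => f (r%:C * cis t) * (r%:C * cis t) *
     ((r%:C * cis t - (h + w))^-1 ^+ m - (r%:C * cis t - w)^-1 ^+ m
      - m%:R * (r%:C * cis t - w)^-1 ^+ m.+1 * h)) by [].
    by apply/funext => t; rewrite /F !exprVn alg2.
  move=> t ht; rewrite cabsM cabsM cabs_circle // ler_pM ?mulr_ge0 ?cabs_ge0 //.
    by rewrite ler_wpM2r // hM.
  have dw := dist_circle_ge w t r0'.
  set z := r%:C * cis t in dw *.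
  have dh : d / 2 <= cabs (z - (h + w)).
    have := ler_cabs_dist (z - w) h; rewrite -addrA -opprD [w + h]addrC => dh.
    by rewrite -/d in dw; have := d0; lra.
  have n1 : z - (h + w) != 0 by rewrite -cabs_gt0; have := d0; lra.
  have n2 : z - w != 0 by rewrite -cabs_gt0; rewrite -/d in dw; have := d0; lra.
  have [|||K' _ [-> //]] := @kernel_expand m (z - (h + w))^-1 (z - w)^-1 h k.
  - rewrite alg3 //; congr (_ * _ * _); ring.
  - by rewrite cabsV; apply: inv_le.
  - by rewrite cabsV; apply: inv_le; rewrite -/d in dw; have := d0; lra.
apply: (le_trans bound).
rewrite (_ : _ *+ 2 = L * cabs h * cabs h); last first.
  by rewrite /L expr2 !mulrnAl !mulrA.
apply: ler_wpM2r; first exact: cabs_ge0.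
move: he; rewrite ltr_pdivlMr; last by lra.
by have := cabs_ge0 h; lra.
Qed.

End CauchyIntegral.

(** * Cauchy's formula on an annulus *)

Section CauchyFormula.
Variable R : realType.
Local Notation C := R[i].
Implicit Types (z w : C) (f g phi : C -> C).

Lemma open_cabs (P : R -> Prop) : (forall x, P x -> exists2 d, 0 < d & forall y, `|y - x| < d -> P y) ->
  open ([set z | P (cabs z)] : set C^o).
Proof.
move=> h; rewrite openE => z /= /h[d d0 hd]; apply/nbhscP; exists d => // w wz; apply: hd.
apply: le_lt_trans wz; rewrite ler_norml; have h1 := ler_cabs_dist z w; have h2 := ler_cabs_dist w z.
by rewrite [cabs (z - w)]cabsB in h1; apply/andP; split; lra.
Qed.

Lemma open_annulus (r1 r2 : R) : open ([set z | r1 < cabs z < r2] : set C^o).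
Proof.
apply: (@open_cabs (fun x => r1 < x < r2)) => x /andP[x1 x2].
exists (Num.min (x - r1) (r2 - x)); first by rewrite lt_min !subr_gt0 x1.
by move=> y; rewrite lt_min !ltr_norml => /andP[/andP[a b] /andP[c d]]; apply/andP; split; lra.
Qed.

Lemma open_pt (a : C) : open ([set z | z != a] : set C^o).
Proof.
rewrite openE => z /= za; apply/nbhscP; exists (cabs (z - a)); first by rewrite cabs_gt0 subr_eq0.
by move=> w; apply: contraTneq => ->; rewrite cabsB ltxx.
Qed.

Lemma hol_cont V f f' z : hol V f f' -> V z -> {for z, continuous (f : C^o -> C^o)}.
Proof. by move=> h /h[d _]; exact: is_derivec_cont d. Qed.

Lemma hol_glue V g : (forall z, V z -> exists W h h',
    [/\ open (W : set C^o), W z, hol W h h' & forall x, W x -> h x = g x]) ->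
  hol V g (derive1 (g : C^o -> C^o)).
Proof.
move=> H; apply: holomorphic_hol => z /H[W [h [h' [Wo Wz hh hg]]]].
exact: (hol_holomorphic Wo (hol_eq Wo hh hg)) Wz.
Qed.

Lemma hol_derive1 V f f' z : hol V f f' -> V z -> derive1 (f : C^o -> C^o) z = f' z.
Proof. by move=> h /h[d _]; rewrite derive1E (@derive_val _ _ _ _ _ _ _ d). Qed.

Lemma hol_unique V f f1 f2 z : hol V f f1 -> hol V f f2 -> V z -> f1 z = f2 z.
Proof. by move=> h1 h2 Vz; rewrite -(hol_derive1 h1 Vz) (hol_derive1 h2 Vz). Qed.

Lemma cont_eq f g a : {for a, continuous (f : C^o -> C^o)} ->
  {for a, continuous (g : C^o -> C^o)} ->
  (exists2 d : R, 0 < d & forall z, z != a -> cabs (z - a) < d -> f z = g z) -> f a = g a.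
Proof.
move=> /continuousc_at cf /continuousc_at cg [d d0 fg]; apply/eqP.
rewrite -subr_eq0 -cabs_eq0 eq_le cabs_ge0 andbT leNgt; apply/negP => k0.
set k := cabs (f a - g a) in k0.
have k2 : 0 < k / 2 by lra.
have [d1 d10 h1] := cf _ k2; have [d2 d20 h2] := cg _ k2.
pose e : R := Num.min (Num.min d1 d2) d / 2.
have m0 : 0 < Num.min (Num.min d1 d2) d by rewrite !lt_min d10 d20.
have e0 : 0 < e by rewrite divr_gt0.
have : e < Num.min (Num.min d1 d2) d by rewrite /e; lra.
rewrite !lt_min => /andP[/andP[e1 e2] ed].
have ea : cabs (a + e%:C - a) = e by rewrite addrAC subrr add0r cabsR gtr0_norm.
have h3 := fg (a + e%:C); rewrite ea in h3.
have {}h3 := h3 _ ed.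
have ne : a + e%:C != a by rewrite -subr_eq0 -cabs_eq0 ea gt_eqF.
have {}h3 := h3 ne.
have {}h1 := h1 (a + e%:C); have {}h2 := h2 (a + e%:C); rewrite ea in h1 h2.
have {}h1 := h1 e1; have {}h2 := h2 e2.
have := ler_cabsD (f a - f (a + e%:C)) (g (a + e%:C) - g a).
rewrite h3 in h1 *; rewrite addrA subrK -/k [cabs (f a - _)]cabsB; lra.
Qed.

Definition dq f (d w z : C) : C := if z == w then d else (f z - f w) / (z - w).

Lemma dq_cont f d w : is_derive (w : C^o) 1 (f : C^o -> C^o) d ->
  {for w, continuous (dq f d w : C^o -> C^o)}.
Proof.
move=> /is_derivecP df; apply/continuousc_at => e e0.
have e2 : 0 < e / 2 by lra.
have [delta d0 hd] := df _ e2; exists delta => // z zw.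
rewrite /dq eqxx; case: eqVneq => [_|nzw]; first by rewrite subrr cabs0.
have := hd (z - w) zw; rewrite subrK => h.
have zw0 : z - w != 0 by rewrite subr_eq0.
rewrite -[X in _ - X](mulfK zw0) -mulrBl cabsM cabsV ltr_pdivrMr ?cabs_gt0 //.
apply: le_lt_trans h _; rewrite ltr_pM2r ?cabs_gt0 //; lra.
Qed.

Lemma open_punctured V w : open (V : set C^o) ->
  open ([set z | V z /\ z != w] : set C^o).
Proof. by move=> Vo; apply: openI => //; exact: open_pt. Qed.

Lemma dq_hol V f f' d w : open (V : set C^o) -> hol V f f' ->
  exists q', hol [set z | V z /\ z != w] (dq f d w) q'.
Proof.
move=> Vo hf; eexists; apply: (hol_eq (f := fun z => (f z - f w) * (z - w)^-1)); last first.
- by move=> z [_ /negbTE zw]; rewrite /dq zw.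
- have h1 := holD (hol_sub (W := [set z | V z /\ z != w]) (fun z h => h.1) hf) (hol_cst _ (- f w)).
  have h2 := holD (hol_id [set z | V z /\ z != w]) (hol_cst _ (- w)).
  by apply: (holM h1 (holV _ h2)) => z [_]; rewrite subr_eq0.
exact: open_punctured.
Qed.

Lemma cauchy_int_cont m r f w : 0 < r -> cont_circle r f -> cabs w != r ->
  ccont (fun t => f (r%:C * cis t) * (r%:C * cis t / (r%:C * cis t - w) ^+ m)).
Proof.
move=> r0 cf wr; have r0' := ltW r0.
exact: (ccontM (ccont_circle r0' cf) (kernel_cont m r0' wr)).
Qed.

Lemma mean_sub (f g : R -> C) c : ccont f -> ccont g ->
  mean (fun t => f t - c * g t) = mean f - c * mean g.
Proof.
move=> [cf] [cg]; have := mean_lin 1 (- c) cf cg; rewrite mul1r mulNr => <-.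
by apply: eq_mean => t; rewrite mul1r mulNr.
Qed.

Lemma cauchy_int_bound (r M : R) f w : 0 < r -> cont_circle r f ->
  (forall t, 0 <= t <= pi *+ 2 -> cabs (f (r%:C * cis t)) <= M) -> cabs w != r ->
  cabs (cauchy_int 1 r f w) <= (M * (r / `|r - cabs w|)) *+ 2.
Proof.
move=> r0 cf fM wr; have r0' := ltW r0.
apply: mean_bound; first exact: (ccontP (cauchy_int_cont 1 r0 cf wr)).
move=> t ht; rewrite cabsM; apply: ler_pM; rewrite ?cabs_ge0 //.
  exact: fM.
rewrite cabsM cabs_circle // cabsV expr1 ler_wpM2l // lef_pV2 ?posrE.
- exact: dist_circle_ge.
- apply: lt_le_trans (dist_circle_ge w t r0').
  by rewrite normr_gt0 subr_eq0 eq_sym.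
- by rewrite normr_gt0 subr_eq0 eq_sym.
Qed.

Lemma cont_circle_cst r c : cont_circle r (fun=> c : C).
Proof. by move=> z _; exact: cst_continuous. Qed.

Lemma circle_neq (r : R) w t : 0 < r -> cabs w != r -> r%:C * cis t != w.
Proof. by move=> r0; apply: contraNneq => <-; rewrite cabs_circle // ltW. Qed.

(** This stands for a limit r -> oo: a quantity bounded by K / (r - q) for all large r vanishes. *)
Lemma limit_le0 (c K q r0 : R) : 0 <= c -> (forall r, r0 < r -> c * (r - q) <= K) -> c = 0.
Proof.
move=> c0 h; apply/eqP; rewrite eq_le c0 andbT leNgt; apply/negP => cp.
pose r := Num.max r0 (q + K / c) + 1.
have r1 : r0 < r.
  by rewrite /r (@le_lt_trans _ _ (Num.max r0 (q + K / c))) ?le_max ?lexx // ltrDl.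
have r2 : q + K / c < r.
  by rewrite /r (@le_lt_trans _ _ (Num.max r0 (q + K / c))) ?le_max ?lexx ?orbT // ltrDl.
have := h r r1; rewrite leNgt => /negP; apply.
by rewrite mulrC -ltr_pdivrMr // ltrBrDl.
Qed.

Lemma kernel_hol w V : (forall z, V z -> z != w) ->
  exists k', hol V (fun z => z / (z - w)) k'.
Proof.
move=> Vw; eexists; apply: (holM (hol_id _) (holV _ (holD (hol_id _) (hol_cst _ (- w))))).
by move=> z /Vw; rewrite subr_eq0.
Qed.

Lemma cauchy_int_indep V f f' (r1 r2 : R) w : 0 < r1 -> r1 < r2 -> hol V f f' ->
  (forall z, r1 <= cabs z <= r2 -> V z /\ z != w) ->
  cauchy_int 1 r1 f w = cauchy_int 1 r2 f w.
Proof.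
move=> r10 r12 hf hV.
have [k' hk] := @kernel_hol w [set z | V z /\ z != w] (fun z h => h.2).
have hF := holM (hol_sub (W := [set z | V z /\ z != w]) (fun z h => h.1) hf) hk.
apply: (@cauchy_annulus R r1 r2 _ _ (ltW r10) r12 (fun z hz => hol_cont hF (hV z hz))).
by apply: hol_sub hF => z /= /andP[a b]; apply: hV; rewrite !ltW.
Qed.

(** The integral does not change when the radius grows, and its distance to 1 is the modulus of the
    mean of w / (z - w), at most 2|w| / (r - |w|). *)
Lemma cauchy_int1 (r : R) w : 0 < r -> cabs w < r -> cauchy_int 1 r (fun=> 1) w = 1.
Proof.
move=> r0 wr; apply/eqP; rewrite -subr_eq0 -cabs_eq0; apply/eqP.
apply: (@limit_le0 _ (cabs w *+ 2) (cabs w) r (cabs_ge0 _)) => r' rr'.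
have r'0 : 0 < r' by lra.
have wr' : cabs w != r' by rewrite lt_eqF //; lra.
rewrite (@cauchy_int_indep setT _ _ _ _ _ r0 rr' (hol_cst _ 1)); last first.
  move=> z /andP[rz _]; split=> //; apply/eqP => zw; rewrite zw in rz; lra.
have E : cauchy_int 1 r' (fun=> 1) w - 1 = mean (fun t => w * (1 * (1 / (r'%:C * cis t - w)))).
  have := mean_sub 1 (cauchy_int_cont 1 r'0 (@cont_circle_cst r' 1) wr') (ccont_cst 1).
  rewrite mean_cst mulr1 => <-; apply: eq_mean => t.
  have zw : r'%:C * cis t - w != 0 by rewrite subr_eq0 circle_neq.
  by rewrite expr1 !mul1r; apply: (mulIf zw); rewrite mulrBl !mulfVK // mul1r opprB addrC subrK.
rewrite E; have c1 : ccont (fun t => w * (1 * (1 / (r'%:C * cis t - w)))).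
  split; apply: (circle_comp_continuous (G := fun z => w * (1 * (1 / (z - w)))) (ltW r'0)) => z zr.
  have zw : [set z | z != w] z by apply/eqP => h; move: wr'; rewrite -h zr eqxx.
  have h := holM (hol_cst [set z | z != w] w) (holM (hol_cst _ 1) (holM (hol_cst _ 1) (holV _ (holD (hol_id _) (hol_cst _ (- w)))))).
  by apply: (hol_cont (h _)) zw => x; rewrite /= subr_eq0.
have K : 0 < r' - cabs w by lra.
rewrite -ler_pdivlMr //; apply: (le_trans (mean_bound (ccontP c1) (B := cabs w / (r' - cabs w)) _)).
  move=> t _; rewrite !mul1r cabsM cabsV ler_wpM2l ?cabs_ge0 // lef_pV2 ?posrE //.
    by apply: le_trans (dist_circle_ge w t (ltW r'0)); rewrite ler_norm.
  by apply: lt_le_trans (dist_circle_ge w t (ltW r'0)); rewrite normr_gt0 gt_eqF.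
by rewrite mulrnAl.
Qed.

(** With w outside, the circle shrinks to radius 0, where the integrand z / (z - w) is 0. *)
Lemma cauchy_int1_out (r : R) w : 0 < r -> r < cabs w -> cauchy_int 1 r (fun=> 1) w = 0.
Proof.
move=> r0 wr.
have wn z : cabs z <= r -> z != w by move=> zr; apply/eqP => h; rewrite h in zr; lra.
have [k' hk] := @kernel_hol w [set z | z != w] (fun z h => h).
have E := @cauchy_annulus R 0 r _ _ (lexx 0) r0 (fun z hz => hol_cont hk (wn z (andP hz).2)).
have {}E : mean (fun t => (0%:C * cis t) / (0%:C * cis t - w)) = mean (fun t => (r%:C * cis t) / (r%:C * cis t - w)).
  by apply: E; apply: hol_sub hk => z /= /andP[_ zr]; apply: wn; exact: ltW.
rewrite /cauchy_int; under eq_mean do rewrite mul1r expr1.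
by rewrite -E; under eq_mean do rewrite mul0r mul0r; rewrite mean_cst.
Qed.

(* The difference quotient at w, extended by
   continuity, has the same mean over all circles, on both sides of w. *)
Lemma cauchy_formula f f' (r0 r1 s r : R) w : hol [set z | r0 < cabs z < r1] f f' ->
  0 < s -> r0 < s -> s < cabs w -> cabs w < r -> r < r1 ->
  f w = cauchy_int 1 r f w - cauchy_int 1 s f w.
Proof.
move=> hf s0 rs sw wr rr.
set V := [set z | _] in hf.
have Vw : V w by rewrite /V /=; apply/andP; split; lra.
have Vo : open (V : set C^o) by exact: open_annulus.
have inV z : s <= cabs z <= r -> V z by move=> /andP[a b]; rewrite /V /=; apply/andP; split; lra.
have [dw _] := hf w Vw.
have [q' hq] := @dq_hol V f f' (f' w) w Vo hf.
have hF := holM (hol_id _) hq.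
pose F z := z * dq f (f' w) w z.
have cF z : s <= cabs z <= r -> {for z, continuous (F : C^o -> C^o)}.
  move=> /inV Vz; have [->|zw] := eqVneq z w; last exact: (hol_cont hF).
  apply: (@continuousM C (C^o) id (dq f (f' w) w)); first exact: cvg_id.
  exact: dq_cont.
(* The circle through w serves as boundary of two annuli; on it F is known to be continuous but not
   differentiable at w. *)
have E1 : mean (fun t => F (s%:C * cis t)) = mean (fun t => F ((cabs w)%:C * cis t)).
  apply: (@cauchy_annulus R s (cabs w) F _ (ltW s0) sw).
    by move=> z /andP[a b]; apply: cF; apply/andP; split; lra.
  apply: hol_sub hF => z /= /andP[a b]; split; first by apply: inV; apply/andP; split; lra.
  by apply/eqP => h; rewrite h in b; lra.
have E2 : mean (fun t => F ((cabs w)%:C * cis t)) = mean (fun t => F (r%:C * cis t)).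
  apply: (@cauchy_annulus R (cabs w) r F _ (cabs_ge0 w) wr).
    by move=> z /andP[a b]; apply: cF; apply/andP; split; lra.
  apply: hol_sub hF => z /= /andP[a b]; split; first by apply: inV; apply/andP; split; lra.
  by apply/eqP => h; rewrite h in a; lra.
have M x : 0 < x -> s <= x <= r -> cabs w != x ->
    mean (fun t => F (x%:C * cis t)) = cauchy_int 1 x f w - f w * cauchy_int 1 x (fun=> 1) w.
  move=> x0 sxr wx.
  have cfx : cont_circle x f by move=> z zx; apply: (hol_cont hf); apply: inV; rewrite zx.
  rewrite -(mean_sub _ (cauchy_int_cont 1 x0 cfx wx) (cauchy_int_cont 1 x0 (@cont_circle_cst x 1) wx)).
  apply: eq_mean => t; have zw := circle_neq t x0 wx.
  rewrite /F /dq (negbTE zw) expr1 mul1r.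
  by move: (_ - w)^-1 (r0 : R) => y _; ring.
have r0' : 0 < r by lra.
have hs : s <= s <= r by apply/andP; split; lra.
have hr : s <= r <= r by apply/andP; split; lra.
have ws : cabs w != s by rewrite gt_eqF.
have wr' : cabs w != r by rewrite lt_eqF.
move: E1; rewrite E2 (M s s0 hs ws) (M r r0' hr wr') (cauchy_int1_out s0 sw) (cauchy_int1 r0' wr).
by rewrite mulr0 mulr1 subr0 => ->; rewrite opprB addrC subrK.
Qed.

End CauchyFormula.

(** * Removable singularities, higher derivatives and division *)

Section Removable.
Variable R : realType.
Local Notation C := R[i].
Implicit Types (z w : C) (f g phi : C -> C).

Definition bounded_near f a := exists M : R, exists2 d : R, 0 < d &
  forall z, z != a -> cabs (z - a) < d -> cabs (f z) <= M.

(** In Cauchy's formula for an annulus the inner integral tends to 0 with the inner radius, because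
    f is bounded near 0. *)
Lemma cauchy_punctured (rho : R) f f' : hol [set z | 0 < cabs z < rho] f f' ->
  bounded_near f 0 -> forall r w, w != 0 -> cabs w < r -> r < rho ->
  f w = cauchy_int 1 r f w.
Proof.
move=> hf [M [d d0 hM]] r w w0 wr rrho.
have cw : 0 < cabs w by rewrite cabs_gt0.
apply/eqP; rewrite -subr_eq0 -cabs_eq0; apply/eqP.
(* The inner radius is 1/k, so that shrinking it becomes the limit k -> oo of [limit_le0]. *)
apply: (@limit_le0 _ _ ((M *+ 2) / cabs w) (cabs w)^-1 (Num.max d^-1 (cabs w)^-1) (cabs_ge0 _)) => k.
rewrite gt_max => /andP[k1 k2].
have ki0 : 0 < k by apply: lt_trans k1; rewrite invr_gt0.
have s0 : 0 < k^-1 by rewrite invr_gt0.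
have sd : k^-1 < d by rewrite -[d]invrK ltf_pV2 ?posrE ?invr_gt0.
have sw : k^-1 < cabs w by rewrite -[cabs w]invrK ltf_pV2 ?posrE ?invr_gt0.
rewrite (cauchy_formula hf s0 s0 sw wr rrho) addrAC subrr sub0r cabsN.
have cs : cont_circle k^-1 f.
  by move=> z zs; apply: (hol_cont hf); rewrite /= zs s0; lra.
have ws : cabs w != k^-1 by rewrite gt_eqF.
have := cauchy_int_bound s0 cs (M := M) _ ws => /(_ _)/le_trans h.
have {}h : cabs (cauchy_int 1 k^-1 f w) <= M * (k^-1 / `|k^-1 - cabs w|) *+ 2.
  apply: h (lexx _) => t _; have zs := @cabs_circle R k^-1 t (ltW s0).
  by apply: hM; rewrite ?subr0 ?zs // -cabs_gt0 zs.
have kw : 0 <= k - (cabs w)^-1 by rewrite subr_ge0 ltW.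
apply: (le_trans (ler_wpM2r kw h)); rewrite ltr0_norm; last by lra.
have n1 : cabs w - k^-1 != 0 by rewrite subr_eq0 gt_eqF.
have -> : k^-1 / - (k^-1 - cabs w) = (cabs w)^-1 * (k - (cabs w)^-1)^-1.
  have n2 : k - (cabs w)^-1 != 0 by rewrite subr_eq0 gt_eqF.
  rewrite opprB; apply: (mulIf n1); apply: (mulIf n2); rewrite mulfVK // mulrAC mulfVK //.
  by rewrite !mulrBr !mulVf ?gt_eqF // mulrC.
rewrite -mulrnAl mulrA mulfVK //.
by rewrite subr_eq0 gt_eqF.
Qed.

Lemma hol_shift V f f' a : hol V f f' ->
  hol [set z | V (z + a)] (fun z => f (z + a)) (fun z => f' (z + a)).
Proof.
move=> hf.
have h1 := holD (hol_id [set z | V (z + a)]) (hol_cst _ a).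
apply: (hol_ext _ _ (hol_comp h1 (hol_sub _ hf))) => //; first by move=> z /=; rewrite addr0 mulr1.
by move=> _ /= [z Vz <-].
Qed.

Lemma hol_cauchy_int m (r : R) g a : 0 < r -> cont_circle r g ->
  hol [set z | cabs (z - a) < r] (fun z => cauchy_int m r g (z - a))
    (fun z => m%:R * cauchy_int m.+1 r g (z - a)).
Proof.
move=> r0 cg; have h : hol [set z | cabs z < r] (cauchy_int m r g) (fun z => m%:R * cauchy_int m.+1 r g z).
  split=> z /= zr; have zr' : cabs z != r by rewrite lt_eqF.
  split; first exact: cauchy_int_derive.
  have c := is_derivec_cont (cauchy_int_derive m.+1 r0 cg zr').
  exact: (cvgMl_tmp (a := m%:R : C) c).
exact: (hol_shift (- a) h).
Qed.

Lemma openc_ball V a : open (V : set C^o) -> V a ->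
  exists2 d : R, 0 < d & forall z, cabs (z - a) < d -> V z.
Proof. by rewrite openE => Vo Va; have := Vo a Va => /nbhscP. Qed.

Lemma open_ball (a : C) (r : R) : open ([set z | cabs (z - a) < r] : set C^o).
Proof.
rewrite openE => z /= za; apply/nbhscP; exists (r - cabs (z - a)); first by rewrite subr_gt0.
move=> w wz /=; have := ler_cabsD (w - z) (z - a); rewrite addrA subrK; lra.
Qed.

(** The puncture at a lets the same formula serve removable singularities and, for f holomorphic at
    a, the differentiability of f'. *)
Lemma local_cauchy V f f' a : open (V : set C^o) -> V a ->
  hol [set z | V z /\ z != a] f f' -> bounded_near f a ->
  exists2 r : R, 0 < r & [/\ forall z, cabs (z - a) < r -> V z,
    cont_circle r (fun z => f (z + a)) &
    forall w, w != a -> cabs (w - a) < r -> f w = cauchy_int 1 r (fun z => f (z + a)) (w - a)].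
Proof.
move=> Vo Va hf [M [d d0 hM]]; have [rho rho0 hr] := openc_ball Vo Va.
have r0 : 0 < rho / 2 by rewrite divr_gt0.
have hs : hol [set z | 0 < cabs z < rho] (fun z => f (z + a)) (fun z => f' (z + a)).
  apply: hol_sub (hol_shift a hf) => z /= /andP[z0 zr]; split.
    by apply: hr; rewrite addrK.
  by rewrite -subr_eq0 addrK -cabs_gt0.
exists (rho / 2) => //; split.
- by move=> z za; apply: hr; lra.
- by move=> z zr; apply: (hol_cont hs); rewrite /= zr; lra.
move=> w wa wr; rewrite -{1}(subrK a w).
apply: (cauchy_punctured hs) => //; rewrite ?subr_eq0 //; last by lra.
exists M, d => // z z0 zd; apply: hM; first by rewrite -subr_eq0 addrK.
by rewrite addrK -[z]subr0.
Qed.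

Lemma removable V f f' a : open (V : set C^o) -> V a ->
  hol [set z | V z /\ z != a] f f' -> bounded_near f a ->
  exists c g', hol V (fun z => if z == a then c else f z) g'.
Proof.
move=> Vo Va hf bf; have [r r0 [hr cg E]] := local_cauchy Vo Va hf bf.
(* The value at a is that of the Cauchy integral, which is holomorphic on the whole disc. *)
exists (cauchy_int 1 r (fun z => f (z + a)) 0); eexists; apply: hol_glue => z Vz.
have [->|za] := eqVneq z a.
  have h := hol_cauchy_int 1 a r0 cg.
  exists [set z | cabs (z - a) < r]; do 2 eexists; split; [exact: open_ball| |exact: h|].
    by rewrite /= subrr cabs0.
  move=> x /= xa; case: eqVneq => [->|xa']; first by rewrite subrr.
  by rewrite E.
exists [set z | V z /\ z != a], f, f'; split => //; first exact: open_punctured.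
by move=> x [_ /negbTE ->].
Qed.

Lemma hol_bounded_near V f f' a : hol V f f' -> V a -> bounded_near f a.
Proof.
move=> hf Va; have /continuousc_at/(_ 1 ltr01)[d d0 hd] := hol_cont hf Va.
exists (cabs (f a) + 1), d => // z _ /hd; have := ler_cabs_dist (f z) (f a); lra.
Qed.

(** Near each point f is a Cauchy integral with m = 1, so f' is one with m = 2 and is again
    differentiable. This keeps the differentiated coefficients of a section holomorphic. *)
Lemma hol_deriv V f f' : open (V : set C^o) -> hol V f f' -> exists f'', hol V f' f''.
Proof.
move=> Vo hf; eexists; apply: hol_glue => a Va.
have hfa := hol_sub (W := [set z | V z /\ z != a]) (fun z h => h.1) hf.
have [r r0 [hr cg E]] := local_cauchy Vo Va hfa (hol_bounded_near hf Va).
set W := [set z | cabs (z - a) < r].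
have Wo : open (W : set C^o) by exact: open_ball.
have Wa : W a by rewrite /W /= subrr cabs0.
have h1 := hol_cauchy_int 1 a r0 cg.
have h2 := hol_cauchy_int 2 a r0 cg.
have EW z : W z -> cauchy_int 1 r (fun z => f (z + a)) (z - a) = f z.
  move=> Wz; have [->|za] := eqVneq z a; last by rewrite -E.
  apply: (@cont_eq R (fun z => cauchy_int 1 r (fun z => f (z + a)) (z - a)) f a).
  - exact: (hol_cont h1 Wa).
  - exact: (hol_cont hf Va).
  by exists r => // x xa xr; rewrite -E.
have h1' := hol_eq Wo h1 EW.
exists W; do 2 eexists; split; [exact: Wo|exact: Wa|exact: h2|].
move=> x Wx /=; rewrite -(hol_unique h1' (hol_sub hr hf) Wx) mul1r //.
Qed.

(** The difference quotient at a is bounded near a, hence has a removable singularity there. Both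
    Taylor expansion and the uniqueness of derivations use this. *)
Lemma hol_division V f f' a : open (V : set C^o) -> V a -> hol V f f' ->
  exists f1 f1', hol V f1 f1' /\ forall z, V z -> f z = f a + (z - a) * f1 z.
Proof.
move=> Vo Va hf; have [q' hq] := @dq_hol R V f f' (f' a) a Vo hf.
have [|c [g' hg]] := removable Vo Va hq.
  have /continuousc_at/(_ 1 ltr01)[d d0 hd] := dq_cont (hf a Va).1.
  exists (cabs (dq f (f' a) a a) + 1), d => // z _ /hd.
  by have := ler_cabs_dist (dq f (f' a) a z) (dq f (f' a) a a); lra.
do 2 eexists; split; first exact: hg.
move=> z Vz /=; case: eqVneq => [->|za]; first by rewrite subrr mul0r addr0.
by rewrite /dq (negbTE za) mulrC mulfVK ?subr_eq0 // addrC subrK.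
Qed.

End Removable.

(** * Laurent expansions on the punctured plane *)

Section Laurent.
Variable R : realType.
Local Notation C := R[i].
Implicit Types (z w : C) (f g A B H : C -> C) (p q : {poly C}).

Definition nz : set C := [set z | z != 0].

Lemma open_nz : open (nz : set C^o).
Proof. exact: open_pt. Qed.

Lemma hol_inv V f f' : hol V f f' ->
  hol [set z | z != 0 /\ V z^-1] (fun z => f z^-1) (fun z => f' z^-1 * (- z ^- 2)).
Proof.
move=> hf.
have h1 : hol [set z | z != 0 /\ V z^-1] (fun z => z^-1) (fun z => - z ^- 2).
  apply: (hol_ext _ _ (holV (f := id) _ (hol_id _))) => //; last by move=> z [].
  by move=> z /=; rewrite mulN1r.
by apply: (hol_comp h1 (hol_sub _ hf)) => _ /= [z [_ Vz] <-].
Qed.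

Lemma hol_exprz (k : int) : hol nz (fun z => z ^ k) (fun z => k%:~R * z ^ (k - 1)).
Proof.
case: k => [[|n]|n].
- apply: (hol_ext _ _ (hol_cst _ 1)) => z; first by rewrite expr0z.
  by rewrite mul0r.
- apply: (hol_ext _ _ (holX nz n.+1)) => // z.
  by rewrite /= -[n.+1]addn1 PoszD addrK.
apply: (hol_eq' open_nz (holV (f := fun z => z ^+ n.+1) _ (holX nz n.+1))) => z /= z0.
  by rewrite expf_neq0.
rewrite NegzE mulrNz -mulNr -opprD -exprnN /= pmulrn -exprM muln2 -addnn.
rewrite (_ : (n.+1 + n.+1 = n + n.+2)%N); last by lia.
rewrite exprD invfM !mulrA mulfK ?expf_neq0 //.
by rewrite addn1.
Qed.

Lemma hol_horner p : exists dp, hol setT (fun z => p.[z]) dp.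
Proof.
elim/poly_ind: p => [|p c [dp IH]].
  by exists (fun=> 0); apply: (hol_ext _ _ (hol_cst _ 0)) => z //; rewrite horner0.
eexists; apply: (hol_ext _ _ (holD (holM IH (hol_id _)) (hol_cst _ c))); last by [].
by move=> z; rewrite !hornerE.
Qed.

Lemma entire_cauchy H H' : hol setT H H' ->
  forall r w, w != 0 -> cabs w < r -> H w = cauchy_int 1 r H w.
Proof.
move=> hH r w w0 wr.
have h1 : hol [set z | 0 < cabs z < r + 1] H H' by apply: hol_sub hH.
apply: (cauchy_punctured h1) => //; last by lra.
exact: (hol_bounded_near hH).
Qed.

Lemma entire_mean H H' (r : R) : hol setT H H' -> 0 < r ->
  H 0 = mean (fun t => H (r%:C * cis t)).
Proof.
move=> hH r0; have := @cauchy_annulus R 0 r H H' (lexx _) r0 (fun z _ => hol_cont hH I) (hol_sub (fun _ _ => I) hH).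
by move=> <-; under eq_mean do rewrite mul0r; rewrite mean_cst.
Qed.

(** By Cauchy's formula and the mean value property H(w) - H(0) is the mean of H(z) w / (z - w),
    which is O(1 / (r - |w|)). A bound outside a disc suffices, as r tends to infinity. *)
Lemma liouville H H' (M rho : R) : hol setT H H' ->
  (forall z, rho < cabs z -> cabs (H z) <= M) -> forall w, H w = H 0.
Proof.
move=> hH hM w; have [->//|w0] := eqVneq w 0.
apply/eqP; rewrite -subr_eq0 -cabs_eq0; apply/eqP.
apply: (@limit_le0 R _ ((M * cabs w) *+ 2) (cabs w) (Num.max rho (cabs w)) (cabs_ge0 _)) => r.
rewrite gt_max => /andP[rr wr].
have r0 : 0 < r by apply: le_lt_trans wr; exact: cabs_ge0.
have wr' : cabs w != r by rewrite lt_eqF.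
have cH : cont_circle r H by move=> z _; exact: (hol_cont hH).
have cc := cauchy_int_cont 1 r0 cH wr'.
have cHc := ccont_circle (ltW r0) cH.
have := mean_sub 1 cc cHc; rewrite -(entire_mean hH r0) -/(cauchy_int 1 r H w) -(entire_cauchy hH w0 wr) mul1r => E.
have K : 0 < r - cabs w by rewrite subr_gt0.
rewrite -ler_pdivlMr // -E.
have -> : (fun t => H (r%:C * cis t) * (r%:C * cis t / (r%:C * cis t - w) ^+ 1) - 1 * H (r%:C * cis t)) =
   (fun t => H (r%:C * cis t) * (w * (r%:C * cis t - w)^-1)).
  apply/funext => t; have zw := circle_neq t r0 wr'; rewrite -subr_eq0 in zw.
  rewrite mul1r -[X in _ - X]mulr1 -mulrBr expr1; congr (_ * _).
  by apply: (mulIf zw); rewrite mulrBl !mulfVK // mul1r opprB addrC subrK.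
have Mb : 0 <= M by apply: le_trans (cabs_ge0 _) (hM (r%:C * cis 0) _); rewrite cabs_circle // ltW.
rewrite mulrnAl -mulrA; apply: mean_bound.
  have c1 : ccont (fun t => w * (r%:C * cis t - w)^-1).
    split; apply: (circle_comp_continuous (G := fun z => w * (z - w)^-1) (ltW r0)) => z zr.
    have zw : [set z | z != w] z by apply/eqP => h; move: wr'; rewrite -h zr eqxx.
    have h := holM (hol_cst [set z | z != w] w) (holV _ (holD (hol_id _) (hol_cst _ (- w)))).
    by apply: (hol_cont (h _)) zw => x; rewrite /= subr_eq0.
  exact: (ccontP (ccontM cHc c1)).
move=> t _; rewrite cabsM; apply: ler_pM; rewrite ?cabs_ge0 //.
  by apply: hM; rewrite cabs_circle // ltW.
rewrite cabsM cabsV ler_wpM2l ?cabs_ge0 // lef_pV2 ?posrE //.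
  by apply: le_trans (dist_circle_ge w t (ltW r0)); rewrite ler_norm.
by apply: lt_le_trans (dist_circle_ge w t (ltW r0)); rewrite normr_gt0 gt_eqF.
Qed.

(** B(w) is the Cauchy integral of f over any circle enclosing w, hence entire. The remainder f - B
    is minus a Cauchy integral over a fixed circle once w lies outside it; so it is bounded at
    infinity and extends there in the coordinate 1/z. *)
Lemma laurent f f' : hol nz f f' -> exists A A' B B',
  [/\ hol setT A A', hol setT B B' & forall z, z != 0 -> f z = A z^-1 + B z].
Proof.
move=> hf.
have cf r : 0 < r -> cont_circle r f.
  by move=> r0 z zr; apply: (hol_cont hf); rewrite /nz /= -cabs_gt0 zr.
have indep r1 r2 w : cabs w < r1 -> r1 < r2 -> cauchy_int 1 r1 f w = cauchy_int 1 r2 f w.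
  move=> w1 r12; have r10 : 0 < r1 by apply: le_lt_trans w1; exact: cabs_ge0.
  apply: (cauchy_int_indep r10 r12 hf) => z /andP[z1 _]; split.
    by rewrite /nz /= -cabs_gt0 (lt_le_trans r10).
  by apply/eqP => h; rewrite h in z1; lra.
(* The radius |w| + 1 is an arbitrary choice above |w|; [BE] replaces it by any other. *)
pose B w := cauchy_int 1 (cabs w + 1) f w.
have BE r w : cabs w < r -> B w = cauchy_int 1 r f w.
  move=> wr; rewrite /B; have [h|h|->//] := ltgtP (cabs w + 1) r; first by apply: indep => //; lra.
  by apply/esym/indep.
have hB : hol setT B (derive1 (B : C^o -> C^o)).
  apply: hol_glue => w0 _.
  have r0 : 0 < cabs w0 + 1 by have := cabs_ge0 w0; lra.
  have h := hol_cauchy_int 1 0 r0 (cf _ r0).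
  exists [set z | cabs (z - 0) < cabs w0 + 1]; do 2 eexists; split.
  - exact: open_ball.
  - by rewrite /= subr0 ltrDl.
  - exact: h.
  by move=> x; rewrite /= subr0 => /BE ->.
pose g z := f z - B z.
have hg := holD hf (holM (hol_cst nz (-1)) (hol_sub (fun _ _ => I) hB)).
have {}hg : exists g', hol nz g g'.
  by eexists; apply: (hol_ext _ _ hg) => z //; rewrite mulN1r.
have [g' {}hg] := hg.
(* For |z| > 2 the difference is minus the integral over the unit circle, and 1 / (|z| - 1) <= 1
   there. *)
have [M M0 hM] : exists2 M : R, 0 <= M & forall z, 2 < cabs z -> cabs (g z) <= M.
  have [M M0 hM] := circle_bound ler01 (cf 1 ltr01).
  exists (M *+ 2) => [|z z2]; first by rewrite mulrn_wge0.
  have zr : cabs z < cabs z + 1 by rewrite ltrDl.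
  have h1 : hol [set z' | 0 < cabs z' < cabs z + 2] f f'.
    by apply: hol_sub hf => x /= /andP[x0 _]; rewrite /nz /= -cabs_gt0.
  have z1 : 1 < cabs z by lra.
  have z1' : cabs z != 1 by rewrite gt_eqF.
  have E : f z = cauchy_int 1 (cabs z + 1) f z - cauchy_int 1 1 f z.
    by apply: (cauchy_formula h1 ltr01 ltr01 z1 zr); lra.
  rewrite /g (BE _ _ zr) E addrAC subrr sub0r cabsN.
  apply: (le_trans (cauchy_int_bound ltr01 (cf 1 ltr01) hM z1')).
  rewrite ler_wMn2r // ler_piMr // ltr0_norm ?subr_lt0 // opprB div1r invf_le1; lra.
have hgi := hol_inv hg.
have [||c [A' hA]] := @removable R setT (fun z => g z^-1) _ 0 openT I (hol_sub _ hgi).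
- by move=> z [_ z0]; split=> //; rewrite /nz /= invr_eq0.
- exists M, 2^-1 => // z z0; rewrite subr0 => z2; apply: hM.
  by rewrite cabsV -[2]invrK ltf_pV2 ?posrE ?invr_gt0 ?cabs_gt0.
do 4 eexists; split; [exact: hA|exact: hB|].
by move=> z z0 /=; rewrite invr_eq0 (negbTE z0) invrK /g subrK.
Qed.

Lemma taylor A A' N : hol setT A A' -> exists p A1 A1', [/\ (size p <= N)%N,
  hol setT A1 A1' & forall v, A v = p.[v] + v ^+ N * A1 v].
Proof.
move=> hA; elim: N => [|N [p [A1 [A1' [sp hA1 E]]]]].
  by exists 0, A, A'; split; rewrite ?size_poly0 // => v; rewrite horner0 add0r mul1r.
have [A2 [A2' [hA2 E2]]] := hol_division openT I hA1 (a := 0).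
exists (p + (A1 0) *: 'X^N), A2, A2'; split=> //.
  rewrite (leq_trans (size_polyD _ _)) // geq_max (leq_trans sp) //=.
  by rewrite (leq_trans (size_scale_leq _ _)) // size_polyXn.
move=> v; rewrite E (E2 v) // subr0 hornerD hornerZ hornerXn exprS; ring.
Qed.

(** The exponents -1, ..., -N form the tail; those from -N - 1 downwards go to A, and the
    non-negative ones to B. *)
Lemma laurent_split N f f' : hol nz f f' -> exists q A A' B B',
  [/\ (size q <= N)%N, hol setT A A', hol setT B B' &
    forall z, z != 0 -> f z = ('X * q).[z^-1] + z^-1 ^+ N.+1 * A z^-1 + B z].
Proof.
move=> /laurent[A [A' [B [B' [hA hB E]]]]].
have [p [A1 [A1' [sp hA1 E1]]]] := taylor N.+1 hA.
move: sp E1; elim/poly_ind: p => [|q c _] sp E1.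
  exists 0, A1, A1', B, B'; split; rewrite ?size_poly0 // => z z0.
  by rewrite E // E1 mulr0.
have sq : (size q <= N)%N.
  move: sp; rewrite size_MXaddC; case: ifP => //; case/andP => /eqP-> _.
  by rewrite size_poly0.
(* The constant term of the Taylor polynomial of A belongs to the part regular at 0. *)
exists q, A1, A1', (fun z => B z + c); eexists; split => //.
  exact: (holD hB (hol_cst _ c)).
move=> z z0; rewrite E // E1 hornerMXaddC hornerM hornerX.
by set e := z^-1; move: q.[e] (A1 e) (e ^+ N.+1) => a b d; ring.
Qed.

(** A comparison of orders at 0: the right side vanishes to order N, the degree of p is below N. *)
Lemma poly_vanish N p A : (size p <= N)%N -> {for 0, continuous (A : C^o -> C^o)} ->
  (forall v, v != 0 -> p.[v] = v ^+ N * A v) -> p = 0.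
Proof.
move=> + cA; elim: N p => [|N IH] p; first by rewrite leqn0 size_poly_eq0 => /eqP.
elim/poly_ind: p => [//|q c _] sp E.
have c0 : c = 0.
  have [dp hp] := hol_horner (q * 'X + c%:P).
  have hx := hol_cont (holX setT N.+1) (I : setT 0).
  have : (q * 'X + c%:P).[0] = 0 ^+ N.+1 * A 0.
    apply: (@cont_eq R (fun z => (q * 'X + c%:P).[z]) (fun z => z ^+ N.+1 * A z)).
    - exact: (hol_cont hp I).
    - by apply: (@continuousM C (C^o) (fun z => z ^+ N.+1) A); [exact: hx|exact: cA].
    by exists 1 => // z z0 _; rewrite E.
  by rewrite hornerMXaddC mulr0 add0r exprS !mul0r.
have sq : (size q <= N)%N.
  move: sp; rewrite size_MXaddC; case: ifP => //; case/andP => /eqP-> _.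
  by rewrite size_poly0.
rewrite c0 addr0 (IH q) ?mul0r // => v v0; apply: (mulIf v0).
by have := E v v0; rewrite !hornerE c0 addr0 exprS => ->; ring.
Qed.

(** The entire function p(v) - v^{N+1} A(v) equals B(1/v) for v != 0, hence is bounded at infinity.
    It is constant by Liouville and vanishes at 0, so p = 0 by comparing orders, and then A = 0 off
    the origin. *)
Lemma laurent_unique N p A A' B B' : hol setT A A' -> hol setT B B' ->
  (size p <= N.+1)%N -> p.[0] = 0 ->
  (forall z, z != 0 -> p.[z^-1] = z^-1 ^+ N.+1 * A z^-1 + B z) ->
  p = 0 /\ forall v, v != 0 -> A v = 0.
Proof.
move=> hA hB sp p0 E; have [dp hp] := hol_horner p.
have hH := holD hp (holM (hol_cst _ (-1)) (holM (holX setT N.+1) hA)).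
have HB v : v != 0 -> p.[v] + -1 * (v ^+ N.+1 * A v) = B v^-1.
  by move=> v0; rewrite -{1}[v]invrK E ?invr_eq0 // invrK; ring.
have /continuousc_at/(_ 1 ltr01)[d d0 hd] := hol_cont hB (I : setT 0).
(* If |z| > 1/d then 1/z lies where B differs from B(0) by less than 1. *)
have H0 := @liouville _ _ (cabs (B 0) + 1) d^-1 hH.
have {}H0 v : p.[v] = v ^+ N.+1 * A v.
  have := H0 _ v; rewrite p0 expr0n !mul0r mulr0 addr0 => h.
  apply/eqP; rewrite -subr_eq0 -mulN1r h // => z zd.
  have z0 : 0 < cabs z by apply: lt_trans zd; rewrite invr_gt0.
  have z0' : z != 0 by rewrite -cabs_gt0.
  rewrite HB //; have := hd z^-1; rewrite subr0 cabsV => /(_ _)H.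
  have {}H : cabs (B z^-1 - B 0) < 1.
    by apply: H; rewrite -[d]invrK ltf_pV2 ?posrE ?invr_gt0.
  have := ler_cabs_dist (B z^-1) (B 0); lra.
have pz : p = 0 by apply: (poly_vanish sp (hol_cont hA I)) => v _; exact: H0.
split=> // v v0; have := H0 v; rewrite pz horner0 => /esym/eqP.
by rewrite mulf_eq0 expf_eq0 (negbTE v0) andbF => /eqP.
Qed.

End Laurent.

(** * The exterior algebra of C^3 *)

Section ExteriorAlgebra.
Variable R : realType.
Local Notation C := R[i].
Local Notation ext := (ext R).

Definition i0 : 'I_3 := ord0.
Definition i1 : 'I_3 := @Ordinal 3 1 isT.
Definition i2 : 'I_3 := @Ordinal 3 2 isT.

(** A subset is given by its three membership bits, so that identities of the exterior algebra
    become eight cases for [ring]. Locking keeps the sets folded under simplification. *)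
Definition mk : bool -> bool -> bool -> {set 'I_3} := locked (fun b0 b1 b2 =>
  [set i : 'I_3 | nth false [:: b0; b1; b2] i]%SET).

Lemma in_mk b0 b1 b2 (i : 'I_3) : (i \in mk b0 b1 b2) = nth false [:: b0; b1; b2] i.
Proof. by rewrite /mk -lock inE. Qed.

Lemma ord3_ind (P : 'I_3 -> Prop) : P i0 -> P i1 -> P i2 -> forall i, P i.
Proof.
move=> p0 p1 p2 [[|[|[|//]]] h].
- by rewrite (_ : Ordinal h = i0) //; apply: val_inj.
- by rewrite (_ : Ordinal h = i1) //; apply: val_inj.
- by rewrite (_ : Ordinal h = i2) //; apply: val_inj.
Qed.

Lemma mkE (S : {set 'I_3}) : S = mk (i0 \in S) (i1 \in S) (i2 \in S).
Proof. by apply/setP; apply: ord3_ind; rewrite in_mk. Qed.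

Lemma mk_ind (P : {set 'I_3} -> Prop) : (forall b0 b1 b2, P (mk b0 b1 b2)) -> forall S, P S.
Proof. by move=> h S; rewrite [S]mkE; exact: h. Qed.

Lemma mk_inj b0 b1 b2 c0 c1 c2 : (mk b0 b1 b2 == mk c0 c1 c2) = [&& b0 == c0, b1 == c1 & b2 == c2].
Proof.
apply/eqP/and3P => [/setP E|[/eqP-> /eqP-> /eqP->]] //.
by have := (E i0, E i1, E i2); rewrite !in_mk /= => -[[-> ->] ->].
Qed.

Lemma mk_subset b0 b1 b2 c0 c1 c2 : (mk b0 b1 b2 \subset mk c0 c1 c2) = [&& b0 ==> c0, b1 ==> c1 & b2 ==> c2].
Proof.
apply/fintype.subsetP/and3P => [E|[h0 h1 h2]].
  by have := (E i0, E i1, E i2); rewrite !in_mk /= => -[[h0 h1] h2]; split; apply/implyP.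
by apply: ord3_ind; rewrite !in_mk; exact/implyP.
Qed.

Lemma mk_setD b0 b1 b2 c0 c1 c2 :
  (mk c0 c1 c2 :\: mk b0 b1 b2)%SET = mk (~~ b0 && c0) (~~ b1 && c1) (~~ b2 && c2).
Proof. by apply/setP; apply: ord3_ind; rewrite finset.in_setD !in_mk. Qed.

Lemma sum_ord3 (V : nmodType) (F : 'I_3 -> V) : \sum_i F i = F i0 + (F i1 + F i2).
Proof.
rewrite !big_ord_recl big_ord0 Algebra.addr0.
by congr (_ + (F _ + F _)); apply: val_inj.
Qed.

Lemma mk_card b0 b1 b2 : #|mk b0 b1 b2| = (b0 + (b1 + b2))%N.
Proof. by rewrite -sum1_card big_mkcond /= sum_ord3 !in_mk; case: b0 b1 b2 => [] [] []. Qed.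

Lemma inversions_mk b0 b1 b2 c0 c1 c2 :
  inversions (mk b0 b1 b2) (mk c0 c1 c2) = ((b1 && c0) + (b2 && c0) + (b2 && c1))%N.
Proof.
rewrite /inversions (@eq_card _ _ [pred p : 'I_3 * 'I_3 |
  [&& p.1 \in mk b0 b1 b2, p.2 \in mk c0 c1 c2 & (p.2 < p.1)%N]]); last first.
  by move=> p; apply/idP/idP => [/set_mem|h] //; exact/mem_set.
rewrite -sum1_card big_mkcond /=.
rewrite -(pair_bigA _ (fun i j : 'I_3 => if [&& i \in mk b0 b1 b2, j \in mk c0 c1 c2 & (j < i)%N] then 1 else 0)%N) /=.
by rewrite !sum_ord3 !in_mk /=; case: b0 b1 b2 c0 c1 c2 => [] [] [] [] [] [].
Qed.

Lemma sum_mk (V : nmodType) (F : {set 'I_3} -> V) :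
  \sum_S F S = \sum_(b0 : bool) \sum_(b1 : bool) \sum_(b2 : bool) F (mk b0 b1 b2).
Proof.
rewrite pair_bigA pair_bigA /= (reindex (fun p : bool * bool * bool => mk p.1.1 p.1.2 p.2)) //=.
exists (fun S : {set 'I_3} => (i0 \in S, i1 \in S, i2 \in S)) => [[[b0 b1] b2] _|S _] /=.
  by rewrite !in_mk.
by rewrite -mkE.
Qed.

Lemma wedge_mk (a b : ext) c0 c1 c2 : wedge a b (mk c0 c1 c2) =
  \sum_(b0 : bool) \sum_(b1 : bool) \sum_(b2 : bool)
   if [&& b0 ==> c0, b1 ==> c1 & b2 ==> c2] then
   (-1) ^+ ((b1 && (~~ b0 && c0)) + (b2 && (~~ b0 && c0)) + (b2 && (~~ b1 && c1)))%N *
   a (mk b0 b1 b2) * b (mk (~~ b0 && c0) (~~ b1 && c1) (~~ b2 && c2)) else 0.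
Proof.
rewrite ffunE big_mkcond /= sum_mk; do 3 (apply: eq_bigr => ? _).
by rewrite powersetE mk_subset mk_setD inversions_mk.
Qed.

Lemma wedge000 (a b : ext) : wedge a b (mk false false false) = a (mk false false false) * b (mk false false false).
Proof. by rewrite wedge_mk !big_bool /=; ring. Qed.

Lemma wedge100 (a b : ext) : wedge a b (mk true false false) =
  a (mk false false false) * b (mk true false false) + a (mk true false false) * b (mk false false false).
Proof. by rewrite wedge_mk !big_bool /=; ring. Qed.

Lemma wedge010 (a b : ext) : wedge a b (mk false true false) =
  a (mk false false false) * b (mk false true false) + a (mk false true false) * b (mk false false false).
Proof. by rewrite wedge_mk !big_bool /=; ring. Qed.

Lemma wedge001 (a b : ext) : wedge a b (mk false false true) =
  a (mk false false false) * b (mk false false true) + a (mk false false true) * b (mk false false false).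
Proof. by rewrite wedge_mk !big_bool /=; ring. Qed.

Lemma wedge110 (a b : ext) : wedge a b (mk true true false) =
  a (mk false false false) * b (mk true true false) + a (mk true false false) * b (mk false true false)
  - a (mk false true false) * b (mk true false false) + a (mk true true false) * b (mk false false false).
Proof. by rewrite wedge_mk !big_bool /=; ring. Qed.

Lemma wedge101 (a b : ext) : wedge a b (mk true false true) =
  a (mk false false false) * b (mk true false true) + a (mk true false false) * b (mk false false true)
  - a (mk false false true) * b (mk true false false) + a (mk true false true) * b (mk false false false).
Proof. by rewrite wedge_mk !big_bool /=; ring. Qed.

Lemma wedge011 (a b : ext) : wedge a b (mk false true true) =
  a (mk false false false) * b (mk false true true) + a (mk false true false) * b (mk false false true)
  - a (mk false false true) * b (mk false true false) + a (mk false true true) * b (mk false false false).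
Proof. by rewrite wedge_mk !big_bool /=; ring. Qed.

Lemma wedge111 (a b : ext) : wedge a b (mk true true true) =
  a (mk false false false) * b (mk true true true) + a (mk true false false) * b (mk false true true)
  - a (mk false true false) * b (mk true false true) + a (mk false false true) * b (mk true true false)
  + a (mk true true false) * b (mk false false true) - a (mk true false true) * b (mk false true false)
  + a (mk false true true) * b (mk true false false) + a (mk true true true) * b (mk false false false).
Proof. by rewrite wedge_mk !big_bool /=; ring. Qed.

Definition wedgeE := (wedge000, wedge100, wedge010, wedge001, wedge110, wedge101, wedge011, wedge111).

End ExteriorAlgebra.

Section ExtMap.
Variable R : realType.
Local Notation C := R[i].
Local Notation ext := (ext R).

Lemma ext_eq (a b : ext) : (forall b0 b1 b2, a (mk b0 b1 b2) = b (mk b0 b1 b2)) -> a = b.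
Proof. by move=> h; apply/ffunP; exact: mk_ind. Qed.

Lemma ffunZE (c : C) (a : ext) S : (c *: a) S = c * a S.
Proof. by rewrite ffunE. Qed.

Lemma ffunDE (a b : ext) S : (a + b) S = a S + b S.
Proof. by rewrite ffunE. Qed.

Lemma ffun0E S : (0 : ext) S = 0.
Proof. by rewrite ffunE. Qed.

Lemma set1_mk (i : 'I_3) : [set i]%SET = mk (i0 == i) (i1 == i) (i2 == i).
Proof. by rewrite {1}[[set i]%SET]mkE !finset.in_set1. Qed.

Lemma set0_mk : finset.set0 = mk false false false.
Proof. by rewrite {1}[finset.set0]mkE !finset.in_set0. Qed.

Lemma ebase_mk b0 b1 b2 c0 c1 c2 : ebase R (mk b0 b1 b2) (mk c0 c1 c2) =
  [&& c0 == b0, c1 == b1 & c2 == b2]%:R.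
Proof. by rewrite ffunE mk_inj. Qed.

Lemma enum_mk b0 b1 b2 : enum (mk b0 b1 b2) = (if b0 then [:: i0] else [::]) ++
  (if b1 then [:: i1] else [::]) ++ (if b2 then [:: i2] else [::]).
Proof.
have E : Finite.enum 'I_3 = [:: i0; i1; i2].
  by rewrite -enumT; apply: (inj_map val_inj); rewrite val_enum_ord.
by rewrite /enum_mem E /= !in_mk /=; case: b0 b1 b2 => [] [] [].
Qed.

(** The image of e_j under g, that is, column j; locked so that [vec_mk] is the only way to compute
    with it. *)
Definition vec : 'M[C]_3 -> 'I_3 -> ext :=
  locked (fun g j => \sum_(i < 3) g i j *: ebase R [set i]%SET).

Lemma vec_mk (g : 'M[C]_3) j b0 b1 b2 : vec g j (mk b0 b1 b2) =
  if b0 then (if b1 || b2 then 0 else g i0 j) else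
  if b1 then (if b2 then 0 else g i1 j) else if b2 then g i2 j else 0.
Proof.
have -> : vec g j (mk b0 b1 b2) = \sum_(i < 3) g i j * (mk b0 b1 b2 == [set i]%SET)%:R.
  by rewrite /vec -lock sum_ffunE; apply: eq_bigr => i _; rewrite ffunZE ffunE.
rewrite sum_ord3 !set1_mk !mk_inj.
by case: b0 b1 b2 => [] [] [] /=; ring.
Qed.

Lemma wedge1l (a : ext) : wedge (ebase R finset.set0) a = a.
Proof. by apply: ext_eq => [[] [] []]; rewrite wedgeE set0_mk !ebase_mk /=; ring. Qed.

Lemma wedge1r (a : ext) : wedge a (ebase R finset.set0) = a.
Proof. by apply: ext_eq => [[] [] []]; rewrite wedgeE set0_mk !ebase_mk /=; ring. Qed.

Lemma ext_map_sum (g : 'M[C]_3) (a : ext) S : ext_map g a S = 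
  \sum_(b0 : bool) \sum_(b1 : bool) \sum_(b2 : bool) a (mk b0 b1 b2) *
   (\big[@wedge R/ebase R finset.set0]_(j <- (if b0 then [:: i0] else [::]) ++
  (if b1 then [:: i1] else [::]) ++ (if b2 then [:: i2] else [::])) vec g j) S.
Proof.
rewrite /ext_map sum_ffunE sum_mk; do 3 (apply: eq_bigr => ? _).
by rewrite ffunZE enum_mk /vec -lock.
Qed.

Definition minor (g : 'M[C]_3) (i i' j j' : 'I_3) : C := g i j * g i' j' - g i j' * g i' j.

Lemma vec2_mk (g : 'M[C]_3) j k b0 b1 b2 : wedge (vec g j) (vec g k) (mk b0 b1 b2) =
  if b0 then (if b1 then (if b2 then 0 else minor g i0 i1 j k)
    else if b2 then minor g i0 i2 j k else 0)
  else if b1 && b2 then minor g i1 i2 j k else 0.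
Proof.
by rewrite /minor; case: b0 b1 b2 => [] [] [] /=; rewrite wedgeE !vec_mk /=; ring.
Qed.

Lemma vec3_mk (g : 'M[C]_3) b0 b1 b2 : wedge (vec g i0) (wedge (vec g i1) (vec g i2)) (mk b0 b1 b2) =
  if [&& b0, b1 & b2] then g i0 i0 * minor g i1 i2 i1 i2 - g i1 i0 * minor g i0 i2 i1 i2 + g i2 i0 * minor g i0 i1 i1 i2
  else 0.
Proof.
by case: b0 b1 b2 => [] [] [] /=; rewrite wedgeE !vec2_mk !vec_mk /=; ring.
Qed.

(** In degrees 0, 1, 2, 3 the action is by 1, g, the 2 x 2 minors of g and det g, the last one
    expanded along the first column. *)
Lemma ext_map_mk (g : 'M[C]_3) (a : ext) b0 b1 b2 : ext_map g a (mk b0 b1 b2) =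
  if b0 then
    if b1 then
      if b2 then (g i0 i0 * minor g i1 i2 i1 i2 - g i1 i0 * minor g i0 i2 i1 i2 + g i2 i0 * minor g i0 i1 i1 i2) * a (mk true true true)
      else minor g i0 i1 i0 i1 * a (mk true true false) + minor g i0 i1 i0 i2 * a (mk true false true) + minor g i0 i1 i1 i2 * a (mk false true true)
    else
      if b2 then minor g i0 i2 i0 i1 * a (mk true true false) + minor g i0 i2 i0 i2 * a (mk true false true) + minor g i0 i2 i1 i2 * a (mk false true true)
      else g i0 i0 * a (mk true false false) + g i0 i1 * a (mk false true false) + g i0 i2 * a (mk false false true)
  else
    if b1 then
      if b2 then minor g i1 i2 i0 i1 * a (mk true true false) + minor g i1 i2 i0 i2 * a (mk true false true) + minor g i1 i2 i1 i2 * a (mk false true true)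
      else g i1 i0 * a (mk true false false) + g i1 i1 * a (mk false true false) + g i1 i2 * a (mk false false true)
    else
      if b2 then g i2 i0 * a (mk true false false) + g i2 i1 * a (mk false true false) + g i2 i2 * a (mk false false true)
      else a (mk false false false).
Proof.
rewrite ext_map_sum.
rewrite !big_bool.
rewrite /=.
rewrite !big_cons.
rewrite !big_nil.
rewrite !wedge1r.
rewrite !vec3_mk.
rewrite !vec2_mk.
rewrite !vec_mk set0_mk !ebase_mk.
by case: b0 b1 b2 => [] [] [] /=; ring.
Qed.

Lemma ext_map_lin (g : 'M[C]_3) c (a b : ext) : ext_map g (c *: a + b) = c *: ext_map g a + ext_map g b.
Proof.
by apply: ext_eq => [[] [] []]; rewrite !(ffunDE, ffunZE, ext_map_mk) /=; ring.
Qed.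

Lemma ext_map_wedge (g : 'M[C]_3) (a b : ext) : ext_map g (wedge a b) = wedge (ext_map g a) (ext_map g b).
Proof.
by apply: ext_eq => [[] [] []]; rewrite !(ext_map_mk, wedgeE) /minor /=; ring.
Qed.

Lemma mulmx3 (g h : 'M[C]_3) i j : (g *m h) i j = g i i0 * h i0 j + (g i i1 * h i1 j + g i i2 * h i2 j).
Proof. by rewrite mxE sum_ord3. Qed.

Lemma minorM (g h : 'M[C]_3) i i' j j' : minor (g *m h) i i' j j' =
  minor g i i' i0 i1 * minor h i0 i1 j j' + minor g i i' i0 i2 * minor h i0 i2 j j' +
  minor g i i' i1 i2 * minor h i1 i2 j j'.
Proof.
rewrite /minor !mulmx3.
move: (g i i0) (g i i1) (g i i2) (g i' i0) (g i' i1) (g i' i2) => a0 a1 a2 b0 b1 b2.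
move: (h i0 j) (h i1 j) (h i2 j) (h i0 j') (h i1 j') (h i2 j') => c0 c1 c2 d0 d1 d2.
by ring.
Qed.

(** Degree 2 is the Cauchy-Binet formula [minorM], degree 3 the multiplicativity of the
    determinant. *)
Lemma ext_map_comp (g h : 'M[C]_3) (a : ext) : ext_map g (ext_map h a) = ext_map (g *m h) a.
Proof.
(* With [ext_map] replaced by a variable only its table of coefficients remains, and nothing
   unfolds. *)
have := @ext_map_mk; move: (@ext_map R) => em emE.
have main b0 b1 b2 : ~~ [&& b0, b1 & b2] ->
    em g (em h a) (mk b0 b1 b2) = em (g *m h) a (mk b0 b1 b2).
  case: b0 b1 b2 => [] [] [] // _; rewrite [LHS]emE /= !emE /= ?minorM ?mulmx3; by ring.
apply: ext_eq => b0 b1 b2; have [|/main//] := boolP [&& b0, b1 & b2].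
case/and3P => -> -> ->; rewrite [LHS]emE /= !emE /= mulrA; congr (_ * _).
rewrite !minorM !mulmx3 /minor.
move: (g i0 i0) (g i0 i1) (g i0 i2) (g i1 i0) (g i1 i1) (g i1 i2) (g i2 i0) (g i2 i1) (g i2 i2) => x0 x1 x2 y0 y1 y2 z0 z1 z2.
move: (h i0 i0) (h i0 i1) (h i0 i2) (h i1 i0) (h i1 i1) (h i1 i2) (h i2 i0) (h i2 i1) (h i2 i2) => d0 d1 d2 e0 e1 e2 f0 f1 f2.
by ring.
Qed.

Lemma ext_map1 (a : ext) : ext_map 1%:M a = a.
Proof.
apply: ext_eq => [[] [] []]; rewrite ext_map_mk /= /minor ?mxE /= //; by ring.
Qed.

Lemma ext_map_one (g : 'M[C]_3) : ext_map g (ebase R finset.set0) = ebase R finset.set0.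
Proof.
apply: ext_eq => [[] [] []]; rewrite set0_mk ext_map_mk !ebase_mk /= //; by ring.
Qed.

Definition w2 : ('I_3 -> C) -> ext := locked (fun v => [ffun S : {set 'I_3} =>
  if S == mk true true false then v i0 else
  if S == mk true false true then v i1 else
  if S == mk false true true then v i2 else 0 : C^o]).

Lemma w2_mk (v : 'I_3 -> C) b0 b1 b2 : w2 v (mk b0 b1 b2) =
  if b0 then (if b1 then (if b2 then 0 else v i0) else if b2 then v i1 else 0)
  else if b1 && b2 then v i2 else 0.
Proof. by rewrite /w2 -lock ffunE !mk_inj; case: b0 b1 b2 => [] [] []. Qed.

Lemma wedge_w2 (v : 'I_3 -> C) (a : ext) b0 b1 b2 : wedge (w2 v) a (mk b0 b1 b2) =
  if b0 then (if b1 then (if b2 then v i0 * a (mk false false true) - v i1 * a (mk false true false) + v i2 * a (mk true false false)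
     else v i0 * a (mk false false false)) else if b2 then v i1 * a (mk false false false) else 0)
  else if b1 && b2 then v i2 * a (mk false false false) else 0.
Proof. by case: b0 b1 b2 => [] [] []; rewrite wedgeE !w2_mk /=; ring. Qed.

(* The value at a point of the derivation z |-> u, e_j |-> v /\ e_j, on a
   section with value a and derivative da. *)
Definition dform (u v : 'I_3 -> C) (da a : ext) : ext :=
  wedge (w2 u) da + wedge (w2 v) (- a (mk false false false) *: ebase R finset.set0 + a).

Lemma dform_mk (u v : 'I_3 -> C) (da a : ext) b0 b1 b2 : dform u v da a (mk b0 b1 b2) =
  if b0 then (if b1 then (if b2 then
       u i0 * da (mk false false true) - u i1 * da (mk false true false) + u i2 * da (mk true false false)
     + (v i0 * a (mk false false true) - v i1 * a (mk false true false) + v i2 * a (mk true false false))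
     else u i0 * da (mk false false false)) else if b2 then u i1 * da (mk false false false) else 0)
  else if b1 && b2 then u i2 * da (mk false false false) else 0.
Proof.
rewrite /dform ffunDE !wedge_w2 set0_mk.
have E c0 c1 c2 : (- a (mk false false false) *: ebase R (mk false false false) + a) (mk c0 c1 c2) =
    if [|| c0, c1 | c2] then a (mk c0 c1 c2) else 0.
  by rewrite ffunDE ffunZE ebase_mk; case: c0 c1 c2 => [] [] [] /=; ring.
by rewrite !E /=; case: b0 b1 b2 => [] [] [] /=; ring.
Qed.

(** The part with v multiplies elements of positive degree by a 2-form and kills constants. In rank
    3 this is a derivation: a product of two elements of positive degree has degree at least 2, and
    a 2-form annihilates it. *)
Lemma dform_leibniz u v (da a db b : ext) :
  dform u v (wedge da b + wedge a db) (wedge a b) = wedge (dform u v da a) b + wedge a (dform u v db b).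
Proof.
apply: ext_eq => [[] [] []]; rewrite [RHS]ffunDE dform_mk !wedgeE !dform_mk /= ?ffunDE ?wedgeE; by ring.
Qed.

Lemma dform_lin u v c (da a db b : ext) :
  dform u v (c *: da + db) (c *: a + b) = c *: dform u v da a + dform u v db b.
Proof.
apply: ext_eq => [[] [] []]; rewrite [RHS]ffunDE [X in _ = X + _]ffunZE !dform_mk /= ?ffunDE ?ffunZE; by ring.
Qed.

Lemma dform_lin_uv u v u' v' c (da a : ext) :
  dform (fun r => c * u r + u' r) (fun r => c * v r + v' r) da a =
  c *: dform u v da a + dform u' v' da a.
Proof.
apply: ext_eq => [[] [] []]; rewrite [RHS]ffunDE [X in _ = X + _]ffunZE !dform_mk /=; by ring.
Qed.

Lemma pair_of0 : pair_of i0 = (i0, i1).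
Proof. by rewrite /pair_of (tnth_nth (i0, i0)) /=; congr (_, _); apply: val_inj; rewrite /= inordK. Qed.
Lemma pair_of1 : pair_of i1 = (i0, i2).
Proof. by rewrite /pair_of (tnth_nth (i0, i0)) /=; congr (_, _); apply: val_inj; rewrite /= inordK. Qed.
Lemma pair_of2 : pair_of i2 = (i1, i2).
Proof. by rewrite /pair_of (tnth_nth (i0, i0)) /=; congr (_, _); apply: val_inj; rewrite /= inordK. Qed.

Definition compound (g : 'M[C]_3) : 'M[C]_3 := \matrix_(r, s)
  minor g (pair_of r).1 (pair_of r).2 (pair_of s).1 (pair_of s).2.

Definition compound_act (g : 'M[C]_3) (v : 'I_3 -> C) (r : 'I_3) : C := \sum_s compound g r s * v s.

Lemma compound_actE (g : 'M[C]_3) v r : compound_act g v r =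
  minor g (pair_of r).1 (pair_of r).2 i0 i1 * v i0 + (minor g (pair_of r).1 (pair_of r).2 i0 i2 * v i1 +
  minor g (pair_of r).1 (pair_of r).2 i1 i2 * v i2).
Proof. by rewrite /compound_act sum_ord3 !mxE pair_of0 pair_of1 pair_of2. Qed.

Lemma ext_map_w2 (g : 'M[C]_3) v : ext_map g (w2 v) = w2 (compound_act g v).
Proof.
apply: ext_eq => [[] [] []]; rewrite ext_map_mk !w2_mk /= ?compound_actE ?pair_of0 ?pair_of1 ?pair_of2 /=; by ring.
Qed.

(** As h is constant, [ext_map h da] is the derivative of the section h a; so this is the conjugate
    of [dform] by g, h being its inverse. *)
Lemma ext_map_dform (g h : 'M[C]_3) u v (da a : ext) : g *m h = 1%:M ->
  ext_map g (dform u v (ext_map h da) (ext_map h a)) = dform (compound_act g u) (compound_act g v) da a.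
Proof.
move=> gh; have lin1 (x y : ext) : ext_map g (x + y) = ext_map g x + ext_map g y.
  by have := ext_map_lin g 1 x y; rewrite !scale1r.
have K x : ext_map g (ext_map h x) = x by rewrite ext_map_comp gh ext_map1.
have -> : dform u v (ext_map h da) (ext_map h a) = wedge (w2 u) (ext_map h da) +
   wedge (w2 v) (ext_map h (- a (mk false false false) *: ebase R finset.set0 + a)).
  by rewrite ext_map_lin ext_map_one /dform ext_map_mk.
by rewrite lin1 !ext_map_wedge !ext_map_w2 !K.
Qed.

Lemma S_mk0 : [set (pair_of i0).1; (pair_of i0).2]%SET = mk true true false.
Proof. by rewrite pair_of0 [LHS]mkE !finset.in_set2. Qed.
Lemma S_mk1 : [set (pair_of i1).1; (pair_of i1).2]%SET = mk true false true.
Proof. by rewrite pair_of1 [LHS]mkE !finset.in_set2. Qed.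
Lemma S_mk2 : [set (pair_of i2).1; (pair_of i2).2]%SET = mk false true true.
Proof. by rewrite pair_of2 [LHS]mkE !finset.in_set2. Qed.

End ExtMap.

(** * Derivations in the two charts *)

Section HolE.
Variable R : realType.
Local Notation C := R[i].
Local Notation P1 := (P1 R).
Implicit Types (V : set C) (f g : C -> C).

Definition hole V f := exists f', hol V f f'.

Lemma hole_holomorphic V f : open (V : set C^o) -> hole V f -> holomorphic_on V f.
Proof. by move=> Vo [f' h]; exact: hol_holomorphic Vo h. Qed.

Lemma holomorphic_hole V f : holomorphic_on V f -> hole V f.
Proof. by move=> /holomorphic_hol h; eexists; exact: h. Qed.

Lemma hole_sub V W f : W `<=` V -> hole V f -> hole W f.
Proof. by move=> WV [f' h]; exists f'; exact: hol_sub WV h. Qed.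

Lemma hole_eq V f g : open (V : set C^o) -> (forall z, V z -> f z = g z) -> hole V f -> hole V g.
Proof. by move=> Vo fg [f' h]; exists f'; exact: hol_eq Vo h fg. Qed.

Lemma hole_cst V c : hole V (fun=> c).
Proof. by eexists; exact: hol_cst. Qed.

Lemma hole_id V : hole V id.
Proof. by eexists; exact: hol_id. Qed.

Lemma holeD V f g : hole V f -> hole V g -> hole V (fun z => f z + g z).
Proof. by move=> [f' hf] [g' hg]; eexists; exact: holD hf hg. Qed.

Lemma holeM V f g : hole V f -> hole V g -> hole V (fun z => f z * g z).
Proof. by move=> [f' hf] [g' hg]; eexists; exact: holM hf hg. Qed.

Lemma holeZ V c f : hole V f -> hole V (fun z => c * f z).
Proof. exact: (holeM (hole_cst V c)). Qed.

Lemma holeN V f : hole V f -> hole V (fun z => - f z).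
Proof. by move=> [f' hf]; eexists; apply: (hol_ext _ _ (holM (hol_cst V (-1)) hf)) => z //; rewrite mulN1r. Qed.

Lemma holeB V f g : hole V f -> hole V g -> hole V (fun z => f z - g z).
Proof. by move=> hf hg; exact: (holeD hf (holeN hg)). Qed.

Lemma hole_exprz (k : int) : hole (@nz R) (fun z => z ^ k).
Proof. by eexists; exact: hol_exprz. Qed.

Lemma hole_inv V f : hole V f -> hole [set z | z != 0 /\ V z^-1] (fun z => f z^-1).
Proof. by move=> [f' h]; eexists; exact: hol_inv h. Qed.

Lemma hole_derive1 V f : open (V : set C^o) -> hole V f -> hole V (derive1 (f : C^o -> C^o)).
Proof.
move=> Vo [f' h]; have [f'' h2] := hol_deriv Vo h; exists f''.
by apply: (hol_eq Vo h2) => z Vz; rewrite (hol_derive1 h Vz).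
Qed.

Lemma U1E (p : P1) : U1 R p <-> p <> None.
Proof. by split=> [[z _ <-]//|]; case: p => // z _; exists z. Qed.

Lemma U0E (p : P1) : U0 R p <-> p <> Some 0.
Proof.
split=> [[w _ <-]|].
  by rewrite /chart0; case: eqP => // /eqP w0 [/eqP]; rewrite invr_eq0 (negbTE w0).
case: p => [z|] z0; last by exists 0; rewrite // /chart0 eqxx.
have {}z0 : z != 0 by apply/eqP => h; apply: z0; rewrite h.
by exists z^-1; rewrite // /chart0 invr_eq0 (negbTE z0) invrK.
Qed.

Lemma U01E (z : C) : U01 R (Some z) <-> z != 0.
Proof.
split=> [[/U0E h _]|z0]; first by apply/eqP => z0; apply: h; rewrite z0.
by split; [apply/U0E => -[/eqP]; rewrite (negbTE z0)|apply/U1E].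
Qed.

Lemma U01N : ~ U01 R None.
Proof. by move=> [_ /U1E]. Qed.

Lemma O_secP k (V : set P1) (f : P1 -> C) : O_sec k V f ->
  hole (@chart1 R @^-1` V) (frame_coef1 f) /\ hole (@chart0 R @^-1` V) (frame_coef0 k f).
Proof. by case=> _ /holomorphic_hole h1 /holomorphic_hole. Qed.

Lemma frame_coef0N k (f : P1 -> C) w : w != 0 -> frame_coef0 k f w = w ^ k * f (Some w^-1).
Proof. by rewrite /frame_coef0 => /negbTE ->. Qed.

Lemma frame_coef01 k (f : P1 -> C) z : z != 0 -> f (Some z) = z ^ k * frame_coef0 k f z^-1.
Proof.
move=> z0; rewrite frame_coef0N ?invr_eq0 // invrK exprz_inv mulrA -expfzDr // subrr.
by rewrite expr0z mul1r.
Qed.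

Lemma chart0N (w : C) : w != 0 -> chart0 w = Some w^-1.
Proof. by rewrite /chart0 => /negbTE ->. Qed.

Lemma chart00 : chart0 (0 : C) = None.
Proof. by rewrite /chart0 eqxx. Qed.

(** The transition function w^k is holomorphic for w != 0, so away from infinity the chart z
    decides. *)
Lemma O_sec1 k (V : set P1) (f : P1 -> C) : P1_open V -> ~ V None ->
  (forall p, ~ V p -> f p = 0) -> hole (@chart1 R @^-1` V) (frame_coef1 f) -> O_sec k V f.
Proof.
move=> [Vo1 Vo0] VN f0 h; split=> //; apply: hole_holomorphic => //.
have V0 w : (@chart0 R @^-1` V) w -> w != 0.
  by apply: contraPneq => ->; rewrite /preimage /= chart00.
apply: (hole_eq Vo0 (f := fun w => w ^ k * f (Some w^-1))).
  by move=> w /V0 w0; rewrite frame_coef0N.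
apply: holeM; first by apply: hole_sub (hole_exprz k) => w /V0.
apply: (hole_sub _ (hole_inv h)) => w Vw; have w0 := V0 w Vw; split=> //.
by move: Vw; rewrite /preimage /= chart0N.
Qed.

Lemma O_sec_0 k (V : set P1) (f : P1 -> C) : P1_open V -> ~ V (Some 0) ->
  (forall p, ~ V p -> f p = 0) -> hole (@chart0 R @^-1` V) (frame_coef0 k f) -> O_sec k V f.
Proof.
move=> [Vo1 Vo0] VN f0 h; split=> //; apply: hole_holomorphic => //.
have V0 w : (@chart1 R @^-1` V) w -> w != 0.
  by apply: contraPneq => ->.
apply: (hole_eq Vo1 (f := fun z => z ^ k * frame_coef0 k f z^-1)).
  by move=> w /V0 w0; rewrite -frame_coef01.
apply: holeM; first by apply: hole_sub (hole_exprz k) => w /V0.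
apply: (hole_sub _ (hole_inv h)) => w Vw; have w0 := V0 w Vw; split=> //.
by rewrite /preimage /= chart0N ?invr_eq0 // invrK.
Qed.

Lemma restrE (A : lmodType C) (V : set P1) (f : P1 -> A) p : V p -> restr V f p = f p.
Proof. by move=> Vp; rewrite /restr asboolT. Qed.

Lemma restrN (A : lmodType C) (V : set P1) (f : P1 -> A) p : ~ V p -> restr V f p = 0.
Proof. by move=> Vp; rewrite /restr asboolF. Qed.

Lemma O_sec_restr k (V W : set P1) (f : P1 -> C) : P1_open W -> W `<=` V ->
  O_sec k V f -> O_sec k W (fun p => if `[< W p >] then f p else 0).
Proof.
move=> [Wo1 Wo0] WV fs; have [h1 h0] := O_secP fs; split.
- by move=> p Wp; rewrite asboolF.
- apply: hole_holomorphic => //; apply: hole_eq (hole_sub _ h1) => //; last by move=> z /WV.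
  by move=> z Wz; rewrite /frame_coef1 asboolT.
apply: hole_holomorphic => //; apply: hole_eq (hole_sub _ h0) => //; last by move=> z /WV.
move=> w Ww; rewrite /frame_coef0; move: Ww; rewrite /preimage /= /chart0.
by case: eqP => _ Ww; rewrite asboolT.
Qed.

End HolE.

(** * Derivations built from two families of coefficients *)

Section MkD.
Variables (R : realType) (l : 'I_3 -> int).
Local Notation C := R[i].
Local Notation P1 := (P1 R).
Local Notation ext := (ext R).
Implicit Types (V W U : set P1) (f g : P1 -> ext).

Definition c1 f (S : {set 'I_3}) : C -> C := frame_coef1 (fun p => f p S).
Definition c0 f (S : {set 'I_3}) : C -> C := frame_coef0 (ext_deg l S) (fun p => f p S).

(* The derivative of the coefficients, in the frame over the first chart at a
   finite point and in the frame over the second chart at infinity. *)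
Definition dsec : (P1 -> ext) -> P1 -> ext := locked (fun f p => [ffun S : {set 'I_3} =>
  match p with
  | Some z => derive1 (c1 f S : C^o -> C^o) z
  | None => derive1 (c0 f S : C^o -> C^o) 0
  end : C^o]).

Lemma dsec1 f z S : dsec f (Some z) S = derive1 (c1 f S : C^o -> C^o) z.
Proof. by rewrite /dsec -lock ffunE. Qed.

Lemma dsec0 f S : dsec f None S = derive1 (c0 f S : C^o -> C^o) 0.
Proof. by rewrite /dsec -lock ffunE. Qed.

Lemma wedgeS (a b : ext) (S : {set 'I_3}) : wedge a b S =
  \sum_(A in powerset S) (-1) ^+ inversions A (S :\: A) * a A * b (S :\: A)%SET.
Proof. by rewrite ffunE. Qed.

Lemma c1_hol V f S : LE_sec l V f -> hole (@chart1 R @^-1` V) (c1 f S).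
Proof. by move=> /(_ S)/O_secP[]. Qed.

Lemma c0_hol V f S : LE_sec l V f -> hole (@chart0 R @^-1` V) (c0 f S).
Proof. by move=> /(_ S)/O_secP[]. Qed.

Lemma c00 f S : c0 f S 0 = f None S.
Proof. by rewrite /c0 /frame_coef0 eqxx. Qed.

Lemma derive1_near (f g : C -> C) (W : set C) z : open (W : set C^o) -> W z ->
  (forall x, W x -> f x = g x) ->
  derive1 (f : C^o -> C^o) z = derive1 (g : C^o -> C^o) z.
Proof.
move=> Wo Wz fg; rewrite !derive1E; apply: near_eq_derive.
have Wn : nbhs (z : C^o) W by exact: open_nbhs_nbhs.
by apply: filterS Wn => x /fg.
Qed.

Lemma in_chart0N V : V None -> (@chart0 R @^-1` V) 0.
Proof. by rewrite /preimage /= chart00. Qed.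

Lemma dsec_restr W f p : P1_open W -> W p -> dsec (restr W f) p = dsec f p.
Proof.
move=> [Wo1 Wo0] Wp; apply/ffunP => S; case: p Wp => [z|] Wp.
  rewrite (dsec1 (restr W f)).
  rewrite (dsec1 f).
  by apply: (derive1_near Wo1 Wp) => x Wx; rewrite /c1 /frame_coef1 restrE.
rewrite !dsec0; apply: (derive1_near Wo0 (in_chart0N Wp)) => x.
by rewrite /c0 /frame_coef0 /preimage /= /chart0; case: eqP => _ Wx; rewrite restrE.
Qed.

Lemma dsec_lin V f g (a : C) p : P1_open V -> LE_sec l V f -> LE_sec l V g -> V p ->
  dsec (a *: f + g) p = a *: dsec f p + dsec g p.
Proof.
move=> _ hf hg Vp; apply/ffunP => S; rewrite [RHS]ffunDE [X in _ = X + _]ffunZE.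
have E q : (a *: f + g) q S = a * f q S + g q S.
  by rewrite -[(a *: f + g) q]/(a *: f q + g q) ffunDE ffunZE.
case: p Vp => [z|] Vp.
  rewrite !dsec1; have [f' h1] := c1_hol S hf; have [g' h2] := c1_hol S hg.
  have h3 := holD (holM (hol_cst _ a) h1) h2.
  have -> : c1 (a *: f + g) S = fun z => a * c1 f S z + c1 g S z.
    by apply/funext => x; rewrite /c1 /frame_coef1 E.
  by rewrite (hol_derive1 h1 Vp) (hol_derive1 h2 Vp) (hol_derive1 h3 Vp) mul0r add0r.
rewrite !dsec0; have [f' h1] := c0_hol S hf; have [g' h2] := c0_hol S hg.
have h3 := holD (holM (hol_cst _ a) h1) h2.
have -> : c0 (a *: f + g) S = fun z => a * c0 f S z + c0 g S z.
  apply/funext => x; rewrite /c0 /frame_coef0 !E.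
  by case: eqP => // _; rewrite mulrDr mulrCA.
have V0 := in_chart0N Vp.
by rewrite (hol_derive1 h1 V0) (hol_derive1 h2 V0) (hol_derive1 h3 V0) mul0r add0r.
Qed.

Lemma ext_deg_split (A S : {set 'I_3}) : A \subset S ->
  ext_deg l S = ext_deg l A + ext_deg l (S :\: A)%SET.
Proof.
move=> AS; rewrite /ext_deg (big_setID A) /= (_ : (S :&: A)%SET = A) //.
by apply/finset.setIidPr.
Qed.

Lemma hol_wedge (W : set C) (F G : {set 'I_3} -> C -> C) (F' G' : {set 'I_3} -> C -> C) S :
  (forall T, hol W (F T) (F' T)) -> (forall T, hol W (G T) (G' T)) ->
  hol W (fun z => \sum_(A in powerset S) (-1) ^+ inversions A (S :\: A) * F A z * G (S :\: A)%SET z)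
   (fun z => \sum_(A in powerset S) ((-1) ^+ inversions A (S :\: A) * F' A z * G (S :\: A)%SET z +
     (-1) ^+ inversions A (S :\: A) * F A z * G' (S :\: A)%SET z)).
Proof.
move=> hF hG; apply: hol_sum => A.
have h := holM (holM (hol_cst W ((-1) ^+ inversions A (S :\: A))) (hF A)) (hG (S :\: A)%SET).
by apply: (hol_ext _ _ h) => z //; rewrite mul0r add0r.
Qed.

(** The exponents of the transition functions add along S = A + (S - A), so the wedge product has
    the same formula in the frame at infinity. *)
Lemma c0_wedge f g S w : c0 (fun p => wedge (f p) (g p)) S w =
  \sum_(A in powerset S) (-1) ^+ inversions A (S :\: A) * c0 f A w * c0 g (S :\: A)%SET w.
Proof.
rewrite /c0 /frame_coef0; case: eqP => [_|/eqP w0]; first by rewrite wedgeS.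
rewrite wedgeS mulr_sumr; apply: eq_bigr => A; rewrite powersetE => AS.
rewrite (ext_deg_split AS) expfzDr //.
by move: (f _ A) (g _ _) ((-1) ^+ _) (w ^ _) (w ^ _) => a b c d e; ring.
Qed.

Lemma dsec_wedge V f g p : P1_open V -> LE_sec l V f -> LE_sec l V g -> V p ->
  dsec (fun p => wedge (f p) (g p)) p = wedge (dsec f p) (g p) + wedge (f p) (dsec g p).
Proof.
move=> _ hf hg Vp; apply/ffunP => S; rewrite [RHS]ffunDE !wedgeS -big_split /=.
case: p Vp => [z|] Vp.
  rewrite dsec1; have hF T : hol (@chart1 R @^-1` V) (c1 f T) (derive1 (c1 f T : C^o -> C^o)).
    by apply: hol_ext (holomorphic_hol (let: And3 _ h _ := hf T in h)).
  have hG T : hol (@chart1 R @^-1` V) (c1 g T) (derive1 (c1 g T : C^o -> C^o)).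
    by apply: hol_ext (holomorphic_hol (let: And3 _ h _ := hg T in h)).
  have h := hol_wedge S hF hG.
  have -> : c1 (fun p => wedge (f p) (g p)) S = fun z => \sum_(A in powerset S)
      (-1) ^+ inversions A (S :\: A) * c1 f A z * c1 g (S :\: A)%SET z.
    by apply/funext => x; rewrite /c1 /frame_coef1 wedgeS.
  rewrite (hol_derive1 h Vp); apply: eq_bigr => A _.
  by rewrite !dsec1.
rewrite dsec0; have V0 := in_chart0N Vp.
have hF T : hol (@chart0 R @^-1` V) (c0 f T) (derive1 (c0 f T : C^o -> C^o)).
  by apply: hol_ext (holomorphic_hol (let: And3 _ _ h := hf T in h)).
have hG T : hol (@chart0 R @^-1` V) (c0 g T) (derive1 (c0 g T : C^o -> C^o)).
  by apply: hol_ext (holomorphic_hol (let: And3 _ _ h := hg T in h)).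
have h := hol_wedge S hF hG.
have -> : c0 (fun p => wedge (f p) (g p)) S = fun z => \sum_(A in powerset S)
    (-1) ^+ inversions A (S :\: A) * c0 f A z * c0 g (S :\: A)%SET z.
  by apply/funext => x; rewrite c0_wedge.
rewrite (hol_derive1 h V0); apply: eq_bigr => A _.
by rewrite !dsec0 !c00.
Qed.

Lemma dsec_homogeneous k f p (S : {set 'I_3}) : homogeneous k f -> #|S| != k -> dsec f p S = 0.
Proof.
move=> hk Sk.
have E1 : c1 f S = fun=> 0 by apply/funext => z; rewrite /c1 /frame_coef1 hk.
have E0 : c0 f S = fun=> 0.
  by apply/funext => z; rewrite /c0 /frame_coef0 !hk // mulr0 if_same.
by case: p => [z|]; [rewrite dsec1 E1|rewrite dsec0 E0]; rewrite derive1_cst.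
Qed.

Lemma LE_sec_restr V W f : P1_open W -> W `<=` V -> LE_sec l V f -> LE_sec l W (restr W f).
Proof.
move=> Wo WV hf S; have := O_sec_restr Wo WV (hf S).
congr O_sec; apply/funext => p; rewrite /restr; case: ifP => // _; by rewrite ffunE.
Qed.

Lemma LE_sec_out V f p : LE_sec l V f -> ~ V p -> f p = 0.
Proof. by move=> hf Vp; apply/ffunP => S; rewrite ffunE; case: (hf S) => + _ _; apply. Qed.

(** u and v are read in the frame of z at finite points and in that of w at infinity, as [dsec] is.
    The default 0 is the normalisation imposed by [Der2_sec]. *)
Definition mkD U (u v : P1 -> 'I_3 -> C) : set P1 -> (P1 -> ext) -> P1 -> ext :=
  fun V f => if `[< [/\ P1_open V, V `<=` U & LE_sec l V f] >] then
    (fun p => if `[< V p >] then dform (u p) (v p) (dsec f p) (f p) else 0) else 0.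

Lemma mkD_in U u v V f p : P1_open V -> V `<=` U -> LE_sec l V f -> V p ->
  mkD U u v V f p = dform (u p) (v p) (dsec f p) (f p).
Proof. by move=> Vo VU hf Vp; rewrite /mkD asboolT //= asboolT. Qed.

Lemma mkD_out U u v V f p : ~ V p -> mkD U u v V f p = 0.
Proof. by move=> Vp; rewrite /mkD; case: ifP => // _; rewrite asboolF. Qed.

Lemma mkD_not U u v V f : ~ [/\ P1_open V, V `<=` U & LE_sec l V f] -> mkD U u v V f = 0.
Proof. by move=> h; rewrite /mkD asboolF. Qed.

Lemma LE_sec_wedge V f g : P1_open V -> LE_sec l V f -> LE_sec l V g ->
  LE_sec l V (fun p => wedge (f p) (g p)).
Proof.
move=> [Vo1 Vo0] hf hg S; split.
- move=> p Vp; rewrite (LE_sec_out hf Vp).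
  have w0l b : wedge 0 b = 0 :> ext.
    by have := wedge_linl (-1) 0 0 b; rewrite scaler0 addr0 scaleN1r addNr.
  by rewrite w0l ffunE.
- have hF T : hol (@chart1 R @^-1` V) (c1 f T) (derive1 (c1 f T : C^o -> C^o)).
    by apply: hol_ext (holomorphic_hol (let: And3 _ h _ := hf T in h)).
  have hG T : hol (@chart1 R @^-1` V) (c1 g T) (derive1 (c1 g T : C^o -> C^o)).
    by apply: hol_ext (holomorphic_hol (let: And3 _ h _ := hg T in h)).
  apply: (hol_holomorphic Vo1 (hol_eq Vo1 (hol_wedge S hF hG) _)).
  by move=> z _; rewrite /frame_coef1 wedgeS.
have hF T : hol (@chart0 R @^-1` V) (c0 f T) (derive1 (c0 f T : C^o -> C^o)).
  by apply: hol_ext (holomorphic_hol (let: And3 _ _ h := hf T in h)).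
have hG T : hol (@chart0 R @^-1` V) (c0 g T) (derive1 (c0 g T : C^o -> C^o)).
  by apply: hol_ext (holomorphic_hol (let: And3 _ _ h := hg T in h)).
apply: (hol_holomorphic Vo0 (hol_eq Vo0 (hol_wedge S hF hG) _)).
by move=> w _; rewrite -c0_wedge.
Qed.

(** Linearity, Leibniz, degree and restriction are checked pointwise. Holomorphy of the result
    depends on the chart and is left as a hypothesis. *)
Lemma mkD_Der2 U u v : (forall V f, P1_open V -> V `<=` U -> LE_sec l V f -> LE_sec l V (mkD U u v V f)) ->
  Der2_sec l U (mkD U u v).
Proof.
move=> Hs; split=> [V f|V Vo VU]; first exact: mkD_not.
split.
- by move=> f; exact: Hs.
- move=> a f g hf hg; apply/funext => p; have [Vp|Vp] := pselect (V p); last first.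
    rewrite mkD_out // -[RHS]/(a *: mkD U u v V f p + mkD U u v V g p) !mkD_out //.
    by rewrite scaler0 addr0.
  rewrite (mkD_in _ _ Vo VU (LE_sec_lin a Vo hf hg) Vp).
  rewrite -[RHS]/(a *: mkD U u v V f p + mkD U u v V g p).
  rewrite (mkD_in _ _ Vo VU hf Vp) (mkD_in _ _ Vo VU hg Vp).
  by rewrite -dform_lin (dsec_lin _ Vo hf hg Vp).
- move=> f g hf hg; apply/funext => p; have [Vp|Vp] := pselect (V p); last first.
    rewrite !mkD_out // (LE_sec_out hf Vp).
    have w0l b : wedge 0 b = 0 :> ext.
      by have := wedge_linl (-1) 0 0 b; rewrite scaler0 addr0 scaleN1r addNr.
    by rewrite !w0l addr0.
  rewrite (mkD_in _ _ Vo VU (LE_sec_wedge Vo hf hg) Vp).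
  rewrite (mkD_in _ _ Vo VU hf Vp) (mkD_in _ _ Vo VU hg Vp).
  by rewrite -dform_leibniz (dsec_wedge Vo hf hg Vp).
- move=> k f hf hk p S Sk; have [Vp|Vp] := pselect (V p); last by rewrite mkD_out // ffunE.
  rewrite (mkD_in _ _ Vo VU hf Vp); move: S Sk; apply: mk_ind => b0 b1 b2; rewrite mk_card dform_mk.
  have H (c0 c1 c2 : bool) : (c0 + (c1 + c2))%N != k -> f p (mk c0 c1 c2) = 0 /\ dsec f p (mk c0 c1 c2) = 0.
    by rewrite -mk_card => h; split; [exact: hk|exact: (dsec_homogeneous _ hk)].
  case: b0 b1 b2 => [] [] [] //= h.
  + have h' (c0 c1 c2 : bool) : (c0 + (c1 + c2))%N = 1%N -> f p (mk c0 c1 c2) = 0 /\ dsec f p (mk c0 c1 c2) = 0.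
      by move=> e; apply: H; rewrite e; apply: contra h => /eqP <-.
    have [[-> ->] [-> ->]] := (h' false false true erefl, h' false true false erefl).
    by have [-> ->] := h' true false false erefl; rewrite !mulr0 !subr0 !addr0.
  + by have [|_ ->] := H false false false; rewrite ?mulr0 //; apply: contra h => /eqP <-.
  + by have [|_ ->] := H false false false; rewrite ?mulr0 //; apply: contra h => /eqP <-.
  + by have [|_ ->] := H false false false; rewrite ?mulr0 //; apply: contra h => /eqP <-.
move=> W f Wo WV hf; apply/funext => p.
have WU : W `<=` U by move=> x /WV /VU.
have [Wp|Wp] := pselect (W p); last by rewrite mkD_out // restrN.
rewrite (mkD_in _ _ Wo WU (LE_sec_restr Wo WV hf) Wp).
rewrite (restrE f Wp) (restrE (mkD U u v V f) Wp).
by rewrite (mkD_in _ _ Vo VU hf (WV _ Wp)) (dsec_restr _ Wo Wp).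
Qed.

End MkD.

Section ChartDerivations.
Variables (R : realType) (l : 'I_3 -> int).
Local Notation C := R[i].
Local Notation P1 := (P1 R).
Local Notation ext := (ext R).
Implicit Types (V W U : set P1) (f g : P1 -> ext).

Lemma hole_dform (W : set C) (u v : 'I_3 -> C -> C) (da a : {set 'I_3} -> C -> C) b0 b1 b2 :
  (forall r, hole W (u r)) -> (forall r, hole W (v r)) ->
  (forall S, hole W (da S)) -> (forall S, hole W (a S)) ->
  hole W (fun z => dform (u ^~ z) (v ^~ z) [ffun S : {set 'I_3} => da S z : C^o] [ffun S : {set 'I_3} => a S z : C^o] (mk b0 b1 b2)).
Proof.
move=> hu hv hda ha.
have E : (fun z => dform (u ^~ z) (v ^~ z) [ffun S : {set 'I_3} => da S z : C^o] [ffun S : {set 'I_3} => a S z : C^o] (mk b0 b1 b2)) =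
  (fun z => if b0 then (if b1 then (if b2 then
       u i0 z * da (mk false false true) z - u i1 z * da (mk false true false) z + u i2 z * da (mk true false false) z
     + (v i0 z * a (mk false false true) z - v i1 z * a (mk false true false) z + v i2 z * a (mk true false false) z)
     else u i0 z * da (mk false false false) z) else if b2 then u i1 z * da (mk false false false) z else 0)
  else if b1 && b2 then u i2 z * da (mk false false false) z else 0).
  by apply/funext => z; rewrite dform_mk !ffunE.
rewrite E; case: b0 b1 b2 {E} => [] [] [] /=; try exact: hole_cst; try exact: holeM.
by apply: holeD; apply: holeD; try apply: holeB; exact: holeM.
Qed.

Lemma mkD_sec1 U (u v : P1 -> 'I_3 -> C) V f : U `<=` U1 R ->
  (forall r, hole (@chart1 R @^-1` U) (fun z => u (Some z) r)) ->
  (forall r, hole (@chart1 R @^-1` U) (fun z => v (Some z) r)) ->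
  P1_open V -> V `<=` U -> LE_sec l V f -> LE_sec l V (mkD l U u v V f).
Proof.
move=> UU1 hu hv Vo VU hf; apply: mk_ind => b0 b1 b2.
have VN : ~ V None by move=> /VU/UU1/U1E.
apply: O_sec1 => //; first by move=> p Vp; rewrite mkD_out // ffun0E.
have sub : @chart1 R @^-1` V `<=` @chart1 R @^-1` U by move=> z; exact: VU.
have H := @hole_dform (@chart1 R @^-1` V) (fun r z => u (Some z) r) (fun r z => v (Some z) r)
  (fun S => derive1 (c1 f S : C^o -> C^o)) (c1 f) b0 b1 b2.
apply: (hole_eq Vo.1 _ (H _ _ _ _)).
- move=> z Vz; rewrite /frame_coef1 (mkD_in _ _ Vo VU hf Vz).
  congr (dform _ _ _ _ _); apply/ffunP => S; rewrite ffunE //.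
  by rewrite dsec1.
- by move=> r; exact: hole_sub sub (hu r).
- by move=> r; exact: hole_sub sub (hv r).
- by move=> S; apply: hole_derive1; [exact: Vo.1|exact: c1_hol hf].
- by move=> S; exact: c1_hol hf.
Qed.

Definition pair_deg (r : 'I_3) : int := l (pair_of r).1 + l (pair_of r).2.
Definition total_deg : int := l i0 + (l i1 + l i2).

Lemma ext_deg_mk b0 b1 b2 : ext_deg l (mk b0 b1 b2) =
  (if b0 then l i0 else 0) + ((if b1 then l i1 else 0) + (if b2 then l i2 else 0)).
Proof. by rewrite /ext_deg big_mkcond sum_ord3 !in_mk. Qed.

(* The derivation w |-> alpha, e_j |-> beta /\ e_j in the chart w = 1 / z,
   rewritten in the frame of the chart z. *)
Definition u_inf (alpha : 'I_3 -> C -> C) (p : P1) (r : 'I_3) : C :=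
  if p is Some z then - (z ^ (pair_deg r + 2) * alpha r z^-1) else alpha r 0.
Definition v_inf (alpha beta : 'I_3 -> C -> C) (p : P1) (r : 'I_3) : C :=
  if p is Some z then z ^ pair_deg r * (beta r z^-1 + (total_deg - pair_deg r)%:~R * (z * alpha r z^-1))
  else beta r 0.

Lemma dsec_frame V f z S : P1_open V -> LE_sec l V f -> V (Some z) -> z != 0 ->
  dsec l f (Some z) S = (ext_deg l S)%:~R * z ^ (ext_deg l S - 1) * c0 l f S z^-1 -
    z ^ (ext_deg l S - 2) * derive1 (c0 l f S : C^o -> C^o) z^-1.
Proof.
move=> Vo hf Vz z0; rewrite dsec1.
set k := ext_deg l S; set W := [set x | V (Some x) /\ x != 0].
have Wo : open (W : set C^o) by apply: (@open_punctured R (@chart1 R @^-1` V) 0); exact: Vo.1.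
have [F' hF] := c0_hol S hf.
have Vzi : (@chart0 R @^-1` V) z^-1 by rewrite /preimage /= chart0N ?invr_eq0 // invrK.
have hi := hol_inv hF.
have h1 := hol_sub (W := W) (fun x (h : W x) => h.2) (hol_exprz R k).
have h2 : hol W (fun x => c0 l f S x^-1) (fun x => F' x^-1 * (- x ^- 2)).
  apply: hol_sub hi => x [Vx x0]; split=> //.
  by rewrite /preimage /= chart0N ?invr_eq0 // invrK.
have h3 := holM h1 h2.
have h4 := hol_eq Wo h3 (g := c1 f S) (fun x (hx : W x) => esym (frame_coef01 k (fun p => f p S) hx.2)).
rewrite (hol_derive1 h4 (conj Vz z0)) (hol_derive1 hF Vzi).
rewrite !expfzDr //= -[z ^ (-1)]/(z^-1) -[z ^ (-2)]/(z ^- 2).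
by move: (z ^- 2) => y; ring.
Qed.

(** The frame e_j changes by z^{l_j}, and differentiating this factor sends alpha into the
    coefficients on e_j. For the pair r the index j is the complementary one, so that l_j is
    [total_deg] minus [pair_deg r]. *)
Lemma mkD_sec0 (alpha beta : 'I_3 -> C -> C) V f :
  (forall r, hole setT (alpha r)) -> (forall r, hole setT (beta r)) ->
  P1_open V -> V `<=` U0 R -> LE_sec l V f ->
  LE_sec l V (mkD l (U0 R) (u_inf alpha) (v_inf alpha beta) V f).
Proof.
move=> ha hb Vo VU hf; apply: mk_ind => b0 b1 b2.
have V0 : ~ V (Some 0) by move=> /VU/U0E.
apply: O_sec_0 => //; first by move=> p Vp; rewrite mkD_out // ffun0E.
have H := @hole_dform (@chart0 R @^-1` V) alpha beta
  (fun S => derive1 (c0 l f S : C^o -> C^o)) (c0 l f) b0 b1 b2.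
apply: (hole_eq Vo.2 _ (H _ _ _ _)); last 4 first.
- by move=> r; exact: hole_sub (ha r).
- by move=> r; exact: hole_sub (hb r).
- by move=> S; apply: hole_derive1; [exact: Vo.2|exact: c0_hol hf].
- by move=> S; exact: c0_hol hf.
move=> w Vw; rewrite /frame_coef0; case: eqP => [w0|/eqP w0].
  rewrite w0 in Vw *.
  have VN : V None by move: Vw; rewrite /preimage /= chart00.
  rewrite (mkD_in _ _ Vo VU hf VN); congr (dform _ _ _ _ _); apply/ffunP => S; rewrite ffunE.
    by rewrite dsec0.
  by rewrite c00.
have Vz : V (Some w^-1) by move: Vw; rewrite /preimage /= chart0N.
rewrite (mkD_in _ _ Vo VU hf Vz).
have wi0 : w^-1 != 0 by rewrite invr_eq0.
have fS S : f (Some w^-1) S = w^-1 ^ ext_deg l S * c0 l f S w.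
  by rewrite (frame_coef01 (ext_deg l S) (fun p => f p S) wi0) invrK.
have dS S := dsec_frame S Vo hf Vz wi0.
rewrite !dform_mk !ffunE !fS !dS /u_inf /v_inf invrK !ext_deg_mk /pair_deg pair_of0 pair_of1 pair_of2 /total_deg.
(* All powers are rewritten in w^-1, with the three factors w^-1 ^ l_i as variables, which leaves
   rational identities for [field]. *)
have X (k : int) : w ^ k = (w^-1 ^ k)^-1 by rewrite exprz_inv invr_expz opprK.
rewrite X.
have e1 : w^-1 ^ (-1) = w by rewrite -[LHS]/(w^-1^-1) invrK.
have e2 : w^-1 ^ (-2) = w ^+ 2 by rewrite -[LHS]/((w^-1 ^+ 2)^-1) exprVn invrK.
have e3 : w^-1 ^ 2 = (w ^+ 2)^-1 by rewrite -exprVn.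
have [m0 m1 m2] : [/\ w^-1 ^ l i0 != 0, w^-1 ^ l i1 != 0 & w^-1 ^ l i2 != 0] by split; rewrite expfz_neq0.
clear H; case: b0 b1 b2 => [] [] [] /=; rewrite ?mulr0 ?addr0 ?add0r //= ?expfzDr // ?e1 ?e2 ?e3 ?expr0z ?mul0r ?expr1z.
- have -> : l i0 + (l i1 + l i2) - (l i0 + l i1) = l i2 by ring.
  have -> : l i0 + (l i1 + l i2) - (l i0 + l i2) = l i1 by ring.
  have -> : l i0 + (l i1 + l i2) - (l i1 + l i2) = l i0 by ring.
  move: (derive1 _ w) (derive1 _ w) (derive1 _ w) => d0 d1 d2.
  move: (c0 l f (mk false false true) w) (c0 l f (mk false true false) w) (c0 l f (mk true false false) w) => g0 g1 g2.
  move: (w^-1 ^ l i0) (w^-1 ^ l i1) (w^-1 ^ l i2) m0 m1 m2 => x0 x1 x2 m0 m1 m2.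
  move: (alpha i0 w) (alpha i1 w) (alpha i2 w) (beta i0 w) (beta i1 w) (beta i2 w) => a0 a1 a2 q0 q1 q2.
  move: ((l i0)%:~R) ((l i1)%:~R) ((l i2)%:~R) => k0 k1 k2.
  by field; rewrite w0 m0 m1 m2.
- move: (derive1 _ w) (w^-1 ^ l i0) (w^-1 ^ l i1) (alpha i0 w) m0 m1 => d x y a p q.
  by field; rewrite w0 p q.
- move: (derive1 _ w) (w^-1 ^ l i0) (w^-1 ^ l i2) (alpha i1 w) m0 m2 => d x y a p q.
  by field; rewrite w0 p q.
move: (derive1 _ w) (w^-1 ^ l i1) (w^-1 ^ l i2) (alpha i2 w) m1 m2 => d x y a p q.
by field; rewrite w0 p q.
Qed.

End ChartDerivations.

(** * Derivations are determined by their values on z and the e_j *)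

Section Representation.
Variables (R : realType) (l : 'I_3 -> int).
Local Notation C := R[i].
Local Notation P1 := (P1 R).
Local Notation ext := (ext R).
Local Notation one := (ebase R finset.set0).
Implicit Types (V W U : set P1) (f g : P1 -> ext) (F G : C -> ext).

Definition sf V F : P1 -> ext := restr V (fun p => if p is Some z then F z else 0).

Lemma sf_in V F z : V (Some z) -> sf V F (Some z) = F z.
Proof. by move=> Vz; rewrite /sf restrE. Qed.

Lemma sf_out V F p : ~ V p -> sf V F p = 0.
Proof. by move=> Vp; rewrite /sf restrN. Qed.

Lemma sf_restr V W F : V `<=` W -> restr V (sf W F) = sf V F.
Proof.
move=> VW; apply/funext => p; have [Vp|Vp] := pselect (V p); last by rewrite sf_out // restrN.
by rewrite restrE // /sf !restrE //; exact: VW.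
Qed.

Lemma sf_sec V F : P1_open V -> V `<=` U1 R ->
  (forall S, hole (@chart1 R @^-1` V) (fun z => F z S)) -> LE_sec l V (sf V F).
Proof.
move=> Vo VU hF S; have VN : ~ V None by move=> /VU/U1E.
apply: O_sec1 => //; first by move=> p Vp; rewrite sf_out // ffun0E.
by apply: (hole_eq Vo.1 _ (hF S)) => z Vz; rewrite /frame_coef1 sf_in.
Qed.

Lemma U01_U1 : U01 R `<=` U1 R. Proof. by move=> p []. Qed.
Lemma U01_U0 : U01 R `<=` U0 R. Proof. by move=> p []. Qed.

Lemma z_coordE : @z_coord R = sf (U01 R) (fun z => z *: one).
Proof. by []. Qed.

Definition e_sec V (j : 'I_3) : P1 -> ext := sf V (fun=> ebase R [set j]%SET).

Lemma hole_ext_cst (W : set C) (phi : C -> C) (a : ext) S : hole W phi -> hole W (fun z => (phi z *: a) S).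
Proof.
move=> h; have := holeM h (hole_cst W (a S)); case=> f' hf; exists f'.
by apply: (hol_ext _ _ hf) => z //; rewrite ffunZE.
Qed.

Lemma z_coord_sec : LE_sec l (U01 R) (@z_coord R).
Proof.
apply: sf_sec; [exact: P1_openU01|exact: U01_U1|move=> S].
by apply: hole_ext_cst; exact: hole_id.
Qed.

Lemma e_sec_sec V j : P1_open V -> V `<=` U1 R -> LE_sec l V (e_sec V j).
Proof. by move=> Vo VU; apply: sf_sec => // S; exact: hole_cst. Qed.

Lemma wedge_one (c : C) (a : ext) : wedge (c *: one) a = c *: a.
Proof.
by apply: ext_eq => [[] [] []]; rewrite wedgeE !ffunZE set0_mk !ebase_mk /=; ring.
Qed.

Lemma wedge0l (a : ext) : wedge 0 a = 0.
Proof. by have := wedge_one 0 a; rewrite !scale0r. Qed.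

Lemma wedge0r (a : ext) : wedge a 0 = 0.
Proof. by have := wedge_linr (-1) a 0 0; rewrite scaler0 addr0 scaleN1r addNr. Qed.

Lemma ext_sum (a : ext) : a = \sum_(S : {set 'I_3}) a S *: ebase R S.
Proof.
apply/ffunP => T; rewrite sum_ffunE (bigD1 T) //= big1 ?addr0.
  by rewrite ffunZE ffunE eqxx mulr1.
by move=> S /negbTE ST; rewrite ffunZE ffunE eq_sym ST mulr0.
Qed.

Section Vanishing.
Variable D : set P1 -> (P1 -> ext) -> P1 -> ext.
Hypothesis hD : Der2_sec l (U01 R) D.
Hypothesis Dz : D (U01 R) (@z_coord R) = 0.
Hypothesis De : forall j, D (U01 R) (e_sec (U01 R) j) = 0.
Variable V : set P1.
Hypothesis Vo : P1_open V.
Hypothesis VU : V `<=` U01 R.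

Let VU1 : V `<=` U1 R. Proof. by move=> p /VU/U01_U1. Qed.
Let Dsec f : LE_sec l V f -> LE_sec l V (D V f).
Proof. by have [h _ _ _ _] := hD.2 V Vo VU; exact: h. Qed.
Let Dlin (a : C) f g : LE_sec l V f -> LE_sec l V g -> D V (a *: f + g) = a *: D V f + D V g.
Proof. by have [_ h _ _ _] := hD.2 V Vo VU; exact: h. Qed.
Let Dleib f g : LE_sec l V f -> LE_sec l V g ->
  D V (fun p => wedge (f p) (g p)) = (fun p => wedge (D V f p) (g p) + wedge (f p) (D V g p)).
Proof. by have [_ _ h _ _] := hD.2 V Vo VU; exact: h. Qed.
Let Dhom k f : LE_sec l V f -> homogeneous k f -> homogeneous (k + 2) (D V f).
Proof. by have [_ _ _ h _] := hD.2 V Vo VU; exact: h. Qed.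
Let Dres f : LE_sec l (U01 R) f -> D V (restr V f) = restr V (D (U01 R) f).
Proof. by have [_ _ _ _ h] := hD.2 _ (P1_openU01 R) (fun p x => x); move=> hf; exact: h. Qed.

Let res0 : restr V (0 : P1 -> ext) = 0.
Proof. by apply/funext => p; rewrite /restr; case: ifP. Qed.

Let sc (phi : C -> C) : P1 -> ext := sf V (fun z => phi z *: one).
Let sc_sec phi : hole (@chart1 R @^-1` V) phi -> LE_sec l V (sc phi).
Proof. by move=> h; apply: sf_sec => // S; exact: hole_ext_cst. Qed.

Let D0 : D V 0 = 0.
Proof.
have h := Dlin (-1) (LE_sec0 l V) (LE_sec0 l V).
by move: h; rewrite scaler0 addr0 scaleN1r addNr.
Qed.

(** D 1 = D (1 . 1) = 2 D 1. *)
Let Done : D V (sc (fun=> 1)) = 0.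
Proof.
have h1 := sc_sec (hole_cst _ 1).
have E : (fun p => wedge (sc (fun=> 1) p) (sc (fun=> 1) p)) = sc (fun=> 1).
  apply/funext => p; have [Vp|Vp] := pselect (V p); last by rewrite /sc sf_out // wedge0l.
  case: p Vp => [z|] Vp; last by have /U1E := VU1 Vp.
  by rewrite /sc sf_in // wedge_one scale1r.
have := Dleib h1 h1; rewrite E => H; apply/funext => p.
have [Vp|Vp] := pselect (V p); last by rewrite (LE_sec_out (Dsec h1)).
case: p Vp => [z|] Vp; last by have /U1E := VU1 Vp.
have E1 : sc (fun=> 1) (Some z) = one by rewrite /sc sf_in // scale1r.
have := congr1 (fun Q : P1 -> ext => Q (Some z)) H; rewrite /= E1 wedge1l wedge1r.
by move=> /(congr1 (fun x => x - D V (sc (fun=> 1)) (Some z))); rewrite subrr addrK => <-.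
Qed.

(** At a point a, phi = phi(a) + (z - a) phi1. Leibniz leaves D(z - a) phi1 = 0 and a term with the
    factor z - a, which vanishes at a. *)
Let Dsc phi : hole (@chart1 R @^-1` V) phi -> D V (sc phi) = 0.
Proof.
move=> [phi' hphi]; apply/funext => p; have hs := sc_sec (ex_intro _ _ hphi).
have [Vp|Vp] := pselect (V p); last by rewrite (LE_sec_out (Dsec hs)).
case: p Vp => [a|] Vp; last by have /U1E := VU1 Vp.
have [phi1 [phi1' [h1 E]]] := hol_division Vo.1 Vp hphi.
have s1 := sc_sec (ex_intro _ _ h1).
have sone := sc_sec (hole_cst _ 1).
have sz : LE_sec l V (sc id) := sc_sec (hole_id _).
have sza := LE_sec_lin (- a) Vo sone sz.
have sw := LE_sec_wedge Vo sza s1.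
have Dza : D V (- a *: sc (fun=> 1) + sc id) = 0.
  rewrite Dlin // Done scaler0 add0r.
  have -> : sc id = restr V (@z_coord R) by rewrite z_coordE sf_restr.
  by rewrite (Dres z_coord_sec) Dz res0.
have -> : sc phi = phi a *: sc (fun=> 1) + (fun p => wedge ((- a *: sc (fun=> 1) + sc id) p) (sc phi1 p)).
  apply/funext => p; rewrite -[RHS]/(phi a *: sc (fun=> 1) p + wedge (- a *: sc (fun=> 1) p + sc id p) (sc phi1 p)).
  have [Vq|Vq] := pselect (V p); last by rewrite /sc !sf_out // wedge0r scaler0 addr0.
  case: p Vq => [z|] Vq; last by have /U1E := VU1 Vq.
  rewrite /sc !sf_in // E // scale1r -scalerDl addrC [z - a]addrC wedge_one scalerA -scalerDl addrC.
  by [].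
rewrite Dlin // Done scaler0 add0r (Dleib sza s1) Dza.
rewrite -[(0 : P1 -> ext) _]/(0 : ext) wedge0l add0r.
rewrite -[(_ + _) (Some a)]/(- a *: sc (fun=> 1) (Some a) + sc id (Some a)) /sc !sf_in //.
by rewrite scale1r -scalerDl addNr scale0r wedge0l.
Qed.

(** f is the sum of its components f_S e_S: those with S empty are covered by [Dsc], those with |S|
    = 1 by Leibniz and [De], the others by degree. *)
Lemma Der2_vanish f : LE_sec l V f -> D V f = 0.
Proof.
move=> hf; pose g (S : {set 'I_3}) := sf V (fun z => f (Some z) S *: ebase R S).
have hg S : LE_sec l V (g S) by apply: sf_sec => // T; apply: hole_ext_cst; exact: c1_hol hf.
have -> : f = \sum_(S : {set 'I_3}) g S.
  apply/funext => p; rewrite fct_sumE; have [Vp|Vp] := pselect (V p); last first.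
    by rewrite (LE_sec_out hf Vp) big1 // => S _; rewrite /g sf_out.
  case: p Vp => [z|] Vp; last by have /U1E := VU1 Vp.
  by rewrite [LHS]ext_sum; apply: eq_bigr => S _; rewrite /g sf_in.
have Dg S : D V (g S) = 0.
  have hom : homogeneous #|S| (g S).
    move=> p T TS; have [Vp|Vp] := pselect (V p); last by rewrite /g sf_out // ffun0E.
    case: p Vp => [z|] Vp; last by have /U1E := VU1 Vp.
    rewrite /g sf_in // ffunZE ffunE; case: eqP => [h|_]; last by rewrite mulr0.
    by rewrite h eqxx in TS.
  (* Raising a degree of at least 2 by 2 exceeds the rank 3. *)
  have big : (1 < #|S|)%N -> D V (g S) = 0.
    move=> S2; apply/funext => p; apply/ffunP => T; rewrite (Dhom (hg S) hom) ?ffun0E //.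
    have T3 : (#|T| <= 3)%N by apply: leq_trans (max_card (mem T)) _; rewrite card_ord.
    by apply/eqP => h; move: T3; rewrite h addn2 !ltnS leqNgt S2.
  have e_j j : S = [set j]%SET -> D V (g S) = 0.
    move=> Sj; have hphi : hole (@chart1 R @^-1` V) (c1 f S) := c1_hol S hf.
    have -> : g S = fun p => wedge (sc (c1 f S) p) (e_sec V j p).
      apply/funext => p; have [Vp|Vp] := pselect (V p); last first.
        have Eg : g S p = 0 := sf_out _ Vp; have Es : sc (c1 f S) p = 0 := sf_out _ Vp.
        by rewrite Eg Es wedge0l.
      case: p Vp => [z|] Vp; last by have /U1E := VU1 Vp.
      have Eg : g S (Some z) = f (Some z) S *: ebase R S := sf_in _ Vp.
      have Es : sc (c1 f S) (Some z) = c1 f S z *: one := sf_in _ Vp.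
      have Ee : e_sec V j (Some z) = ebase R [set j]%SET := sf_in _ Vp.
      have EE : wedge (c1 f S z *: one) (ebase R [set j]%SET) = c1 f S z *: ebase R S.
        exact: (etrans (wedge_one _ _) (congr1 (fun T => c1 f S z *: ebase R T) (esym Sj))).
      exact: (etrans Eg (esym (etrans (f_equal2 (@wedge R) Es Ee) EE))).
    rewrite (Dleib (sc_sec hphi) (e_sec_sec j Vo VU1)) (Dsc hphi).
    have -> : e_sec V j = restr V (e_sec (U01 R) j) by rewrite sf_restr.
    rewrite (Dres (e_sec_sec j (P1_openU01 R) U01_U1)) De res0.
    by apply/funext => p; rewrite wedge0l wedge0r addr0.
  move: big e_j; rewrite [S]mkE; case: (i0 \in S) (i1 \in S) (i2 \in S) => [] [] [] big e_j;
    try (by apply: big; rewrite mk_card).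
  - by apply: (e_j i0); rewrite set1_mk.
  - by apply: (e_j i1); rewrite set1_mk.
  - by apply: (e_j i2); rewrite set1_mk.
  have -> : g (mk false false false) = sc (c1 f (mk false false false)).
    by rewrite /g /sc set0_mk.
  by apply: Dsc; exact: c1_hol hf.
(* D is additive on sections only, so each partial sum is shown to be a section along the way. *)
elim: (index_enum _) => [|S s IH]; first by rewrite big_nil D0.
have hs : LE_sec l V (\sum_(T <- s) g T).
  elim: s {IH} => [|T s IH].
    rewrite big_nil; exact: (LE_sec0 l V).
  rewrite big_cons; have := LE_sec_lin 1 Vo (hg T) IH.
  by rewrite scale1r.
have := Dlin 1 (hg S) hs; rewrite !scale1r Dg IH add0r => h.
by rewrite big_cons.
Qed.

End Vanishing.

Lemma Der2_unique0 D : Der2_sec l (U01 R) D -> D (U01 R) (@z_coord R) = 0 ->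
  (forall j, D (U01 R) (e_sec (U01 R) j) = 0) -> D = 0.
Proof.
move=> hD Dz De; apply/funext => V; apply/funext => f.
have [[Vo VU hf]|n] := pselect [/\ P1_open V, V `<=` U01 R & LE_sec l V f].
  exact: (Der2_vanish hD Dz De Vo VU hf).
by rewrite (hD.1 _ _ n).
Qed.

End Representation.

Section Cocycles.
Variables (R : realType) (l : 'I_3 -> int).
Local Notation C := R[i].
Local Notation P1 := (P1 R).
Local Notation ext := (ext R).
Local Notation one := (ebase R finset.set0).
Local Notation kk := (pair_deg l).
Local Notation Ltot := (total_deg l).
Implicit Types (V W U : set P1) (f g : P1 -> ext) (a b : 'I_3 -> C -> C).
Implicit Types (D : set P1 -> (P1 -> ext) -> P1 -> ext).

Definition ext01 a (p : P1) (r : 'I_3) : C := if p is Some z then a r z else 0.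

(* the derivation z |-> a, e_j |-> b /\ e_j over U0 n U1 *)
Definition der_of a b := mkD l (U01 R) (ext01 a) (ext01 b).

Lemma U01nz : @chart1 R @^-1` (U01 R) `<=` @nz R.
Proof. by move=> z /U01E. Qed.

Lemma der_of_sec a b : (forall r, hole (@nz R) (a r)) -> (forall r, hole (@nz R) (b r)) ->
  Der2_sec l (U01 R) (der_of a b).
Proof.
move=> ha hb; apply: mkD_Der2 => V f Vo VU hf.
apply: mkD_sec1 => //; first exact: U01_U1.
  by move=> r; exact: hole_sub U01nz (ha r).
by move=> r; exact: hole_sub U01nz (hb r).
Qed.

Lemma dsec_sf V (phi phi' : C -> C) (x : ext) z : P1_open V -> V (Some z) ->
  hol (@chart1 R @^-1` V) phi phi' ->
  dsec l (sf V (fun z => phi z *: x)) (Some z) = phi' z *: x.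
Proof.
move=> Vo Vz h; apply/ffunP => S; rewrite dsec1 ffunZE.
have h2 := holM h (hol_cst (@chart1 R @^-1` V) (x S)).
have -> : phi' z * x S = phi' z * x S + phi z * 0 by rewrite mulr0 addr0.
rewrite -(hol_derive1 h2 Vz); apply: (derive1_near Vo.1 Vz) => y Vy.
have E : sf V (fun z => phi z *: x) (Some y) = phi y *: x := sf_in _ Vy.
by rewrite /c1 /frame_coef1 E ffunZE.
Qed.

Lemma der_of_scaled a b (phi phi' : C -> C) (x : ext) z : z != 0 ->
  hol (@nz R) phi phi' ->
  der_of a b (U01 R) (sf (U01 R) (fun z => phi z *: x)) (Some z) =
  dform (a ^~ z) (b ^~ z) (phi' z *: x) (phi z *: x).
Proof.
move=> z0 h; have Vz : U01 R (Some z) by apply/U01E.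
have hs : LE_sec l (U01 R) (sf (U01 R) (fun z => phi z *: x)).
  apply: sf_sec; [exact: P1_openU01|exact: U01_U1|move=> S].
  by apply: hole_ext_cst; apply: hole_sub U01nz _; exists phi'.
rewrite /der_of (mkD_in _ _ (P1_openU01 R) (fun p h => h) hs Vz).
rewrite (dsec_sf x (P1_openU01 R) Vz (hol_sub U01nz h)).
have E : sf (U01 R) (fun z => phi z *: x) (Some z) = phi z *: x := sf_in _ Vz.
by rewrite E.
Qed.

Lemma der_of_z a b z : z != 0 -> der_of a b (U01 R) (@z_coord R) (Some z) = w2 (a ^~ z).
Proof.
move=> z0; rewrite z_coordE (der_of_scaled a b one z0 (hol_id _)).
apply: ext_eq => b0 b1 b2; rewrite dform_mk w2_mk !ffunZE set0_mk !ebase_mk.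
by case: b0 b1 b2 => [] [] [] /=; ring.
Qed.

Lemma e_secE V j : e_sec V j = sf V (fun z => (fun=> 1) z *: ebase R [set j]%SET).
Proof. by rewrite /e_sec; congr sf; apply/funext => z; rewrite scale1r. Qed.

Lemma der_of_e a b j z : z != 0 -> der_of a b (U01 R) (e_sec (U01 R) j) (Some z) =
  wedge (w2 (b ^~ z)) (ebase R [set j]%SET).
Proof.
move=> z0; rewrite e_secE (der_of_scaled a b _ z0 (hol_cst _ 1)).
apply: ext_eq => b0 b1 b2; rewrite dform_mk wedge_w2 !ffunZE set1_mk !ebase_mk.
by move: j; apply: ord3_ind; case: b0 b1 b2 => [] [] [] /=; ring.
Qed.

(* third r is the index outside the pair r, and third_sign r the sign of the
   permutation (pair r, third r). *)
Definition third (r : 'I_3) : 'I_3 := rev_ord r.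
Definition third_sign (r : 'I_3) : C := if r == i1 then -1 else 1.

Lemma third0 : third i0 = i2. Proof. exact: val_inj. Qed.
Lemma third1 : third i1 = i1. Proof. exact: val_inj. Qed.
Lemma third2 : third i2 = i0. Proof. exact: val_inj. Qed.

Lemma third_signK r : third_sign r * third_sign r = 1.
Proof. by rewrite /third_sign; case: ifP => _; rewrite ?mulrNN mulr1. Qed.

Local Notation S_ r := [set (pair_of r).1; (pair_of r).2]%SET.

Definition z_coef D (r : 'I_3) (z : C) : C := D (U01 R) (@z_coord R) (Some z) (S_ r).
(** D e_j has degree 3, thus a single coefficient. In b /\ e_j only the pair complementary to j
    contributes, with the sign of [third_sign]. *)
Definition e_coef D (r : 'I_3) (z : C) : C :=
  third_sign r * D (U01 R) (e_sec (U01 R) (third r)) (Some z) (mk true true true).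

Lemma z_coef_der_of a b r z : z != 0 -> z_coef (der_of a b) r z = a r z.
Proof.
by move=> z0; rewrite /z_coef (der_of_z _ _ z0); move: r; apply: ord3_ind;
  rewrite ?S_mk0 ?S_mk1 ?S_mk2 w2_mk.
Qed.

Lemma e_coef_der_of a b r z : z != 0 -> e_coef (der_of a b) r z = b r z.
Proof.
move=> z0; rewrite /e_coef (der_of_e _ _ _ z0) wedge_w2 set1_mk !ebase_mk /third_sign.
by move: r; apply: ord3_ind; rewrite ?third0 ?third1 ?third2 /=; ring.
Qed.

Lemma in_nz_U01 z : @nz R z -> U01 R (Some z).
Proof. by move=> z0; apply/U01E. Qed.

Lemma z_coef_hole D r : Der2_sec l (U01 R) D -> hole (@nz R) (z_coef D r).
Proof.
move=> hD; have [h _ _ _ _] := hD.2 _ (P1_openU01 R) (fun p x => x).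
apply: (hole_sub _ (c1_hol (S_ r) (h _ (z_coord_sec R l)))).
by move=> z; exact: in_nz_U01.
Qed.

Lemma e_coef_hole D r : Der2_sec l (U01 R) D -> hole (@nz R) (e_coef D r).
Proof.
move=> hD; have [h _ _ _ _] := hD.2 _ (P1_openU01 R) (fun p x => x).
apply: holeZ; apply: (hole_sub _ (c1_hol (mk true true true) (h _ (e_sec_sec l (third r) (P1_openU01 R) (@U01_U1 R))))).
by move=> z; exact: in_nz_U01.
Qed.

Lemma addN1_eq0 (A : lmodType C) (x y : A) : (-1) *: x + y = 0 -> y = x.
Proof. by rewrite scaleN1r addrC => /eqP; rewrite subr_eq0 => /eqP. Qed.

(** The difference kills z and every e_j: as D raises degrees by 2, D z is a 2-form and D e_j a
    3-form, and the coefficients of [z_coef] and [e_coef] exhaust them. *)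
Lemma representation D : Der2_sec l (U01 R) D -> D = der_of (z_coef D) (e_coef D).
Proof.
move=> hD; have h1 r := z_coef_hole r hD; have h2 r := e_coef_hole r hD.
have hc := der_of_sec h1 h2.
have [Ds _ _ Dh _] := hD.2 _ (P1_openU01 R) (fun p x => x).
have [Cs _ _ Ch _] := hc.2 _ (P1_openU01 R) (fun p x => x).
suff h0 : (-1) *: der_of (z_coef D) (e_coef D) + D = 0.
  exact: (addN1_eq0 h0).
have E (f : P1 -> ext) (p : P1) : ((-1) *: der_of (z_coef D) (e_coef D) + D : set P1 -> (P1 -> ext) -> P1 -> ext) (U01 R) f p =
    - der_of (z_coef D) (e_coef D) (U01 R) f p + D (U01 R) f p.
  by rewrite -[LHS]/((-1) *: der_of (z_coef D) (e_coef D) (U01 R) f p + D (U01 R) f p) scaleN1r.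
have zs := z_coord_sec R l.
have es j := e_sec_sec l j (P1_openU01 R) (@U01_U1 R).
apply: (@Der2_unique0 R l); first exact: (Der2_sec_lin (-1) (P1_openU01 R) hc hD).
  apply/funext => p; rewrite E; have [Vp|Vp] := pselect (U01 R p); last first.
    by rewrite (LE_sec_out (Ds _ zs) Vp) (LE_sec_out (Cs _ zs) Vp) oppr0 addr0.
  case: p Vp => [z|] Vp; last by case: (@U01N R Vp).
  have z0 : z != 0 by apply/U01E.
  have hz : homogeneous 0 (@z_coord R).
    move=> p S S0; have [Vq|Vq] := pselect (U01 R p); last by rewrite z_coordE sf_out // ffun0E.
    case: p Vq => [y|] Vq; last by case: (@U01N R Vq).
    rewrite z_coordE (sf_in _ Vq) ffunZE ffunE; case: eqP => [h|_]; last by rewrite mulr0.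
    by rewrite h finset.cards0 in S0.
  have hom := Dh 0%N _ zs hz.
  rewrite (der_of_z _ _ z0); apply/eqP; rewrite addrC subr_eq0; apply/eqP.
  apply: ext_eq => b0 b1 b2; rewrite w2_mk /z_coef S_mk0 S_mk1 S_mk2.
  by case: b0 b1 b2 => [] [] [] //=; rewrite hom // mk_card.
move=> j; apply/funext => p; rewrite E; have [Vp|Vp] := pselect (U01 R p); last first.
  by rewrite (LE_sec_out (Ds _ (es j)) Vp) (LE_sec_out (Cs _ (es j)) Vp) oppr0 addr0.
case: p Vp => [z|] Vp; last by case: (@U01N R Vp).
have z0 : z != 0 by apply/U01E.
have hz : homogeneous 1 (e_sec (U01 R) j).
  move=> p S S0; have [Vq|Vq] := pselect (U01 R p); last by rewrite /e_sec sf_out // ffun0E.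
  case: p Vq => [y|] Vq; last by case: (@U01N R Vq).
  rewrite /e_sec (sf_in _ Vq) ffunE; case: eqP => [h|//].
  by rewrite h finset.cards1 in S0.
have hom := Dh 1%N _ (es j) hz.
rewrite (der_of_e _ _ _ z0); apply/eqP; rewrite addrC subr_eq0; apply/eqP.
apply: ext_eq => b0 b1 b2; rewrite wedge_w2 /e_coef set1_mk !ebase_mk /third_sign /= third0 third1 third2.
case: b0 b1 b2 => [] [] []; try by (rewrite hom ?mk_card //; clear hz hom; move: j; apply: ord3_ind => /=; ring).
by clear hz hom; move: j; apply: ord3_ind => /=; ring.
Qed.

End Cocycles.

(** * Coboundaries in coordinates *)

Section Coboundaries.
Variables (R : realType) (l : 'I_3 -> int).
Local Notation C := R[i].
Local Notation P1 := (P1 R).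
Local Notation ext := (ext R).
Local Notation one := (ebase R finset.set0).
Local Notation kk := (pair_deg l).
Local Notation Ltot := (total_deg l).
Local Notation der_of := (@der_of R l).
Implicit Types (V W U : set P1) (f g : P1 -> ext) (a b : 'I_3 -> C -> C).
Implicit Types (D : set P1 -> (P1 -> ext) -> P1 -> ext).
Local Notation S_ r := [set (pair_of r).1; (pair_of r).2]%SET.

(** The map [res (U01 R)] of [Der2_sheaf], written out. *)
Definition resD D : set P1 -> (P1 -> ext) -> P1 -> ext :=
  fun V => if `[< V `<=` U01 R >] then D V else 0.

Definition cobd D := exists A B, [/\ Der2_sec l (U0 R) A, Der2_sec l (U1 R) B & D = resD A + resD B].

Lemma res_mkD U u v u' v' : U01 R `<=` U ->
  (forall p, U01 R p -> u p = u' p) -> (forall p, U01 R p -> v p = v' p) ->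
  resD (mkD l U u v) = mkD l (U01 R) u' v'.
Proof.
move=> UU hu hv; apply/funext => V; apply/funext => f; rewrite /resD.
have [VU|VU] := pselect (V `<=` U01 R); last first.
  by rewrite asboolF // mkD_not // => -[].
rewrite asboolT //; have [[Vo hf]|n] := pselect (P1_open V /\ LE_sec l V f); last first.
  by rewrite !mkD_not // => -[? ? ?]; apply: n.
apply/funext => p; have [Vp|Vp] := pselect (V p); last by rewrite !mkD_out.
have VU' : V `<=` U by move=> q /VU/UU.
by rewrite (mkD_in _ _ Vo VU' hf Vp) (mkD_in _ _ Vo VU hf Vp) hu ?hv //; exact: VU.
Qed.

Lemma der_of_ext a b a' b' : (forall r z, z != 0 -> a r z = a' r z) ->
  (forall r z, z != 0 -> b r z = b' r z) -> der_of a b = der_of a' b'.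
Proof.
move=> ha hb.
have E (x x' : 'I_3 -> C -> C) : (forall r z, z != 0 -> x r z = x' r z) ->
    forall p, U01 R p -> ext01 x p = ext01 x' p.
  move=> h [z|] // /U01E z0; apply/funext => r; exact: h.
apply/funext => V; apply/funext => f; rewrite /der_of.
have [[Vo VU hf]|n] := pselect [/\ P1_open V, V `<=` U01 R & LE_sec l V f]; last first.
  by rewrite !mkD_not.
apply/funext => p; have [Vp|Vp] := pselect (V p); last by rewrite !mkD_out.
by rewrite !(mkD_in _ _ Vo VU hf Vp) (E _ _ ha p (VU _ Vp)) (E _ _ hb p (VU _ Vp)).
Qed.

Lemma der_of_lin c a b a' b' : der_of (fun r z => c * a r z + a' r z) (fun r z => c * b r z + b' r z) =
  c *: der_of a b + der_of a' b'.
Proof.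
apply/funext => V; apply/funext => f; rewrite -[RHS]/(c *: der_of a b V f + der_of a' b' V f).
have [[Vo VU hf]|n] := pselect [/\ P1_open V, V `<=` U01 R & LE_sec l V f]; last first.
  by rewrite /der_of !mkD_not // scaler0 addr0.
apply/funext => p; rewrite -[RHS]/(c *: der_of a b V f p + der_of a' b' V f p).
have [Vp|Vp] := pselect (V p); last by rewrite /der_of !mkD_out // scaler0 addr0.
rewrite /der_of !(mkD_in _ _ Vo VU hf Vp) -dform_lin_uv.
by case: p Vp => [z|] Vp //; have /U01N := VU _ Vp.
Qed.

Lemma cobd1 a b : (forall r, hole setT (a r)) -> (forall r, hole setT (b r)) ->
  exists2 B, Der2_sec l (U1 R) B & resD B = der_of a b.
Proof.
move=> ha hb; exists (mkD l (U1 R) (ext01 a) (ext01 b)); last first.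
  by apply: res_mkD => //; exact: U01_U1.
apply: mkD_Der2 => V f Vo VU hf.
by apply: mkD_sec1 => // r; [exact: hole_sub (ha r)|exact: hole_sub (hb r)].
Qed.

(** [a_inf] and [b_inf] are [u_inf] and [v_inf] at finite points: what a derivation over U0
    contributes in the chart z. *)
Definition a_inf (alpha : 'I_3 -> C -> C) (r : 'I_3) (z : C) : C :=
  - (z ^ (kk r + 2) * alpha r z^-1).
Definition b_inf (alpha beta : 'I_3 -> C -> C) (r : 'I_3) (z : C) : C :=
  z ^ kk r * (beta r z^-1 + (Ltot - kk r)%:~R * (z * alpha r z^-1)).

Lemma cobd0 alpha beta : (forall r, hole setT (alpha r)) -> (forall r, hole setT (beta r)) ->
  exists2 A, Der2_sec l (U0 R) A & resD A = der_of (a_inf alpha) (b_inf alpha beta).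
Proof.
move=> ha hb; exists (mkD l (U0 R) (u_inf l alpha) (v_inf l alpha beta)); last first.
  apply: res_mkD; first exact: U01_U0.
    by move=> [z|] // /U01N.
  by move=> [z|] // /U01N.
by apply: mkD_Der2 => V f Vo VU hf; apply: mkD_sec0.
Qed.

Lemma Der2_res U D : U01 R `<=` U -> Der2_sec l U D -> Der2_sec l (U01 R) (resD D).
Proof.
move=> UU [hD1 hD2]; split.
  move=> V f n; rewrite /resD; case: ifP => // /asboolP VU; apply: hD1 => -[Vo VU' hf].
  by apply: n.
move=> V Vo VU; have VU' : V `<=` U by move=> p /VU/UU.
have E W : W `<=` V -> resD D W = D W by move=> WV; rewrite /resD asboolT // => p /WV/VU.
have [h1 h2 h3 h4 h5] := hD2 V Vo VU'.
rewrite (E V) //; split => // W f Wo WV hf; rewrite (E W) //; exact: h5.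
Qed.

Lemma z_coef_res1 B r : Der2_sec l (U1 R) B -> exists2 a, hole setT a &
  forall z, z != 0 -> z_coef (resD B) r z = a z.
Proof.
move=> hB; have [h _ _ _ hr] := hB.2 _ (P1_openU1 R) (fun p x => x).
have s1 : LE_sec l (U1 R) (sf (U1 R) (fun z => z *: one)).
  apply: sf_sec => //; first exact: P1_openU1.
  by move=> S; apply: hole_ext_cst; exact: hole_id.
have := c1_hol (S_ r) (h _ s1); set a := c1 _ _ => ha; exists a.
  by apply: hole_sub ha => z _; exists z.
move=> z z0; have Vz : U01 R (Some z) by apply/U01E.
have sub := @U01_U1 R.
rewrite /z_coef /resD asboolT // z_coordE -(sf_restr _ sub) (hr _ _ (P1_openU01 R) sub s1).
by rewrite restrE.
Qed.

Lemma e_coef_res1 B r : Der2_sec l (U1 R) B -> exists2 b, hole setT b &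
  forall z, z != 0 -> e_coef (resD B) r z = b z.
Proof.
move=> hB; have [h _ _ _ hr] := hB.2 _ (P1_openU1 R) (fun p x => x).
have s1 := e_sec_sec l (third r) (P1_openU1 R) (fun p x => x).
have := c1_hol (mk true true true) (h _ s1); set b := c1 _ _ => hb; exists (fun z => third_sign R r * b z).
  by apply: holeZ; apply: hole_sub hb => z _; exists z.
move=> z z0; have Vz : U01 R (Some z) by apply/U01E.
have sub := @U01_U1 R.
rewrite /e_coef /resD asboolT // /e_sec -(sf_restr _ sub) (hr _ _ (P1_openU01 R) sub s1).
by rewrite restrE.
Qed.

(* w = 1 / z and the frame of O(l j) over the chart w *)
Definition w_sec : P1 -> ext := restr (U0 R) (fun p => if p is Some z then z^-1 *: one else 0).
Definition e_sec0 (j : 'I_3) : P1 -> ext :=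
  restr (U0 R) (fun p => if p is Some z then z ^ l j *: ebase R [set j]%SET else ebase R [set j]%SET).

Lemma U0N : U0 R None. Proof. by apply/U0E. Qed.
Lemma U0_Some z : z != 0 -> U0 R (Some z). Proof. by move=> z0; apply/U0E => -[/eqP]; rewrite (negbTE z0). Qed.
Lemma U0_0 : ~ U0 R (Some 0). Proof. by move=> /U0E. Qed.

Lemma w_sec_sec : LE_sec l (U0 R) w_sec.
Proof.
move=> S; apply: O_sec_0; [exact: P1_openU0|exact: U0_0| |].
  by move=> p np; rewrite /w_sec restrN // ffun0E.
apply: (hole_eq (P1_openU0 R).2 (f := fun w => w * one S)); last first.
  exact: (holeM (hole_id _) (hole_cst _ _)).
move=> w _; rewrite /frame_coef0 /w_sec; case: eqP => [->|/eqP w0].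
  by rewrite restrE ?ffun0E ?mul0r //; exact: U0N.
rewrite restrE; last by apply: U0_Some; rewrite invr_eq0.
rewrite ffunZE invrK ffunE; case: eqP => [->|_]; last by rewrite !mulr0.
by rewrite /ext_deg big_set0 expr0z mul1r.
Qed.

Lemma e_sec0_sec j : LE_sec l (U0 R) (e_sec0 j).
Proof.
move=> S; apply: O_sec_0; [exact: P1_openU0|exact: U0_0| |].
  by move=> p np; rewrite /e_sec0 restrN // ffun0E.
apply: (hole_eq (P1_openU0 R).2 (f := fun w => ebase R [set j]%SET S)); last exact: hole_cst.
move=> w _; rewrite /frame_coef0 /e_sec0; case: eqP => [w0|/eqP w0].
  by rewrite restrE //; exact: U0N.
rewrite restrE; last by apply: U0_Some; rewrite invr_eq0.
rewrite ffunZE ffunE; case: eqP => [->|_]; last by rewrite !mulr0.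
rewrite /ext_deg big_set1 mulr1 exprz_inv.
by rewrite -expfzDr // subrr expr0z.
Qed.

(** alpha and beta are the coefficients of A on w and on the frames over U0. They are translated by
    A w = - z^-2 A z and by Leibniz for z^{l_j} e_j. *)
Lemma coefs_res0 A : Der2_sec l (U0 R) A -> exists alpha beta,
  [/\ forall r, hole setT (alpha r), forall r, hole setT (beta r),
   forall r z, z != 0 -> z_coef (resD A) r z = a_inf alpha r z &
   forall r z, z != 0 -> e_coef (resD A) r z = b_inf alpha beta r z].
Proof.
move=> hA; have [h _ _ _ hr] := hA.2 _ (P1_openU0 R) (fun p x => x).
have sub := @U01_U0 R.
have hrA := Der2_res sub hA; have rep := representation hrA.
set a := z_coef (resD A) in rep *; set b := e_coef (resD A) in rep *.
pose alpha r := c0 l (A (U0 R) w_sec) (S_ r).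
pose beta r w := third_sign R r * c0 l (A (U0 R) (e_sec0 (third r))) (mk true true true) w.
have setTU0 : setT `<=` @chart0 R @^-1` (U0 R) by move=> w _; exists w.
have ea r z : z != 0 -> a r z = a_inf alpha r z.
  move=> z0; have Vz : U01 R (Some z) by apply/U01E.
  have ws : restr (U01 R) w_sec = sf (U01 R) (fun z => z^-1 *: one).
    apply/funext => p; have [Up|Up] := pselect (U01 R p); last by rewrite restrN // sf_out.
    case: p Up => [y|/U01N//] Up.
    rewrite restrE // (sf_in _ Up) /w_sec restrE //; exact: sub.
  have hinv : hol (@nz R) (fun z => z^-1) (fun z => - z ^- 2).
    apply: (hol_ext _ _ (holV (f := id) (fun y h => h) (hol_id _))) => y //.
    by rewrite mulN1r.
  have E1 : A (U01 R) (restr (U01 R) w_sec) (Some z) = A (U0 R) w_sec (Some z).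
    by rewrite (hr _ _ (P1_openU01 R) sub w_sec_sec) restrE.
  have E2 : A (U01 R) (restr (U01 R) w_sec) (Some z) = der_of a b (U01 R) (sf (U01 R) (fun z => z^-1 *: one)) (Some z).
    by rewrite -ws -rep /resD asboolT.
  rewrite E1 (der_of_scaled l a b one z0 hinv) in E2.
  have E3 : A (U0 R) w_sec (Some z) (S_ r) = a r z * - z ^- 2.
    rewrite E2; move: r; apply: ord3_ind; rewrite ?S_mk0 ?S_mk1 ?S_mk2 dform_mk /= ffunZE set0_mk ebase_mk /=;
    by rewrite mulr1.
  have E4 : A (U0 R) w_sec (Some z) (S_ r) = z ^ ext_deg l (S_ r) * alpha r z^-1.
    exact: (frame_coef01 _ (fun p => A (U0 R) w_sec p (S_ r)) z0).
  have kE : ext_deg l (S_ r) = kk r.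
    rewrite /pair_deg; move: r {E3 E4}; apply: ord3_ind; rewrite ?S_mk0 ?S_mk1 ?S_mk2 ext_deg_mk ?pair_of0 ?pair_of1 ?pair_of2 /=; ring.
  rewrite /a_inf expfzDr // -kE -mulrA [z ^ 2 * _]mulrC mulrA -E4 E3.
  by rewrite mulrN mulNr opprK -mulrA mulVf ?mulr1 // expf_neq0.
exists alpha, beta; split => //.
- by move=> r; apply: hole_sub (c0_hol _ (h _ w_sec_sec)).
- move=> r; apply: holeZ; apply: hole_sub (c0_hol _ (h _ (e_sec0_sec _))) => //.
move=> r z z0; have Vz : U01 R (Some z) by apply/U01E.
set j := third r.
have es : restr (U01 R) (e_sec0 j) = sf (U01 R) (fun z => z ^ l j *: ebase R [set j]%SET).
  apply/funext => p; have [Up|Up] := pselect (U01 R p); last by rewrite restrN // sf_out.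
  case: p Up => [y|/U01N//] Up.
  rewrite restrE // (sf_in _ Up) /e_sec0 restrE //; exact: sub.
have E1 : A (U01 R) (restr (U01 R) (e_sec0 j)) (Some z) = A (U0 R) (e_sec0 j) (Some z).
  by rewrite (hr _ _ (P1_openU01 R) sub (e_sec0_sec j)) restrE.
have E2 : A (U01 R) (restr (U01 R) (e_sec0 j)) (Some z) =
    der_of a b (U01 R) (sf (U01 R) (fun z => z ^ l j *: ebase R [set j]%SET)) (Some z).
  by rewrite -es -rep /resD asboolT.
rewrite E1 (der_of_scaled l a b _ z0 (hol_exprz R (l j))) in E2.
have kj : Ltot - kk r = l j.
  rewrite /pair_deg /total_deg /j; move: r {es E1 E2} @j; apply: ord3_ind; rewrite ?third0 ?third1 ?third2 ?pair_of0 ?pair_of1 ?pair_of2 /=; ring.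
have E3 : A (U0 R) (e_sec0 j) (Some z) (mk true true true) =
    third_sign R r * (a r z * ((l j)%:~R * z ^ (l j - 1)) + b r z * z ^ l j).
  rewrite E2 dform_mk /= !ffunZE set1_mk !ebase_mk /j /third_sign.
  move: r {es E1 E2 kj} @j; apply: ord3_ind; rewrite ?third0 ?third1 ?third2 /=; ring.
have E4 : A (U0 R) (e_sec0 j) (Some z) (mk true true true) = z ^ Ltot * (third_sign R r * beta r z^-1).
  rewrite (frame_coef01 (ext_deg l (mk true true true))
    (fun p => A (U0 R) (e_sec0 j) p (mk true true true)) z0).
  by rewrite /beta mulrA third_signK mul1r /c0 /j !ext_deg_mk.
(* Solving for b isolates the contribution of a, which is then replaced by alpha through [ea]. *)
have E5 : b r z * z ^ l j = z ^ Ltot * beta r z^-1 - a r z * ((l j)%:~R * z ^ (l j - 1)).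
  have E := etrans (esym E3) E4.
  have E' : a r z * ((l j)%:~R * z ^ (l j - 1)) + b r z * z ^ l j = z ^ Ltot * beta r z^-1.
    have G (s x y t : C) : s * s = 1 -> s * x = y * (s * t) -> x = y * t.
      by move=> h2 e; rewrite -[x]mul1r -h2 -mulrA e; rewrite -[RHS]mul1r -h2; ring.
    exact: (G _ _ _ _ (third_signK R r) E).
  by rewrite -E' addrC addKr.
have lj0 : z ^ l j != 0 by rewrite expfz_neq0.
have LE : Ltot = kk r + l j by rewrite -kj; ring.
have e1 : z ^ (l j - 1) = z ^ l j * z^-1 by exact: (expfzDr _ _ z0).
have e2 : z ^ (kk r + 2) = z ^ kk r * z ^+ 2 by exact: (expfzDr _ _ z0).
have e3 : z ^ (kk r + l j) = z ^ kk r * z ^ l j by exact: (expfzDr _ _ z0).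
apply: (mulIf lj0); rewrite E5 (ea _ _ z0) /a_inf /b_inf kj LE e1 e2 e3.
move: (z ^ kk r) (z ^ l j) (beta r z^-1) (alpha r z^-1) ((l j)%:~R) => x y p q n.
by field.
Qed.

End Coboundaries.

(** * First cohomology *)

Section Tails.
Variable R : realType.
Local Notation C := R[i].
Implicit Types (p q : {poly C}) (f A B : C -> C).

(** N is the dimension of the space of tails; N = 0, that is n = -1, gives the zero space. *)
Lemma tail_polyP (n : int) (N : nat) p : n + 1 = N%:Z ->
  (tail_poly n p <-> p.[0] = 0 /\ (size p <= N.+1)%N).
Proof.
move=> nN; split=> [[q -> hq]|[p0 sp]].
  split; first by rewrite hornerM hornerX mul0r.
  have [->|q0] := eqVneq q 0; first by rewrite mulr0 size_poly0.
  by rewrite mulrC size_mulX //; move: (hq q0); lia.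
move/eqP: p0 => /(@factor_theorem C p 0)[q E]; move: E; rewrite subr0 mulrC => E.
exists q => // q0; move: sp; rewrite E mulrC size_mulX //; lia.
Qed.

Lemma tail_poly_lin n (c : C) p q : tail_poly n p -> tail_poly n q -> tail_poly n (c *: p + q).
Proof.
move=> [p' -> hp] [q' -> hq]; exists (c *: p' + q'); first by rewrite mulrDr scalerAr.
have [->|c0] := eqVneq c 0; first by rewrite scale0r add0r.
move=> h.
have [p0|p0] := eqVneq p' 0; first by rewrite p0 scaler0 add0r in h *; exact: hq.
have [q0|q0] := eqVneq q' 0; first by rewrite q0 addr0 size_scale //; exact: hp.
pose m := absz (n + 1); have n1 : n + 1 = m%:Z by rewrite /m; move: (hp p0); move: (size _) => s; lia.
have H (s : nat) : (s%:Z - 1 <= n)%R -> (s <= m)%N by lia.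
have H' (s : nat) : (s <= m)%N -> (s%:Z - 1 <= n)%R by lia.
apply: H'; apply: (leq_trans (size_polyD _ _)); rewrite geq_max size_scale //.
by apply/andP; split; apply: H; [exact: hp|exact: hq].
Qed.

Lemma tail_poly0 n : tail_poly n (0 : {poly C}).
Proof. by exists 0; rewrite ?mulr0 ?eqxx. Qed.

Lemma expfN (N : nat) (k : int) (z : C) : k = - (N%:Z) -> z ^ k = z^-1 ^+ N.
Proof. by move=> ->; rewrite -exprz_inv. Qed.

(** z^k A(1/z) is regular over U0 as a section of O(k), and B is regular over U1. For k < 0 the
    exponents k + 1, ..., -1 are reached by neither. *)
Lemma tail_split (k : int) f : k < 0 -> hole (@nz R) f -> exists p A B,
  [/\ tail_poly (- k - 2) p, hole setT A, hole setT B &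
   forall z, z != 0 -> f z = p.[z^-1] + z ^ k * A z^-1 + B z].
Proof.
move=> k0 [f' hf]; pose N := absz (- k - 1).
have kN : k = - (N.+1%:Z) by rewrite /N; lia.
have [q [A [A' [B [B' [sq hA hB E]]]]]] := laurent_split N hf.
exists ('X * q), A, B; split; [|by exists A'|by exists B'|].
  by exists q => //; move: sq; lia.
by move=> z /E ->; rewrite (expfN _ kN).
Qed.

(** The vanishing of A is recorded because A will be, up to sign, the alpha which enters the second
    coefficient. *)
Lemma tail_unique (k : int) p A B : k < 0 -> tail_poly (- k - 2) p ->
  hole setT A -> hole setT B ->
  (forall z, z != 0 -> p.[z^-1] = z ^ k * A z^-1 + B z) ->
  p = 0 /\ forall v, v != 0 -> A v = 0.
Proof.
move=> k0 tp [A' hA] [B' hB] E; pose N := absz (- k - 1).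
have kN : k = - (N.+1%:Z) by rewrite /N; lia.
have nN : - k - 2 + 1 = N%:Z by rewrite /N; lia.
have [p0 sp] := (tail_polyP p nN).1 tp.
apply: (laurent_unique hA hB sp p0) => z /E ->.
by rewrite (expfN _ kN).
Qed.

End Tails.

Section DerTails.
Variables (R : realType) (l : 'I_3 -> int).
Local Notation C := R[i].
Local Notation P1 := (P1 R).
Local Notation kk := (pair_deg l).
Local Notation Ltot := (total_deg l).
Local Notation der_of := (@der_of R l).
Hypothesis kk_lt : forall r, kk r + 2 < 0.
Implicit Types (p q : 'I_3 -> {poly C}).

Definition pz p (r : 'I_3) (z : C) : C := (p r).[z^-1].
(* e = 2 for Der(O_M) (x) Lambda^2 E and e = 0 for Hom(Lambda^1 E, Lambda^3 E) *)
Definition tails (e : int) p := forall r, tail_poly (- (kk r + e) - 2) (p r).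

Lemma der_ofD (a b a' b' : 'I_3 -> C -> C) :
  der_of (fun r z => a r z + a' r z) (fun r z => b r z + b' r z) = der_of a b + der_of a' b'.
Proof.
have E : 1 *: der_of a b = der_of a b by exact: scale1r.
have H := etrans (der_of_lin l 1 a b a' b') (congr1 (fun x => x + der_of a' b') E).
refine (etrans _ H).
by apply: der_of_ext => r z _; rewrite mul1r.
Qed.

Lemma der_ofB (a b a' b' : 'I_3 -> C -> C) :
  der_of (fun r z => a r z - a' r z) (fun r z => b r z - b' r z) = der_of a b - der_of a' b'.
Proof.
apply: (@addIr (set P1 -> (P1 -> ext R) -> P1 -> ext R) (der_of a' b')); rewrite subrK -der_ofD.
by apply: der_of_ext => r z _; rewrite subrK.
Qed.

Lemma hole_horner V (p : {poly C}) : hole V (fun z => p.[z]).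
Proof. by have [p' hp] := hol_horner p; exists p'; exact: hol_sub hp. Qed.

Lemma hole_setT_inv f : hole setT f -> hole (@nz R) (fun z => f z^-1).
Proof. by move=> /hole_inv; apply: hole_sub. Qed.

Lemma hole_pz p r : hole (@nz R) (pz p r).
Proof. exact: hole_setT_inv (hole_horner _ _). Qed.

Lemma twist_hole (k : int) (c : C) f : hole setT f ->
  hole (@nz R) (fun z => z ^ k * (c * (z * f z^-1))).
Proof.
move=> hf; apply: (holeM (hole_exprz _ k)); apply: holeZ.
exact: (holeM (hole_id _) (hole_setT_inv hf)).
Qed.

(** Reducing a fixes alpha; what alpha adds to b is subtracted before b is reduced. *)
Lemma der_of_surj D : Der2_sec l (U01 R) D -> exists p q,
  [/\ tails 2 p, tails 0 q & cobd l (D - der_of (pz p) (pz q))].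
Proof.
move=> hD; rewrite (representation hD).
have ha r := z_coef_hole r hD; have hb r := e_coef_hole r hD.
move: (z_coef D) (e_coef D) ha hb => a b ha hb {hD D}.
have h1 r := tail_split (kk_lt r) (ha r).
have {h1}[p h1] := choice h1; have {h1}[A h1] := choice h1; have {h1}[A' h1] := choice h1.
pose alpha r z := - A r z.
(* The sign in alpha matches the one in [a_inf]. *)
have hal r : hole setT (alpha r) by apply: holeN; have [_ ? _ _] := h1 r.
(* the chart change of alpha also contributes to the second coefficient *)
pose t r z := z ^ kk r * ((Ltot - kk r)%:~R * (z * alpha r z^-1)).
have hb2 r : hole (@nz R) (fun z => b r z - t r z).
  by apply: holeB; [exact: hb|exact: twist_hole].
have kk0 r : kk r < 0 by move: (kk_lt r); lia.
have h2 r := tail_split (kk0 r) (hb2 r).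
have {h2}[q h2] := choice h2; have {h2}[B h2] := choice h2; have {h2}[B' h2] := choice h2.
exists p, q; split.
- by move=> r; have [] := h1 r.
- by move=> r; have [? _ _ _] := h2 r; rewrite addr0.
have hB r : hole setT (B r) by have [] := h2 r.
have hA' r : hole setT (A' r) by have [] := h1 r.
have hB' r : hole setT (B' r) by have [] := h2 r.
have [D0 hD0 e0] := cobd0 l hal hB; have [D1 hD1 e1] := cobd1 l hA' hB'.
exists D0, D1; split; [exact: hD0|exact: hD1|].
rewrite e0 e1.
rewrite -der_ofB -der_ofD.
apply: der_of_ext => r z z0.
  have [_ _ _ E] := h1 r; rewrite (E _ z0) /pz /a_inf /alpha; ring.
have [_ _ _ E] := h2 r; have {}E := E _ z0.
rewrite -[b r z](subrK (t r z)) E /t /pz /b_inf; ring.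
Qed.

(** The component on z is not affected by b, so b is arbitrary. This also serves for vertical
    derivations that are not in normal form. *)
Lemma der_of_inj1 p b : tails 2 p -> cobd l (der_of (pz p) b) -> forall r, p r = 0.
Proof.
move=> hp [A [B [hA hB E]]] r.
have [alpha [beta [hal hbe ea eb]]] := coefs_res0 hA.
have [a1 ha1 ea1] := z_coef_res1 r hB.
have Ep z : z != 0 -> (p r).[z^-1] = z ^ (kk r + 2) * - alpha r z^-1 + a1 z.
  move=> z0; have := z_coef_der_of l (pz p) b r z0; rewrite E.
  have -> : z_coef (resD A + resD B) r z = z_coef (resD A) r z + z_coef (resD B) r z.
    rewrite /z_coef -[LHS]/((resD A (U01 R) (@z_coord R) (Some z) + resD B (U01 R) (@z_coord R) (Some z)) _).
    by rewrite ffunDE.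
  rewrite (ea _ _ z0) (ea1 _ z0).
  by rewrite /a_inf mulrN => ->.
by have [] := tail_unique (kk_lt r) (hp r) (holeN (hal r)) ha1 Ep.
Qed.

(** With a = 0 the uniqueness of tails makes alpha vanish off the origin, so that [b_inf] reduces to
    its term with beta. *)
Lemma der_of_inj2 q : tails 0 q -> cobd l (der_of (fun _ _ => 0) (pz q)) -> forall r, q r = 0.
Proof.
move=> hq [A [B [hA hB E]]] r.
have [alpha [beta [hal hbe ea eb]]] := coefs_res0 hA.
have [a1 ha1 ea1] := z_coef_res1 r hB; have [b1 hb1 eb1] := e_coef_res1 r hB.
have Ep z : z != 0 -> (0 : {poly C}).[z^-1] = z ^ (kk r + 2) * - alpha r z^-1 + a1 z.
  move=> z0; have := z_coef_der_of l (fun _ _ => 0) (pz q) r z0; rewrite E.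
  have -> : z_coef (resD A + resD B) r z = z_coef (resD A) r z + z_coef (resD B) r z.
    rewrite /z_coef -[LHS]/((resD A (U01 R) (@z_coord R) (Some z) + resD B (U01 R) (@z_coord R) (Some z)) _).
    by rewrite ffunDE.
  rewrite (ea _ _ z0) (ea1 _ z0).
  by rewrite /a_inf mulrN horner0 => ->.
have [_ al0] := tail_unique (kk_lt r) (tail_poly0 _ _) (holeN (hal r)) ha1 Ep.
have Eq z : z != 0 -> (q r).[z^-1] = z ^ kk r * beta r z^-1 + b1 z.
  move=> z0; have := e_coef_der_of l (fun _ _ => 0) (pz q) r z0; rewrite E.
  have -> : e_coef (resD A + resD B) r z = e_coef (resD A) r z + e_coef (resD B) r z.
    rewrite /e_coef -[(resD A + resD B) _ _ _]/(resD A (U01 R) _ (Some z) + resD B (U01 R) _ (Some z)).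
    by rewrite ffunDE mulrDr.
  rewrite (eb _ _ z0) (eb1 _ z0) /b_inf.
  have zi0 : z^-1 != 0 by rewrite invr_eq0.
  have /eqP := al0 _ zi0; rewrite oppr_eq0 => /eqP->.
  by rewrite !mulr0 addr0 => ->.
have kk0 : kk r < 0 by move: (kk_lt r); lia.
have hq' : tail_poly (- kk r - 2) (q r) by have := hq r; rewrite addr0.
by have [] := tail_unique kk0 hq' (hbe r) hb1 Eq.
Qed.

End DerTails.

Section CohomologyTheory.
Variables (R : realType) (F : presheaf R).
Local Notation C := R[i].

Definition cob (a : amb F) : Prop := exists u v,
  [/\ sec (U0 R) u, sec (U1 R) v & a = res (U01 R) u + res (U01 R) v].

Lemma rep_ex (a : amb F) : sec (U01 R) a -> exists x : H1 F, represents a x.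
Proof.
move=> ha; pose c : cocycle F := Sub a (asboolT ha : cocycle_pred a).
by exists (H1_class c), c; rewrite ?SubK.
Qed.

Lemma rep_sec (a : amb F) (x : H1 F) : represents a x -> sec (U01 R) a.
Proof. by move=> [c <- _]; exact/asboolP/(valP c). Qed.

Lemma rep_surj (x : H1 F) : exists a, represents a x.
Proof. by exists (val (H1_repr x)), (H1_repr x); rewrite ?H1_reprK. Qed.

Lemma rep_eq (a b : amb F) (x y : H1 F) : represents a x -> represents b y ->
  (x = y <-> cob (a - b)).
Proof.
move=> [c <- <-] [d <- <-]; split.
  move=> /H1_class_inv/asboolP[u [v [hu hv e]]]; exists u, v; split=> //.
move=> [u [v [hu hv e]]]; apply: H1_class_eq; apply/asboolP; exists u, v.
by split; [exact: hu|exact: hv|rewrite -e raddfB].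
Qed.

Lemma rep_lin k (a b : amb F) (x y : H1 F) : represents a x -> represents b y ->
  represents (k *: a + b) (k *: x + y).
Proof.
move=> [c <- <-] [d <- <-]; exists (k *: c + d); first by rewrite linearP.
by rewrite H1_classD H1_classZ.
Qed.

End CohomologyTheory.

Section Theta.
Variables (R : realType) (l : 'I_3 -> int).
Local Notation C := R[i].
Local Notation P1 := (P1 R).
Local Notation kk := (pair_deg l).
Local Notation der_of := (@der_of R l).
Local Notation H := (H1 (Der2_sheaf R l)).
Hypothesis kk_lt : forall r, kk r + 2 < 0.
Implicit Types (P Q : 'cV[{poly C}]_3).

Definition cz P : 'I_3 -> C -> C := pz (fun r => P r ord0).
Definition vtails (e : int) P := tails l e (fun r => P r ord0).

Lemma cob_cobd (D : amb (Der2_sheaf R l)) : cob D = cobd l D.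
Proof. by []. Qed.

Lemma Theta_ex P Q : exists x : H, represents (der_of (cz P) (cz Q) : amb (Der2_sheaf R l)) x.
Proof. by apply: rep_ex; apply: der_of_sec => r; exact: hole_pz. Qed.

(* the class of z |-> P(1/z), e_j |-> Q(1/z) /\ e_j *)
Definition Theta P Q : H := projT1 (cid (Theta_ex P Q)).

Lemma Theta_rep P Q : represents (der_of (cz P) (cz Q) : amb (Der2_sheaf R l)) (Theta P Q).
Proof. exact: projT2 (cid (Theta_ex P Q)). Qed.

Lemma czP k P P' r z : cz (k%:P *: P + P') r z = k * cz P r z + cz P' r z.
Proof. by rewrite /cz /pz !mxE hornerD hornerCM. Qed.

Lemma Theta_lin k P P' Q Q' :
  Theta (k%:P *: P + P') (k%:P *: Q + Q') = k *: Theta P Q + Theta P' Q'.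
Proof.
have h1 := Theta_rep (k%:P *: P + P') (k%:P *: Q + Q').
have h2 := rep_lin k (Theta_rep P Q) (Theta_rep P' Q').
move: h1; have -> : der_of (cz (k%:P *: P + P')) (cz (k%:P *: Q + Q')) =
    k *: der_of (cz P) (cz Q) + der_of (cz P') (cz Q').
  by refine (etrans _ (der_of_lin _ _ _ _ _ _)); apply: der_of_ext => r z _; rewrite czP.
move=> [c e1 <-]; move: h2 => [d e2 <-].
by congr H1_class; apply: val_inj; rewrite e1 e2.
Qed.

Lemma Theta_surj x : exists P Q, [/\ vtails 2 P, vtails 0 Q & x = Theta P Q].
Proof.
have [D hD] := rep_surj x; have [p [q [hp hq h]]] := der_of_surj kk_lt (rep_sec hD).
have E p0 : pz p0 = cz ((\col_r p0 r : 'cV[{poly C}]_3)).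
  by apply/funext => r; apply/funext => z; rewrite /cz /pz mxE.
exists (\col_r p r), (\col_r q r); split.
- by move=> r; rewrite mxE; exact: hp.
- by move=> r; rewrite mxE; exact: hq.
by apply/(rep_eq hD (Theta_rep _ _)); rewrite cob_cobd -!E.
Qed.

Lemma vtails_lin e k P P' : vtails e P -> vtails e P' -> vtails e (k%:P *: P + P').
Proof.
move=> hP hP' r; rewrite !mxE mul_polyC; exact: tail_poly_lin (hP r) (hP' r).
Qed.

Lemma vtails0 e : vtails e 0.
Proof. by move=> r; rewrite mxE; exact: tail_poly0. Qed.

Lemma cz0 : cz 0 = fun _ _ => 0.
Proof. by apply/funext => r; apply/funext => z; rewrite /cz /pz mxE horner0. Qed.

Lemma Theta_inj P Q P' Q' : vtails 2 P -> vtails 0 Q -> vtails 2 P' -> vtails 0 Q' ->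
  Theta P Q = Theta P' Q' -> P = P' /\ Q = Q'.
Proof.
move=> hP hQ hP' hQ' E.
have := (rep_eq (Theta_rep P Q) (Theta_rep P' Q')).1 E; rewrite cob_cobd => h.
have E1 X Y r z : cz X r z - cz Y r z = cz ((-1)%:P *: Y + X) r z by rewrite czP; ring.
have X0 X Y : (forall r, ((-1)%:P *: Y + X : 'cV[{poly C}]_3) r ord0 = 0) -> X = Y.
  move=> h0; apply/matrixP => r c; rewrite ord1; have := h0 r.
  by rewrite !mxE polyCN mulN1r addrC => /eqP; rewrite subr_eq0 => /eqP.
have hd : cobd l (der_of (cz ((-1)%:P *: P' + P)) (cz ((-1)%:P *: Q' + Q))).
  move: h; rewrite -der_ofB; congr cobd; apply: der_of_ext => r z _; exact: E1.
have PP : P = P'.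
  by apply: X0; exact: (der_of_inj1 kk_lt (vtails_lin (-1) hP' hP) hd).
split=> //; apply: X0; apply: (der_of_inj2 kk_lt (vtails_lin (-1) hQ' hQ)).
move: hd; congr cobd; apply: der_of_ext => r z _; rewrite // -E1 PP; ring.
Qed.

Lemma tail_fun_sec k (p : {poly C}) : O_sec k (U01 R) (tail_fun p).
Proof.
apply: O_sec1; [exact: P1_openU01|exact: U01N| |].
  by move=> s Us; rewrite /tail_fun restrN.
apply: (hole_eq (P1_openU01 R).1 (f := fun z => p.[z^-1])).
  by move=> z Vz; rewrite /frame_coef1 /tail_fun restrE.
apply: hole_sub (hole_setT_inv (hole_horner setT p)); exact: U01nz.
Qed.

Local Notation i_ r := (pair_of r).1.
Local Notation j_ r := (pair_of r).2.
Local Notation S_ r := [set i_ r; j_ r]%SET.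

Lemma tail_ident k (f : P1 -> C^o) p : tail_poly (- k - 2) p -> f = tail_fun p ->
  exists2 y : H1 (O_sheaf R k), represents (f : amb (O_sheaf R k)) y & H1_O_ident y p.
Proof.
move=> hp ->; have [y hy] := @rep_ex _ (O_sheaf R k) (tail_fun p) (tail_fun_sec k p).
by exists y => //; split.
Qed.

Lemma w2_S (v : 'I_3 -> C) r : w2 v (S_ r) = v r.
Proof. by move: r; apply: ord3_ind; rewrite ?S_mk0 ?S_mk1 ?S_mk2 w2_mk. Qed.

Lemma restriction_Theta P Q : vtails 2 P ->
  restriction_ident (Theta P Q) (fun r => P r ord0).
Proof.
move=> hP; exists (der_of (cz P) (cz Q)); first exact: Theta_rep.
move=> r; apply: tail_ident; first exact: hP.
apply/funext => s; have [Us|Us] := pselect (U01 R s); last first.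
  by rewrite /tail_fun restrN // /der_of mkD_out // ffun0E.
case: s Us => [z|/U01N//] Us; have z0 : z != 0 by apply/U01E.
by rewrite /tail_fun restrE // der_of_z // w2_S.
Qed.

Definition omega_of Q : P1 -> ext R := sf (U01 R) (fun z => w2 (cz Q ^~ z)).

Lemma omega_of_sec Q : LE_sec l (U01 R) (omega_of Q).
Proof.
apply: sf_sec; [exact: P1_openU01|exact: U01_U1|].
have h r : hole (@chart1 R @^-1` (U01 R)) (cz Q r) by apply: hole_sub (@U01nz R) (hole_pz _ _).
apply: mk_ind => b0 b1 b2.
have -> : (fun z => w2 (cz Q ^~ z) (mk b0 b1 b2)) = fun z => if b0 then
   (if b1 then (if b2 then 0 else cz Q i0 z) else if b2 then cz Q i1 z else 0)
   else if b1 && b2 then cz Q i2 z else 0 by apply/funext => z; rewrite w2_mk.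
by case: b0 b1 b2 => [] [] [] /=; first [exact: h | exact: hole_cst].
Qed.

Lemma omega_of_vertical Q : vertical (omega_of Q) (der_of (fun _ _ => 0) (cz Q) : amb (Der2_sheaf R l)).
Proof.
split; first exact: omega_of_sec.
  move=> p; apply: mk_ind => b0 b1 b2; rewrite mk_card => h2.
  have [Up|Up] := pselect (U01 R p); last by rewrite /omega_of sf_out // ffun0E.
  case: p Up => [z|/U01N//] Up.
  have -> : omega_of Q (Some z) = w2 (cz Q ^~ z) := sf_in _ Up.
  by rewrite w2_mk; move: h2; case: b0 b1 b2 => [] [] [].
move=> V f Vo VU hf.
have E p : V p -> der_of (fun _ _ => 0) (cz Q) V f p =
    dform (ext01 (fun _ _ => 0) p) (ext01 (cz Q) p) (dsec l f p) (f p).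
  by move=> Vp; rewrite /der_of (mkD_in _ _ Vo VU hf Vp).
have out p : ~ V p -> der_of (fun _ _ => 0) (cz Q) V f p = 0 by move=> Vp; rewrite /der_of mkD_out.
split=> hom; apply/funext => p; have [Vp|Vp] := pselect (V p).
- rewrite E //; case: p Vp => [z|] Vp; last by have /U01N := VU _ Vp.
  have h b0 b1 b2 : [|| b0, b1 | b2] -> f (Some z) (mk b0 b1 b2) = 0.
    by move=> hb; apply: hom; rewrite mk_card; move: hb; case: b0 b1 b2 => [] [] [].
  apply: ext_eq => b0 b1 b2; rewrite dform_mk !h // ffun0E.
  by case: b0 b1 b2 => [] [] [] /=; ring.
- by rewrite out.
- rewrite E //; case: p Vp => [z|] Vp; last by have /U01N := VU _ Vp.
  rewrite restrE //; have -> : omega_of Q (Some z) = w2 (cz Q ^~ z) := sf_in _ (VU _ Vp).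
  have h : f (Some z) (mk false false false) = 0 by apply: hom; rewrite mk_card.
  apply: ext_eq => b0 b1 b2; rewrite dform_mk wedge_w2 !h.
  by case: b0 b1 b2 => [] [] [] /=; ring.
by rewrite out // restrN // wedge0l.
Qed.

Lemma vertical_Theta Q : vtails 0 Q -> vertical_ident (Theta 0 Q) (fun r => Q r ord0).
Proof.
move=> hQ; exists (omega_of Q), (der_of (fun _ _ => 0) (cz Q)); split.
- by rewrite -cz0; exact: Theta_rep.
- exact: omega_of_vertical.
move=> r; apply: tail_ident; first by have := hQ r; rewrite addr0.
apply/funext => s; have [Us|Us] := pselect (U01 R s); last first.
  by rewrite /tail_fun restrN // /omega_of sf_out // ffun0E.
case: s Us => [z|/U01N//] Us.
have -> : omega_of Q (Some z) = w2 (cz Q ^~ z) := sf_in _ Us.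
by rewrite /tail_fun restrE // w2_S.
Qed.

(** A vertical D kills the degree 0 section z, so its first coefficient is 0; if D is cohomologous
    to Theta P Q, then [der_of_inj1] gives P = 0. *)
Lemma H1_verticalP (x : H) : H1_vertical x <-> exists2 Q, vtails 0 Q & x = Theta 0 Q.
Proof.
split=> [[omega [D [hD [_ _ vD]]]]|[Q hQ ->]]; last first.
  exists (omega_of Q), (der_of (fun _ _ => 0) (cz Q)); split; last exact: omega_of_vertical.
  by rewrite -cz0; exact: Theta_rep.
have [P [Q [hP hQ xE]]] := Theta_surj x; exists Q => //.
suff -> : 0 = P by [].
have D0 : D (U01 R) (@z_coord R) = 0.
  have [h _] := vD _ _ (P1_openU01 R) (fun p h => h) (z_coord_sec R l); apply: h.
  move=> p S Sn; have [Up|Up] := pselect (U01 R p); last by rewrite /z_coord restrN // ffun0E.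
  case: p Up => [z|/U01N//] Up; rewrite /z_coord restrE // ffunZE ffunE.
  by move: Sn; case: (S =P finset.set0) => [->|_ _]; rewrite ?finset.cards0 ?eqxx ?mulr0.
have hS := rep_sec hD; have rep := representation hS.
have := (rep_eq hD (Theta_rep P Q)).1 xE; rewrite cob_cobd rep -der_ofB => h.
have E : der_of (fun r z => z_coef D r z - cz P r z) (fun r z => e_coef D r z - cz Q r z) =
    der_of (pz (fun r => ((-1)%:P *: P + 0 : 'cV[{poly C}]_3) r ord0)) (fun r z => e_coef D r z - cz Q r z).
  apply: der_of_ext => // r z _; rewrite -[RHS]/(cz _ r z) czP cz0 /z_coef D0 ffun0E; ring.
rewrite E in h.
have P0 := der_of_inj1 kk_lt (vtails_lin (-1) hP (vtails0 2)) h.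
apply/matrixP => r c; rewrite ord1 mxE; have := P0 r.
by rewrite !mxE polyCN mulN1r addr0 => /eqP; rewrite oppr_eq0 => /eqP.
Qed.

End Theta.

(** * The action of U(E) *)

Section Conjugation.
Variables (R : realType) (l : 'I_3 -> int).
Local Notation C := R[i].
Local Notation P1 := (P1 R).
Local Notation ext := (ext R).
Local Notation kk := (pair_deg l).
Local Notation der_of := (@der_of R l).
Local Notation H := (H1 (Der2_sheaf R l)).
Hypothesis kk_lt : forall r, kk r + 2 < 0.
Implicit Types (P Q : 'cV[{poly C}]_3) (g h : 'M[C]_3) (V : set P1) (f : P1 -> ext).

Lemma ext_map_coef g : exists m : {set 'I_3} -> {set 'I_3} -> C,
  forall a S, ext_map g a S = \sum_T m S T * a T.
Proof.
exists (fun S T => ext_map g (ebase R T) S) => a S.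
have lin1 c (x y : ext) : ext_map g (c *: x + y) = c *: ext_map g x + ext_map g y.
  exact: ext_map_lin.
have g0 : ext_map g 0 = 0.
  by have := lin1 (-1) 0 0; rewrite scaler0 addr0 scaleN1r addNr.
have h (s : seq {set 'I_3}) : ext_map g (\sum_(T <- s) a T *: ebase R T) S =
    \sum_(T <- s) ext_map g (ebase R T) S * a T.
  elim: s => [|T s IH]; first by rewrite !big_nil g0 ffun0E.
  by rewrite !big_cons lin1 ffunDE ffunZE IH mulrC.
rewrite {1}[a]ext_sum; exact: h.
Qed.

Lemma ext_map_zero g : ext_map g (0 : ext) = 0.
Proof.
have [m hm] := ext_map_coef g; apply/ffunP => S; rewrite hm big1 ?ffun0E // => T _.
by rewrite ffun0E mulr0.
Qed.

(** Over U1 a single frame trivialises all summands, so every constant matrix acts on sections and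
    commutes with differentiation. The block form enters with the chart change, in [conj_cobd]. *)
Lemma LE_ext_map g V f : P1_open V -> V `<=` U1 R -> LE_sec l V f ->
  LE_sec l V (fun p => ext_map g (f p)) /\
  forall p, V p -> dsec l (fun p => ext_map g (f p)) p = ext_map g (dsec l f p).
Proof.
move=> Vo VU hf; have [m hm] := ext_map_coef g.
have VN : ~ V None by move=> /VU/U1E.
have hh S : hol (@chart1 R @^-1` V) (fun z => ext_map g (f (Some z)) S)
    (fun z => \sum_T m S T * derive1 (c1 f T : C^o -> C^o) z).
  have h1 T : hol (@chart1 R @^-1` V) (fun z => m S T * f (Some z) T)
      (fun z => m S T * derive1 (c1 f T : C^o -> C^o) z).
    have [f' hf'] := c1_hol T hf.
    have h2 := holM (hol_cst (@chart1 R @^-1` V) (m S T)) hf'.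
    have e1 z : (@chart1 R @^-1` V) z -> derive1 (c1 f T : C^o -> C^o) z = f' z.
      by move=> Vz; exact: (hol_derive1 hf' Vz).
    apply: (hol_eq' Vo.1 h2) => z Vz; by rewrite e1 // mul0r add0r.
  have := hol_sum xpredT h1.
  by apply: hol_ext => z //; rewrite hm.
split.
  move=> S; apply: O_sec1 => //; last by exists (fun z => \sum_T m S T * derive1 (c1 f T : C^o -> C^o) z); exact: hh.
  by move=> p Vp; rewrite (LE_sec_out hf Vp) ext_map_zero ffun0E.
move=> [z|] Vz //; apply/ffunP => S; rewrite dsec1 hm.
have e := hol_derive1 (hh S) Vz; refine (etrans e _).
by apply: eq_bigr => T _; rewrite dsec1.
Qed.

Lemma conj_der_of g a b : g \in unitmx -> Der2_conj g (der_of a b) =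
  der_of (fun r z => compound_act g (a ^~ z) r) (fun r z => compound_act g (b ^~ z) r).
Proof.
move=> gu; have gh : g *m invmx g = 1%:M by rewrite mulmxV.
have hg : invmx g *m g = 1%:M by rewrite mulVmx.
apply/funext => V; apply/funext => f; apply/funext => p; rewrite /Der2_conj.
set f' := fun x => _.
have K x : ext_map g (f' x) = f x by rewrite /f' ext_map_comp gh ext_map1.
have [[Vo VU hf]|n] := pselect [/\ P1_open V, V `<=` U01 R & LE_sec l V f]; last first.
  (* f and g^-1 f are sections simultaneously, so conjugation respects the default value 0. *)
  have n' : ~ [/\ P1_open V, V `<=` U01 R & LE_sec l V f'].
    move=> [Vo VU hf']; apply: n; split; [exact: Vo|exact: VU|].
    have [h _] := LE_ext_map g Vo (subset_trans VU (@U01_U1 R)) hf'.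
    have <- : (fun p => ext_map g (f' p)) = f by apply/funext => x; exact: K.
    exact: h.
  rewrite /der_of (mkD_not _ _ n) (mkD_not _ _ n'); exact: ext_map_zero.
have [hf' df'] := LE_ext_map (invmx g) Vo (subset_trans VU (@U01_U1 R)) hf.
have [Vp|Vp] := pselect (V p); last by rewrite /der_of (mkD_out _ _ _ _ _ Vp) (mkD_out _ _ _ _ _ Vp) ext_map_zero.
rewrite /der_of (mkD_in _ _ Vo VU hf' Vp) (mkD_in _ _ Vo VU hf Vp) (df' _ Vp).
rewrite (ext_map_dform _ _ _ _ gh).
by case: p Vp => [z|] Vp //; have /U01N := VU _ Vp.
Qed.

Lemma compound_act_hole g (a : 'I_3 -> C -> C) (W : set C) : (forall r, hole W (a r)) ->
  forall r, hole W (fun z => compound_act g (a ^~ z) r).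
Proof.
move=> ha r; have E z : compound_act g (a ^~ z) r =
    compound g r i0 * a i0 z + (compound g r i1 * a i1 z + compound g r i2 * a i2 z) by rewrite /compound_act sum_ord3.
have [f' hf'] : hole W (fun z => compound g r i0 * a i0 z + (compound g r i1 * a i1 z + compound g r i2 * a i2 z)).
  by apply: holeD; [|apply: holeD]; apply: holeZ; exact: ha.
by exists f'; apply: hol_ext hf' => z //; rewrite E.
Qed.

Lemma compound_actD g u v r : compound_act g (fun s => u s + v s) r = compound_act g u r + compound_act g v r.
Proof. by rewrite /compound_act -big_split; apply: eq_bigr => s _; rewrite mulrDr. Qed.

Lemma compound_actN g u r : compound_act g (fun s => - u s) r = - compound_act g u r.
Proof. by rewrite /compound_act -sumrN; apply: eq_bigr => s _; rewrite mulrN. Qed.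

Lemma UE_unit g : UE l g -> g \in unitmx.
Proof. by move=> [gU _]; exact: unitarymx_unit. Qed.

(** A non-zero product g_ac g_bd forces l_a = l_c and l_b = l_d, hence equal pair degrees. *)
Lemma compound_block g : (forall i j, l i != l j -> g i j = 0) -> forall r s, kk r != kk s -> compound g r s = 0.
Proof.
move=> gl r s; rewrite mxE /minor /pair_deg.
move: (pair_of r).1 (pair_of r).2 (pair_of s).1 (pair_of s).2 => a b c d.
move=> n.
have h1 : g a c * g b d = 0.
  have [e1|/gl->] := eqVneq (l a) (l c); last by rewrite mul0r.
  have [e2|/gl->] := eqVneq (l b) (l d); last by rewrite mulr0.
  by rewrite e1 e2 eqxx in n.
have h2 : g a d * g b c = 0.
  have [e1|/gl->] := eqVneq (l a) (l d); last by rewrite mul0r.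
  have [e2|/gl->] := eqVneq (l b) (l c); last by rewrite mulr0.
  by rewrite e1 e2 addrC eqxx in n.
by rewrite h1 ?h2 ?subr0 // mulrC h2 subr0.
Qed.

(* With t k = z ^ k this says that conjugation commutes with the change of chart. *)
Lemma compound_act_block g (t : int -> C) u r : UE l g ->
  compound_act g (fun s => t (kk s) * u s) r = t (kk r) * compound_act g u r.
Proof.
move=> gU; rewrite /compound_act mulr_sumr; apply: eq_bigr => s _.
have [<-|/(compound_block gU.2)->] := eqVneq (kk r) (kk s); last by rewrite !mul0r mulr0.
by rewrite mulrCA.
Qed.

Lemma cobdP D : cobd l D <-> exists alpha beta a b : 'I_3 -> C -> C,
  [/\ forall r, hole setT (alpha r), forall r, hole setT (beta r),
     forall r, hole setT (a r), forall r, hole setT (b r) &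
   D = der_of (fun r z => a_inf l alpha r z + a r z) (fun r z => b_inf l alpha beta r z + b r z)].
Proof.
split=> [[A [B [hA hB ->]]]|[al [be [a [b [h1 h2 h3 h4 ->]]]]]]; last first.
  have [A hA eA] := cobd0 l h1 h2; have [B hB eB] := cobd1 l h3 h4.
  by exists A, B; split; [exact: hA|exact: hB|rewrite eA eB der_ofD].
have [al [be [h1 h2 ea eb]]] := coefs_res0 hA.
have ha1 r := z_coef_res1 r hB; have hb1 r := e_coef_res1 r hB.
have ha2 r : exists a, hole setT a /\ forall z, z != 0 -> z_coef (resD B) r z = a z.
  by have [a ? ?] := ha1 r; exists a.
have hb2 r : exists a, hole setT a /\ forall z, z != 0 -> e_coef (resD B) r z = a z.
  by have [a ? ?] := hb1 r; exists a.
have [a h3] := choice ha2; have [b h4] := choice hb2.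
exists al, be, a, b; split; [exact: h1|exact: h2|by move=> r; have [] := h3 r|by move=> r; have [] := h4 r|].
rewrite (representation (Der2_res (@U01_U0 R) hA)) (representation (Der2_res (@U01_U1 R) hB)) -der_ofD.
apply: der_of_ext => r z z0.
  by rewrite ea // (h3 r).2.
by rewrite eb // (h4 r).2.
Qed.

(** This makes conjugation descend to cohomology: acting on alpha, beta, a and b by the second
    compound commutes with the powers of z in [a_inf] and [b_inf], which are constant on blocks. *)
Lemma conj_cobd g D : UE l g -> cobd l D -> cobd l (Der2_conj g D).
Proof.
move=> gU /cobdP[al [be [a [b [h1 h2 h3 h4 ->]]]]]; apply/cobdP.
exists (fun r z => compound_act g (al ^~ z) r), (fun r z => compound_act g (be ^~ z) r).
exists (fun r z => compound_act g (a ^~ z) r), (fun r z => compound_act g (b ^~ z) r).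
split; [exact: (compound_act_hole g h1)|exact: (compound_act_hole g h2)|exact: (compound_act_hole g h3)|exact: (compound_act_hole g h4)|].
rewrite (conj_der_of _ _ (UE_unit gU)); apply: der_of_ext => r z z0; rewrite compound_actD; congr (_ + _).
  rewrite /a_inf compound_actN; congr (- _).
  exact: (compound_act_block (fun k => z ^ (k + 2)) (al ^~ z^-1) r gU).
rewrite /b_inf (compound_act_block (fun k => z ^ k) _ r gU); congr (_ * _); rewrite compound_actD; congr (_ + _).
rewrite (compound_act_block (fun k => (total_deg l - k)%:~R) _ r gU); congr (_ * _).
exact: (compound_act_block (fun=> z) _ r gU).
Qed.

Definition compound_mul g P : 'cV[{poly C}]_3 := map_mx polyC (compound g) *m P.

Lemma cz_compound_mul g P r z : cz (compound_mul g P) r z = compound_act g (cz P ^~ z) r.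
Proof.
rewrite /cz /pz /compound_mul /compound_act mxE horner_sum; apply: eq_bigr => s _.
by rewrite !mxE hornerCM.
Qed.

Lemma vtails_compound_mul e g P : UE l g -> vtails l e P -> vtails l e (compound_mul g P).
Proof.
move=> gU hP r; rewrite /compound_mul mxE.
elim/big_rec: _ => [|s p _ hp]; first exact: tail_poly0.
rewrite [map_mx _ _ _ _]mxE mul_polyC.
have [E|/(compound_block gU.2)->] := eqVneq (kk r) (kk s); last by rewrite scale0r add0r.
by apply: tail_poly_lin (hp); rewrite E; exact: hP.
Qed.

(** [UE_act] is a relation defined through some representative; [conj_cobd] shows that the choice
    does not matter. *)
Lemma UE_actP g P Q (y : H) : UE l g ->
  UE_act g (Theta l P Q) y <-> y = Theta l (compound_mul g P) (compound_mul g Q).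
Proof.
move=> gU; have gu := UE_unit gU.
have E P' Q' : Der2_conj g (der_of (cz P') (cz Q')) = der_of (cz (compound_mul g P')) (cz (compound_mul g Q')).
  by rewrite conj_der_of //; apply: der_of_ext => r z _; rewrite cz_compound_mul.
split=> [[D [hD hy]]|->]; last first.
  exists (der_of (cz P) (cz Q)); split; first exact: Theta_rep.
  by rewrite E; exact: Theta_rep.
apply/(rep_eq hy (Theta_rep l (compound_mul g P) (compound_mul g Q))); rewrite cob_cobd.
have := (rep_eq hD (Theta_rep l P Q)).1 erefl; rewrite cob_cobd.
move: (rep_sec hD) => hS; rewrite (representation hS).
move: (z_coef D) (e_coef D) => a b; rewrite -der_ofB => /(conj_cobd gU).
rewrite !conj_der_of // -der_ofB; congr cobd; apply: der_of_ext => r z _.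
  by rewrite cz_compound_mul compound_actD compound_actN.
by rewrite cz_compound_mul compound_actD compound_actN.
Qed.

End Conjugation.

(** * The second compound of a 3 x 3 matrix *)

Section SecondCompound.
Variable R : realType.
Local Notation C := R[i].
Implicit Types (g h B : 'M[C]_3).
Local Open Scope sesquilinear_scope.

Lemma compoundM g h : compound (g *m h) = compound g *m compound h.
Proof.
apply/matrixP => r s; rewrite mulmx3 !mxE minorM pair_of0 pair_of1 pair_of2 /=; ring.
Qed.

Lemma compound1 : compound (1%:M : 'M[C]_3) = 1%:M.
Proof.
apply/matrixP; apply: ord3_ind => [||]; apply: ord3_ind => [||];
  rewrite !mxE ?pair_of0 ?pair_of1 ?pair_of2 /minor !mxE /=; ring.
Qed.

Lemma compoundZ (c : C) g : compound (c *: g) = c ^+ 2 *: compound g.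
Proof. by apply/matrixP => r s; rewrite !mxE /minor !mxE; ring. Qed.

Lemma compound_tr g : compound (g ^t*) = (compound g) ^t*.
Proof. by apply/matrixP => r s; rewrite !mxE /minor !mxE rmorphB !rmorphM; ring. Qed.

(* The scalar is det g: up to it, the second compound is an involution. *)
Lemma compound_compound g : exists d, compound (compound g) = d *: g.
Proof.
exists (g i0 i0 * minor g i1 i2 i1 i2 - g i1 i0 * minor g i0 i2 i1 i2 + g i2 i0 * minor g i0 i1 i1 i2).
apply/matrixP; apply: ord3_ind => [||]; apply: ord3_ind => [||];
  rewrite !mxE ?pair_of0 ?pair_of1 ?pair_of2 {1}/minor !mxE ?pair_of0 ?pair_of1 ?pair_of2 /minor /=;
  move: (g i0 i0) (g i0 i1) (g i0 i2) (g i1 i0) (g i1 i1) (g i1 i2) (g i2 i0) (g i2 i1) (g i2 i2) =>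
    x0 x1 x2 y0 y1 y2 z0 z1 z2; ring.
Qed.

Lemma compound_unitary g : g \is unitarymx -> compound g \is unitarymx.
Proof. by move=> /unitarymxP h; apply/unitarymxP; rewrite -compound_tr -compoundM h compound1. Qed.

Lemma scale_unitary n (c : C) (A : 'M[C]_n.+1) : A \is unitarymx ->
  (c *: A \is unitarymx) = (c * c^* == 1).
Proof.
move=> /unitarymxP hA; have E : (c *: A) *m (c *: A) ^t* = (c * c^*) *: 1%:M.
  by rewrite linearZ /= map_mxZ -scalemxAl -scalemxAr hA scalerA.
apply/unitarymxP/eqP; rewrite E; last by move=> ->; rewrite scale1r.
by move=> /matrixP/(_ ord0 ord0); rewrite !mxE mulr1.
Qed.

Lemma compound_surj B : B \is unitarymx -> exists2 c, c *: compound B \is unitarymx & compound (c *: compound B) = B.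
Proof.
move=> BU; have [d hd] := compound_compound B.
have : d *: B \is unitarymx by rewrite -hd; do 2 apply: compound_unitary.
rewrite scale_unitary // => /eqP dd.
have d0 : d != 0 by apply: contra_eq_neq dd => ->; rewrite mul0r eq_sym oner_eq0.
(* The compound is quadratic in scalars, so c times the compound of B is sent to c^2 d B = B. *)
pose c := sqrtC d^-1; exists c; last first.
  by rewrite compoundZ hd scalerA sqrtCK mulVf // scale1r.
rewrite scale_unitary ?compound_unitary //.
(* |c|^4 = 1 because |d| = 1; as |c|^2 >= 0, it equals 1. *)
have c2 : (c * c^*) ^+ 2 = 1.
  by rewrite exprMn -rmorphXn sqrtCK fmorphV -invfM dd invr1.
have c_ge0 : 0 <= c * c^* by rewrite -normCK exprn_ge0.
by move/eqP: c2; rewrite -[X in _ == X](expr1n _ 2) eqrXn2 ?ler01.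
Qed.

Variable l : 'I_3 -> int.

Definition unitary_blocks n (kappa : 'I_n -> int) : set 'M[C]_n :=
  [set B | B \is unitarymx /\ forall r s, kappa r != kappa s -> B r s = 0].

(** The two pairs numbered by [pair_of r] share exactly the index r, which is counted twice in the
    sum. *)
Lemma pair_deg_pair_deg r : pair_deg (pair_deg l) r = total_deg l + l r.
Proof.
have E s : pair_deg (pair_deg l) s = pair_deg l (pair_of s).1 + pair_deg l (pair_of s).2 by [].
have [E0 E1 E2] : [/\ pair_deg l i0 = l i0 + l i1, pair_deg l i1 = l i0 + l i2 & pair_deg l i2 = l i1 + l i2].
  by rewrite /pair_deg pair_of0 pair_of1 pair_of2.
move: r; apply: ord3_ind; rewrite E ?pair_of0 ?pair_of1 ?pair_of2 ?E0 ?E1 ?E2 /total_deg; lia.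
Qed.

(** For surjectivity the preimage is a multiple of the compound of B; it is block diagonal for
    [pair_deg (pair_deg l)], which differs from l by a constant. *)
Lemma compound_UE : [set compound g | g in @UE R l] = unitary_blocks (pair_deg l).
Proof.
apply/seteqP; split=> [_ [g [gU gl] <-]|B [BUn Bl]].
  by split; [exact: compound_unitary|exact: (compound_block gl)].
have [c cU E] := compound_surj BUn; exists (c *: compound B) => //; split=> // i j ij.
rewrite mxE (compound_block Bl) ?mulr0 //.
by rewrite !pair_deg_pair_deg (inj_eq (addrI _)).
Qed.

Lemma UE_tr g : UE l g -> UE l (g ^t*).
Proof.
move=> [gU gl]; split; first by rewrite trmxC_unitary.
by move=> i j ij; rewrite !mxE gl ?rmorph0 // eq_sym.
Qed.

Lemma compound_mulK g P : UE l g -> compound_mul g (compound_mul (g ^t*) P) = P.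
Proof.
move=> [/unitarymxP gU _]; rewrite /compound_mul mulmxA -map_mxM -compoundM gU compound1.
by rewrite map_mx1 mul1mx.
Qed.

End SecondCompound.

(** * Invariant metrics and the splitting *)

Section Metric.
Variables (R : realType) (l : 'I_3 -> int).
Local Notation C := R[i].
Local Notation kk := (pair_deg l).
Local Notation H := (H1 (Der2_sheaf R l)).
Hypothesis kk_lt : forall r, kk r + 2 < 0.
Implicit Types (P Q : 'cV[{poly C}]_3) (g : 'M[C]_3) (x y : H).
Local Open Scope sesquilinear_scope.

(** A crude common bound for the sizes of all tails, so that one finite range of coefficients serves
    P and Q alike. *)
Definition coef_bound : nat := \sum_r absz (kk r).
Local Notation M := coef_bound.

Lemma vtails_size e P r : 0 <= e <= 2 -> vtails l e P -> (size (P r ord0) <= M)%N.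
Proof.
move=> /andP[e0 e2] hP; have k0 := kk_lt r; pose N := absz (- (kk r + e) - 1).
have nN : - (kk r + e) - 2 + 1 = N%:Z by rewrite /N; lia.
have [_ sp] := (tail_polyP _ nN).1 (hP r); apply: (leq_trans sp).
by rewrite /M (bigD1 r) //=; apply: leq_trans (leq_addr _ _); rewrite /N; lia.
Qed.

Lemma coords_ex x : exists PQ : 'cV[{poly C}]_3 * 'cV[{poly C}]_3,
  [/\ vtails l 2 PQ.1, vtails l 0 PQ.2 & x = Theta l PQ.1 PQ.2].
Proof. by have [P [Q h]] := Theta_surj kk_lt x; exists (P, Q). Qed.

Definition coords x := projT1 (cid (coords_ex x)).

Lemma coordsP x : [/\ vtails l 2 (coords x).1, vtails l 0 (coords x).2 & x = Theta l (coords x).1 (coords x).2].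
Proof. exact: projT2 (cid (coords_ex x)). Qed.

Lemma coords_Theta P Q : vtails l 2 P -> vtails l 0 Q -> coords (Theta l P Q) = (P, Q).
Proof.
move=> hP hQ; have [h1 h2 h3] := coordsP (Theta l P Q).
have [e1 e2] := Theta_inj kk_lt hP hQ h1 h2 h3.
by rewrite [LHS]surjective_pairing -e1 -e2.
Qed.

Lemma coords_lin a x y : coords (a *: x + y) =
  (a%:P *: (coords x).1 + (coords y).1, a%:P *: (coords x).2 + (coords y).2).
Proof.
have [h1 h2 h3] := coordsP x; have [h4 h5 h6] := coordsP y.
rewrite {1}h3 {1}h6 -Theta_lin coords_Theta //; exact: vtails_lin.
Qed.

Definition coef_form P Q : C := \sum_(i < M) \sum_r (P r ord0)`_i * Num.conj (Q r ord0)`_i.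

Lemma coef_form_lin a P P' Q : coef_form (a%:P *: P + P') Q = a * coef_form P Q + coef_form P' Q.
Proof.
rewrite /coef_form mulr_sumr -big_split; apply: eq_bigr => i _ /=.
rewrite mulr_sumr -big_split; apply: eq_bigr => r _ /=.
by rewrite !mxE coefD coefCM mulrDl mulrA.
Qed.

Lemma coef_form_conj P Q : coef_form Q P = Num.conj (coef_form P Q).
Proof.
rewrite /coef_form rmorph_sum; apply: eq_bigr => i _; rewrite rmorph_sum; apply: eq_bigr => r _ /=.
by rewrite rmorphM /= conjCK mulrC.
Qed.

Lemma coef_form_ge0 P : 0 <= coef_form P P.
Proof.
by apply: sumr_ge0 => i _; apply: sumr_ge0 => r _; rewrite -normCK exprn_ge0.
Qed.

Lemma coef_form_eq0 e P : 0 <= e <= 2 -> vtails l e P -> coef_form P P = 0 -> P = 0.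
Proof.
move=> he hP /eqP; rewrite psumr_eq0; last first.
  by move=> i _; apply: sumr_ge0 => r _; rewrite -normCK exprn_ge0.
move=> /allP h; apply/matrixP => r c; rewrite ord1 mxE; apply/polyP => i.
rewrite coef0; have [iM|iM] := ltnP i M; last first.
  by rewrite nth_default //; apply: leq_trans iM; exact: vtails_size he hP.
have := h (Ordinal iM) (mem_index_enum _); rewrite implyTb psumr_eq0; last first.
  by move=> s _; rewrite -normCK exprn_ge0.
move=> /allP/(_ r (mem_index_enum _)); rewrite implyTb -normCK sqrf_eq0 normr_eq0.
by move/eqP.
Qed.

(** For each exponent the vector of coefficients is multiplied by the compound of g, a unitary
    matrix. *)
Lemma coef_form_compound g P Q : UE l g -> coef_form (compound_mul g P) (compound_mul g Q) = coef_form P Q.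
Proof.
move=> [/compound_unitary/unitarymxP/mulmx1C gU _].
pose v (X : 'cV[{poly C}]_3) i : 'cV[C]_3 := \col_r (X r ord0)`_i.
have E (X Y : 'cV[{poly C}]_3) i : \sum_r (X r ord0)`_i * Num.conj (Y r ord0)`_i = ((v Y i) ^t* *m v X i) ord0 ord0.
  by rewrite mxE; apply: eq_bigr => r _; rewrite !mxE mulrC.
have V (X : 'cV[{poly C}]_3) i : v (compound_mul g X) i = compound g *m v X i.
  apply/matrixP => r c; rewrite !mxE coef_sum; apply: eq_bigr => s _.
  by rewrite [map_mx _ _ _ _]mxE coefCM [v _ _ _ _]mxE.
rewrite /coef_form; apply: eq_bigr => i _; rewrite !E !V trmx_mul map_mxM.
by rewrite -mulmxA [_ *m (compound g *m _)]mulmxA gU mul1mx.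
Qed.

Lemma Theta0 : Theta l 0 0 = 0 :> H.
Proof.
have e : (-1)%:P *: 0 + 0 = 0 :> 'cV[{poly C}]_3 by rewrite scaler0 addr0.
by have := @Theta_lin R l (-1) 0 0 0 0; rewrite e scaleN1r addNr.
Qed.

Definition std_metric x y : C := coef_form (coords x).1 (coords y).1 + coef_form (coords x).2 (coords y).2.

Lemma std_metricP : invariant_metric std_metric.
Proof.
split.
- by move=> a x x' y; rewrite /std_metric coords_lin !coef_form_lin mulrDr addrACA.
- by move=> x y; rewrite /std_metric coef_form_conj [X in _ + X]coef_form_conj rmorphD.
- move=> x x0; have [h1 h2 h3] := coordsP x; rewrite lt0r addr_ge0 ?coef_form_ge0 // andbT.
  rewrite paddr_eq0 ?coef_form_ge0 //; apply: contra x0 => /andP[/eqP e1 /eqP e2].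
  by rewrite h3 (coef_form_eq0 _ h1 e1) // (coef_form_eq0 _ h2 e2) // Theta0.
- move=> g x y x' y' gU; have [h1 h2 h3] := coordsP x; have [h4 h5 h6] := coordsP y.
  rewrite {1}h3 {1}h6 => /(UE_actP _ _ _ gU)-> /(UE_actP _ _ _ gU)->.
  by rewrite /std_metric !coords_Theta ?coef_form_compound //; exact: vtails_compound_mul.
Qed.

End Metric.

(** * Orthogonal projection to a finitely spanned subspace *)

Section OrthogonalProjection.
Variables (K : numClosedFieldType) (V : lmodType K) (h : V -> V -> K).
Hypothesis h_lin : forall a x x' y, h (a *: x + x') y = a * h x y + h x' y.
Hypothesis h_conj : forall x y, h y x = Num.conj (h x y).
Hypothesis h_pos : forall x, x != 0 -> 0 < h x x.

Lemma form0l y : h 0 y = 0.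
Proof. by have := h_lin (-1) 0 0 y; rewrite scaler0 addr0 mulN1r addNr. Qed.

Lemma form_linr a x y y' : h x (a *: y + y') = Num.conj a * h x y + h x y'.
Proof. by rewrite h_conj h_lin rmorphD rmorphM /= -!h_conj. Qed.

Lemma form0r x : h x 0 = 0.
Proof. by rewrite h_conj form0l rmorph0. Qed.

Lemma formBl x y z : h (x - y) z = h x z - h y z.
Proof. by rewrite addrC -scaleN1r h_lin mulN1r addrC. Qed.

Lemma form_eq0 x : h x x = 0 -> x = 0.
Proof. by move=> e; have [//|/h_pos] := eqVneq x 0; rewrite e ltxx. Qed.

Fixpoint spanl (s : seq V) : set V :=
  if s is e :: s' then [set v | exists a w, spanl s' w /\ v = a *: e + w] else [set 0].

Lemma spanl0 s : spanl s 0.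
Proof.
by elim: s => [//|e s IH] /=; exists 0, 0; split=> //; rewrite scale0r addr0.
Qed.

Lemma spanl_lin s a x y : spanl s x -> spanl s y -> spanl s (a *: x + y).
Proof.
elim: s x y => [|e s IH] x y /=; first by move=> -> ->; rewrite scaler0 addr0.
move=> [b [w [hw ->]]] [c [w' [hw' ->]]]; exists (a * b + c), (a *: w + w').
by split; [exact: IH|rewrite scalerDr scalerA addrACA scalerDl].
Qed.

(** Induction on a list whose span contains W, not on a basis of W: a new vector e enlarges the
    intersection of W with the span by at most one dimension, and one Gram-Schmidt step treats
    it. *)
Lemma orthogonal_projection s (W : set V) : W 0 ->
  (forall a x y, W x -> W y -> W (a *: x + y)) -> W `<=` spanl s ->
  forall x, exists2 v, W v & forall u, W u -> h (x - v) u = 0.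
Proof.
elim: s W => [|e s IH] W W0 Wlin Ws x.
  by exists 0 => // u /Ws /= ->; rewrite form0r.
have [Ws'|/existsNP[v0 /not_implyP[Wv0 nv0]]] := pselect (W `<=` spanl s).
  exact: IH.
pose W' := W `&` spanl s.
have W'lin a y z : W' y -> W' z -> W' (a *: y + z).
  by move=> [? ?] [? ?]; split; [exact: Wlin|exact: spanl_lin].
have {}IH := IH W' (conj W0 (spanl0 s)) W'lin (@subIsetr _ _ _).
have [p0 [Wp0 sp0] hp0] := IH v0; have [px [Wpx _] hpx] := IH x.
(* f is orthogonal to W' and spans W together with W'; v0 is an element of W outside the span of
   s. *)
pose f := v0 - p0; have fE : f = (-1) *: p0 + v0 by rewrite scaleN1r addrC.
have Wf : W f by rewrite fE; exact: Wlin.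
have f0 : f != 0.
  apply/eqP => /eqP; rewrite subr_eq0 => /eqP e0; apply: nv0; rewrite e0; exact: sp0.
have hf0 : h f f != 0 by rewrite gt_eqF // h_pos.
pose t := h (x - px) f / h f f.
exists (t *: f + px); first exact: Wlin.
move=> u Wu; have [b [w [sw uE]]] := Ws _ Wu; have [a [w0 [sw0 vE]]] := Ws _ Wv0.
have a0 : a != 0.
  by apply/eqP => a0; apply: nv0; rewrite vE a0 scale0r add0r.
(* b and a are the coefficients of u and v0 at e, so u - k f has none and falls into W'. *)
pose k := b / a.
have W'u : W' (u - k *: f).
  split; first by rewrite addrC -scaleNr; exact: Wlin.
  rewrite /f uE vE /k.
  have -> : b *: e + w - (b / a) *: (a *: e + w0 - p0) = (b / a) *: ((-1) *: w0 + p0) + w.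
    have -> : b *: e = (b / a) *: (a *: e) by rewrite scalerA divfK.
    apply: (addIr ((b / a) *: (a *: e + w0 - p0))); rewrite subrK addrAC -scalerDr.
    congr (_ *: _ + _).
    by rewrite scaleN1r [- w0 + p0]addrC [RHS]addrC addrA subrK addrK.
  by apply: spanl_lin sw; exact: spanl_lin.
have -> : u = k *: f + (u - k *: f) by rewrite addrC subrK.
have -> : x - (t *: f + px) = (- t) *: f + (x - px).
  by rewrite scaleNr opprD addrCA.
have hf u' : W' u' -> h f u' = 0 by exact: hp0.
rewrite form_linr !h_lin (hpx _ W'u) (hf _ W'u) mulr0 addr0 /t mulNr divfK //.
by rewrite addNr mulr0 addr0.
Qed.

End OrthogonalProjection.

Section Splitting.
Variables (R : realType) (l : 'I_3 -> int).
Local Notation C := R[i].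
Local Notation kk := (pair_deg l).
Local Notation H := (H1 (Der2_sheaf R l)).
Hypothesis kk_lt : forall r, kk r + 2 < 0.
Implicit Types (P Q S : 'cV[{poly C}]_3) (g : 'M[C]_3) (x y : H).
Local Open Scope sesquilinear_scope.
Local Notation Theta := (Theta l).
Local Notation vtails := (vtails l).

Lemma vertical0 : H1_vertical (0 : H).
Proof. by apply/(H1_verticalP kk_lt); exists 0; [exact: vtails0|rewrite Theta0]. Qed.

Lemma Theta_vlin a Q Q' : Theta 0 (a%:P *: Q + Q') = a *: Theta 0 Q + Theta 0 Q' :> H.
Proof.
have e : a%:P *: 0 + 0 = 0 :> 'cV[{poly C}]_3 by rewrite scaler0 addr0.
by rewrite -Theta_lin e.
Qed.

Lemma vertical_lin a x y : H1_vertical x -> H1_vertical y -> H1_vertical (a *: x + y).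
Proof.
move=> /(H1_verticalP kk_lt)[Q hQ ->] /(H1_verticalP kk_lt)[Q' hQ' ->].
apply/(H1_verticalP kk_lt); exists (a%:P *: Q + Q'); first exact: vtails_lin.
by rewrite Theta_vlin.
Qed.

(** All monomials below [coef_bound] are listed, including some that are not tails; only the
    inclusion in their span matters. *)
Lemma vertical_span : exists s : seq H, @H1_vertical R l `<=` spanl s.
Proof.
pose M := coef_bound l.
pose m (p : 'I_3 * 'I_M) : 'cV[{poly C}]_3 := 'X^(p.2) *: delta_mx p.1 ord0.
exists [seq Theta 0 (m p) | p <- enum {: 'I_3 * 'I_M}] => x /(H1_verticalP kk_lt)[Q hQ ->].
have E : Q = \sum_(p <- enum {: 'I_3 * 'I_M}) ((Q p.1 ord0)`_p.2)%:P *: m p.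
  rewrite big_enum /= -(pair_bigA _ (fun (r : 'I_3) (i : 'I_M) => ((Q r ord0)`_i)%:P *: m (r, i))) /=.
  apply/matrixP => r c; rewrite ord1 summxE (bigD1 r) //= [X in _ + X]big1 ?addr0; last first.
    move=> s sr; rewrite summxE big1 // => i _.
    by rewrite !mxE eq_sym (negbTE sr) /= !mulr0.
  rewrite summxE; have sQ := vtails_size kk_lt r (isT : 0 <= (0 : int) <= 2) hQ.
  apply/polyP => i; rewrite coef_sum; have [iM|iM] := ltnP i M; last first.
    rewrite nth_default ?(leq_trans sQ) // big1 // => j _.
    rewrite !mxE !eqxx mulr1 coefCM coefXn; case: eqP => [e|_]; last by rewrite mulr0.
    by move: (ltn_ord j); rewrite -e ltnNge iM.
  rewrite (bigD1 (Ordinal iM)) //= big1 ?addr0; last first.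
    move=> j ji; rewrite !mxE !eqxx mulr1 coefCM coefXn; case: eqP => [e|_]; last by rewrite mulr0.
    by case/eqP: ji; apply: val_inj.
  by rewrite !mxE !eqxx mulr1 coefCM coefXn eqxx mulr1.
rewrite {1}E; elim: (enum _) => [|p s IH]; first by rewrite big_nil Theta0.
by rewrite big_cons Theta_vlin /=; eexists; eexists; split; first exact: IH.
Qed.

Variable h : H -> H -> C.
Hypothesis hh : invariant_metric h.

Let h_lin : forall (a : C) x x' y, h (a *: x + x') y = a * h x y + h x' y.
Proof. by case: hh. Qed.
Let h_conj : forall x y, h y x = Num.conj (h x y).
Proof. by case: hh. Qed.
Let h_pos : forall x, x != 0 -> 0 < h x x.
Proof. by case: hh. Qed.

(* Theta P S is the lift of P to the orthogonal complement of the vertical classes *)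
Definition horizontal P S := vtails 0 S /\ forall v, H1_vertical v -> h (Theta P S) v = 0.

Lemma horizontal_ex P : exists S, horizontal P S.
Proof.
have [s hs] := vertical_span.
have [v /(H1_verticalP kk_lt)[Q hQ vE] hv] :=
  orthogonal_projection h_lin h_conj h_pos vertical0 vertical_lin hs (Theta P 0).
(* Theta 0 Q is the projection of Theta P 0 to the vertical classes, so the lift has S = - Q. *)
exists ((-1)%:P *: Q + 0); split; first by apply: vtails_lin => //; exact: vtails0.
move=> u hu; rewrite -(hv u hu) vE; congr h.
have e : (-1)%:P *: 0 + P = P by rewrite scaler0 add0r.
by rewrite -{1}e Theta_lin scaleN1r addrC.
Qed.

(** The difference of two lifts of P is vertical and orthogonal to all vertical classes, itself
    included. *)
Lemma horizontal_uniq P S S' : horizontal P S -> horizontal P S' -> S = S'.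
Proof.
move=> [hS hS1] [hS' hS1'].
have e : (-1)%:P *: P + P = 0 by rewrite polyCN scaleN1r addNr.
have E : Theta 0 ((-1)%:P *: S' + S) = Theta P S - Theta P S' :> H.
  by rewrite -{1}e Theta_lin scaleN1r addrC.
have tS := vtails_lin (-1) hS' hS.
have V : H1_vertical (Theta 0 ((-1)%:P *: S' + S) : H).
  by apply/(H1_verticalP kk_lt); exists ((-1)%:P *: S' + S).
have h0 : h (Theta 0 ((-1)%:P *: S' + S)) (Theta 0 ((-1)%:P *: S' + S)) = 0.
  by rewrite {1}E (formBl h_lin) hS1 // hS1' // subr0.
have := form_eq0 h_pos h0; rewrite -(Theta0 R l) => T0.
have [_ e2] := Theta_inj kk_lt (vtails0 _ _ 2) tS (vtails0 _ _ 2) (vtails0 _ _ 0) T0.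
by apply/eqP; rewrite -subr_eq0 addrC -scaleN1r -polyCN; apply/eqP.
Qed.

Lemma horizontal_lin a P P' S S' : horizontal P S -> horizontal P' S' ->
  horizontal (a%:P *: P + P') (a%:P *: S + S').
Proof.
move=> [h1 h2] [h3 h4]; split; first exact: vtails_lin.
by move=> v hv; rewrite Theta_lin h_lin h2 // h4 // mulr0 addr0.
Qed.

Lemma horizontal_compound_mul g P S : UE l g -> horizontal P S -> horizontal (compound_mul g P) (compound_mul g S).
Proof.
move=> gU [hS hS1]; split; first exact: vtails_compound_mul.
move=> v /(H1_verticalP kk_lt)[Q hQ ->].
have gU' := UE_tr gU; have hQ' := vtails_compound_mul gU' hQ.
(* Invariance moves g from the lift to the vertical class, where it becomes the adjoint g^*;
   vertical classes are stable under it. *)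
have <- : h (Theta P S) (Theta 0 (compound_mul (g ^t*) Q)) = h (Theta (compound_mul g P) (compound_mul g S)) (Theta 0 Q).
  have [_ _ _ hinv] := hh; symmetry; apply: (hinv g) => //.
    exact/(UE_actP _ _ _ gU).
  by apply/(UE_actP _ _ _ gU); rewrite (compound_mulK _ gU) /compound_mul mulmx0.
by apply: hS1; apply/(H1_verticalP kk_lt); exists (compound_mul (g ^t*) Q).
Qed.

Definition hor_lift P := projT1 (cid (horizontal_ex P)).
Lemma hor_liftP P : horizontal P (hor_lift P). Proof. exact: projT2 (cid (horizontal_ex P)). Qed.

Lemma hor_lift_lin a P P' : hor_lift (a%:P *: P + P') = a%:P *: hor_lift P + hor_lift P'.
Proof. exact: horizontal_uniq (hor_liftP _) (horizontal_lin a (hor_liftP P) (hor_liftP P')). Qed.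

Lemma hor_lift_compound_mul g P : UE l g -> hor_lift (compound_mul g P) = compound_mul g (hor_lift P).
Proof. by move=> gU; exact: horizontal_uniq (hor_liftP _) (horizontal_compound_mul gU (hor_liftP P)). Qed.

End Splitting.

Section Recombination.
Variables (R : realType) (l : 'I_3 -> int).
Local Notation C := R[i].
Local Notation kk := (pair_deg l).
Local Notation H := (H1 (Der2_sheaf R l)).
Hypothesis kk_lt : forall r, kk r + 2 < 0.
Implicit Types (P Q S v : 'cV[{poly C}]_3) (g : 'M[C]_3) (x y : H).
Local Notation Theta := (Theta l).
Local Notation vtails := (vtails l).
Local Notation c_ r := (cdeg (l (pair_of r).1) (l (pair_of r).2)).
Local Notation d_ r := (ddeg (l (pair_of r).1) (l (pair_of r).2)).

(** This is c + 1 itself: every pair degree is at most -3, so c >= -1. *)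
Definition shift_exp r : nat := absz (c_ r + 1).

Lemma pair_deg_shift_exp r : kk r = - (shift_exp r + 3)%:Z.
Proof. by have := kk_lt r; rewrite /shift_exp /cdeg /pair_deg; lia. Qed.

(** In 1/z, P occupies the exponents 1, ..., c + 1 and the shifted Q those from c + 2 to c + d + 2,
    so the two do not overlap. *)
Definition comb P Q : 'cV[{poly C}]_3 := \col_r (P r ord0 + 'X^(shift_exp r) * Q r ord0).

Lemma vtails2P P : vtails 2 P <->
  forall r, (P r ord0).[0] = 0 /\ (size (P r ord0) <= (shift_exp r).+1)%N.
Proof.
have E r : - (kk r + 2) - 2 + 1 = (shift_exp r)%:Z by rewrite pair_deg_shift_exp; lia.
by split=> h r; [exact: (tail_polyP _ (E r)).1|exact: (tail_polyP _ (E r)).2].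
Qed.

Lemma vtails0P Q : vtails 0 Q <->
  forall r, (Q r ord0).[0] = 0 /\ (size (Q r ord0) <= (shift_exp r).+3)%N.
Proof.
have E r : - (kk r + 0) - 2 + 1 = (shift_exp r).+2%:Z by rewrite pair_deg_shift_exp; lia.
by split=> h r; [exact: (tail_polyP _ (E r)).1|exact: (tail_polyP _ (E r)).2].
Qed.

Lemma sum_tailP r (p : {poly C}) : tail_poly (c_ r + d_ r + 1) p <->
  p.[0] = 0 /\ (size p <= (shift_exp r + shift_exp r).+3)%N.
Proof.
apply: tail_polyP; have := pair_deg_shift_exp r; rewrite /cdeg /ddeg /pair_deg; lia.
Qed.

Lemma comb_tails P Q r : vtails 2 P -> vtails 0 Q ->
  tail_poly (c_ r + d_ r + 1) (comb P Q r ord0).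
Proof.
move=> /vtails2P/(_ r)[p0 sp] /vtails0P/(_ r)[q0 sq]; apply/sum_tailP; rewrite mxE; split.
  by rewrite hornerD hornerM p0 q0 mulr0 addr0.
apply: (leq_trans (size_polyD _ _)); rewrite geq_max; apply/andP; split.
  by apply: (leq_trans sp); lia.
have [->|Q0] := eqVneq (Q r ord0) 0; first by rewrite mulr0 size_poly0.
rewrite mulrC size_mulXn //; apply: leq_trans (_ : shift_exp r + (shift_exp r).+3 <= _)%N; last by lia.
by rewrite leq_add2l.
Qed.

Lemma comb_surj v : (forall r, tail_poly (c_ r + d_ r + 1) (v r ord0)) ->
  exists P Q, [/\ vtails 2 P, vtails 0 Q & comb P Q = v].
Proof.
move=> hv; exists (\col_r take_poly (shift_exp r).+1 (v r ord0)).
(* The cut is at exponent c + 2, the shift only by c + 1; the missing factor 'X makes the upper part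
   a tail. *)
exists (\col_r ('X * drop_poly (shift_exp r).+1 (v r ord0))); split.
- apply/vtails2P => r; have /sum_tailP[v0 _] := hv r; rewrite mxE; split; last exact: size_take_poly.
  by rewrite horner_coef0 coef_take_poly /= -horner_coef0.
- apply/vtails0P => r; have /sum_tailP[_ sv] := hv r; rewrite mxE; split.
    by rewrite hornerM hornerX mul0r.
  apply: (leq_trans (size_polyMleq _ _)); rewrite size_polyX size_drop_poly /=.
  by move: sv; move: (size _) => s; lia.
apply/matrixP => r c; rewrite [c]ord1 !mxE mulrA -exprSr mulrC.
by rewrite poly_take_drop.
Qed.

Lemma comb_lin a P P' Q Q' :
  comb (a%:P *: P + P') (a%:P *: Q + Q') = a%:P *: comb P Q + comb P' Q'.
Proof. by apply/matrixP => r c; rewrite !mxE; ring. Qed.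

Lemma comb_eq0 P Q : vtails 2 P -> vtails 0 Q -> comb P Q = 0 -> P = 0 /\ Q = 0.
Proof.
move=> /vtails2P hP /vtails0P hQ e.
have E r : P r ord0 + 'X^(shift_exp r) * Q r ord0 = 0.
  by move/matrixP: e => /(_ r ord0); rewrite !mxE.
have P0 r : P r ord0 = 0.
  have [_ sp] := hP r; have [q0 _] := hQ r; apply/polyP => i; rewrite coef0.
  have [i_n|n_i] := leqP i (shift_exp r); last by rewrite nth_default // (leq_trans sp).
  have := congr1 (fun p : {poly C} => p`_i) (E r); rewrite coefD coefXnM coef0.
  case: ltnP => [_|n_i]; first by rewrite addr0.
  (* At this exponent the shifted Q contributes its constant coefficient, which is 0. *)
  have -> : i = shift_exp r by apply/eqP; rewrite eqn_leq i_n.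
  by rewrite subnn -horner_coef0 q0 addr0.
split; apply/matrixP => r c; rewrite [c]ord1 mxE; first exact: P0.
have := E r; rewrite P0 add0r => /eqP; rewrite mulf_eq0 => /orP[|/eqP//].
by rewrite -size_poly_eq0 size_polyXn.
Qed.

(** Inside a block the pair degrees agree, hence so do the shifts. *)
Lemma comb_compound_mul g P Q : UE l g -> comb (compound_mul g P) (compound_mul g Q) = compound_mul g (comb P Q).
Proof.
move=> gU; apply/matrixP => r c; rewrite [c]ord1 /comb /compound_mul !mxE mulr_sumr -big_split.
apply: eq_bigr => s _ /=; rewrite [map_mx _ _ _ _]mxE [X in _ = _ * X]mxE.
have [E|/(compound_block gU.2)->] := eqVneq (kk r) (kk s); last by rewrite polyC0 !mul0r mulr0 addr0.
have -> : shift_exp r = shift_exp s by move: E; rewrite !pair_deg_shift_exp; lia.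
by rewrite mulrDr mulrCA.
Qed.

Lemma scale_shuffle (a b : {poly C}) P P' Q Q' :
  b *: (a *: P + P') + (a *: Q + Q') = a *: (b *: P + Q) + (b *: P' + Q').
Proof. by apply/matrixP => r c; rewrite !mxE; ring. Qed.

Lemma identification h : invariant_metric h -> exists Phi : H -> 'cV[{poly C}]_3,
  is_identification h Phi /\ forall g x y, UE l g -> UE_act g x y -> Phi y = compound_mul g (Phi x).
Proof.
move=> hh; pose S := hor_lift kk_lt hh; pose cx := @coords R l kk_lt.
have hS P : horizontal h P (S P) := hor_liftP kk_lt hh P.
(* Theta P (S P) is the horizontal part of Theta P Q, so its vertical part is Theta 0 (Q - S P). *)
pose Phi x := comb (cx x).1 ((-1)%:P *: S (cx x).1 + (cx x).2).
have tS P Q : vtails 0 Q -> vtails 0 ((-1)%:P *: S P + Q).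
  by move=> hQ; apply: vtails_lin => //; have [] := hS P.
have PhiT P Q : vtails 2 P -> vtails 0 Q -> Phi (Theta P Q) = comb P ((-1)%:P *: S P + Q).
  by move=> hP hQ; rewrite /Phi /cx coords_Theta.
have Phi_lin a x y : Phi (a *: x + y) = a%:P *: Phi x + Phi y.
  rewrite /Phi /cx coords_lin /= /S hor_lift_lin -comb_lin; congr comb.
  exact: scale_shuffle.
exists Phi; split; last first.
  move=> g x y gU; have [h1 h2 {1}->] := coordsP kk_lt x => /(UE_actP _ _ _ gU)->.
  rewrite PhiT; [|exact: vtails_compound_mul|exact: vtails_compound_mul].
  rewrite /S hor_lift_compound_mul // /Phi -comb_compound_mul //; congr comb.
  by rewrite /compound_mul mulmxDr -scalemxAr.
split.
- exact: Phi_lin.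
- move=> x y e; have : Phi ((-1) *: x + y) = 0.
    by rewrite Phi_lin e polyCN scaleN1r addNr.
  have [h1 h2 xE] := coordsP kk_lt ((-1) *: x + y).
  move=> /(comb_eq0 h1 (tS _ _ h2))[e1 e2].
  move: e2; rewrite e1 => e2.
  have S0 : S 0 = 0.
    have := hor_lift_lin kk_lt hh (-1) 0 0; rewrite scaler0 addr0 polyCN scaleN1r addNr; exact.
  rewrite S0 scaler0 add0r in e2.
  move: xE; rewrite e1 e2 Theta0 scaleN1r addrC => /eqP; rewrite subr_eq0 => /eqP.
  exact: esym.
- apply/seteqP; split=> [_ [x _ <-] r|v hv].
    by have [h1 h2 _] := coordsP kk_lt x; apply: comb_tails => //; exact: tS.
  have [P [Q [hP hQ <-]]] := comb_surj hv.
  (* [Phi] subtracts S P, so the preimage adds it back. *)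
  exists (Theta P (1%:P *: S P + Q)) => //; rewrite PhiT //; last first.
    by apply: vtails_lin => //; have [] := hS P.
  by congr comb; rewrite polyCN scaleN1r polyC1 scale1r addrA addNr add0r.
move=> x; have [h1 h2 xE] := coordsP kk_lt x.
exists (fun r => (cx x).1 r ord0), (fun r => ((-1)%:P *: S (cx x).1 + (cx x).2) r ord0).
split; last by move=> r; rewrite /Phi mxE.
exists (Theta (cx x).1 (S (cx x).1)), (Theta 0 ((-1)%:P *: S (cx x).1 + (cx x).2)); split.
- have e1 : 1%:P *: (cx x).1 + 0 = (cx x).1 by rewrite polyC1 scale1r addr0.
  have e2 : 1%:P *: S (cx x).1 + ((-1)%:P *: S (cx x).1 + (cx x).2) = (cx x).2.
    by rewrite polyC1 scale1r polyCN scaleN1r addrA subrr add0r.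
  have := @Theta_lin R l 1 (cx x).1 0 (S (cx x).1) ((-1)%:P *: S (cx x).1 + (cx x).2).
  by rewrite e1 e2 scale1r => <-.
- by have [] := hS (cx x).1.
- apply/(H1_verticalP kk_lt); exists ((-1)%:P *: S (cx x).1 + (cx x).2) => //.
  exact: tS h2.
- exact: restriction_Theta.
exact: vertical_Theta (tS _ _ h2).
Qed.

End Recombination.

(** * Orbit sets *)

Section Orbits.
Variable R : realType.
Local Notation C := R[i].
Local Open Scope sesquilinear_scope.

Local Notation unitary_blocks := (@unitary_blocks R _).

Definition tail_vecs n (e : 'I_n -> int) : set 'cV[{poly C}]_n :=
  [set v | forall r, tail_poly (e r) (v r ord0)].

(** Stated for any size and any labels kappa, so that blocks can be split off repeatedly. *)
Definition orbits_of n (kappa e : 'I_n -> int) : set (set 'cV[{poly C}]_n) :=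
  [set [set map_mx polyC B *m v | B in unitary_blocks kappa] | v in tail_vecs e].

Lemma block_unitary k m (A : 'M[C]_k) (D : 'M[C]_m) :
  block_mx A 0 0 D \is unitarymx <-> A \is unitarymx /\ D \is unitarymx.
Proof.
have E : block_mx A 0 0 D *m (block_mx A 0 0 D) ^t* = block_mx (A *m A ^t*) 0 0 (D *m D ^t*).
  rewrite tr_block_mx map_block_mx mulmx_block !trmx0 !map_mx0.
  by rewrite !mulmx0 !mul0mx !addr0 !add0r.
split=> [/unitarymxP|[/unitarymxP hA /unitarymxP hD]].
  by rewrite E scalar_mx_block => /eq_block_mx[? _ _ ?]; split; apply/unitarymxP.
by apply/unitarymxP; rewrite E hA hD scalar_mx_block.
Qed.

Lemma unitary_blocks_split k m (kappa : 'I_(k + m) -> int) :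
  (forall i j, kappa (lshift m i) != kappa (rshift k j)) ->
  unitary_blocks kappa = [set block_mx A 0 0 D | A in unitary_blocks (kappa \o @lshift k m) &
    D in unitary_blocks (kappa \o @rshift k m)].
Proof.
move=> sep; apply/seteqP; split=> [B [BU Bk]|_ [A [AU Ak] [D [DU Dk] <-]]].
  have E : B = block_mx (ulsubmx B) 0 0 (drsubmx B).
    rewrite -[LHS]submxK; congr block_mx; apply/matrixP => i j; rewrite !mxE; apply: Bk.
      exact: sep.
    by rewrite eq_sym; exact: sep.
  have [Aun Dun] : ulsubmx B \is unitarymx /\ drsubmx B \is unitarymx.
    by apply/block_unitary; rewrite -E.
  exists (ulsubmx B); first by split=> // r s rs; rewrite !mxE; exact: Bk.
  by exists (drsubmx B) => //; split=> // r s rs; rewrite !mxE; exact: Bk.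
split; first exact/block_unitary.
move=> r s; rewrite -[r]splitK -[s]splitK.
case: (fintype.split r) => i; case: (fintype.split s) => j /= rs.
- by rewrite block_mxEul; exact: Ak.
- by rewrite block_mxEur mxE.
- by rewrite block_mxEdl mxE.
by rewrite block_mxEdr; exact: Dk.
Qed.

(** When no label occurs on both sides, the group is a product acting independently on the two
    halves, so an orbit is a product of orbits. *)
Lemma orbits_split k m (kappa e : 'I_(k + m) -> int) :
  (forall i j, kappa (lshift m i) != kappa (rshift k j)) ->
  orbits_of kappa e = orbit_prod (orbits_of (kappa \o @lshift k m) (e \o @lshift k m))
    (orbits_of (kappa \o @rshift k m) (e \o @rshift k m)).
Proof.
move=> sep.
have E v1 v2 : [set map_mx polyC B *m col_mx v1 v2 | B in unitary_blocks kappa] =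
   [set col_mx u v | u in [set map_mx polyC A *m v1 | A in unitary_blocks (kappa \o @lshift k m)] &
      v in [set map_mx polyC D *m v2 | D in unitary_blocks (kappa \o @rshift k m)]].
  have F (A : 'M[C]_k) (D : 'M[C]_m) : map_mx polyC (block_mx A 0 0 D) *m col_mx v1 v2 =
      col_mx (map_mx polyC A *m v1) (map_mx polyC D *m v2).
    by rewrite map_block_mx !map_mx0 mul_block_col !mul0mx addr0 add0r.
  rewrite (unitary_blocks_split sep); apply/seteqP; split.
    move=> _ [_ [A hA [D hD <-]] <-]; rewrite F.
    exists (map_mx polyC A *m v1); first by exists A.
    by exists (map_mx polyC D *m v2) => //; exists D.
  move=> _ [_ [A hA <-] [_ [D hD <-] <-]]; rewrite -F.
  by exists (block_mx A 0 0 D) => //; exists A => //; exists D.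
apply/seteqP; split=> [_ [v hv <-]|_ [_ [v1 h1 <-] [_ [v2 h2 <-] <-]]].
  rewrite -[v]vsubmxK E; eexists; last eexists; last reflexivity.
    by exists (usubmx v) => // r; rewrite mxE; exact: hv.
  by exists (dsubmx v) => // r; rewrite mxE; exact: hv.
exists (col_mx v1 v2); last exact: E.
move=> r; rewrite -[r]splitK; case: (fintype.split r) => i /=.
  by rewrite col_mxEu; exact: h1.
by rewrite col_mxEd; exact: h2.
Qed.

Lemma orbits_const k (kappa e : 'I_k -> int) (n : int) : (0 <= n)%R ->
  (forall r s, kappa r = kappa s) -> (forall r, e r = n) ->
  orbits_of kappa e = orbit_set R k n.
Proof.
move=> n0 hk he; rewrite /orbit_set n0 /orbits_of.
have -> : unitary_blocks kappa = [set g | g \is unitarymx].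
  apply/seteqP; split=> [B []//|B BU]; split=> // r s; by rewrite (hk r s) eqxx.
by have -> : e = fun=> n by apply/funext => r; exact: he.
Qed.

Variable l : 'I_3 -> int.
Local Notation H := (H1 (Der2_sheaf R l)).

(** [Phi] turns the action of g into multiplication by its compound, and by [compound_UE] the
    compounds fill the whole group of unitary blocks. *)
Lemma orbits_image (e : 'I_3 -> int) (Phi : H -> 'cV[{poly C}]_3) :
  (forall r, pair_deg l r + 2 < 0) -> range Phi = tail_vecs e ->
  (forall g x y, UE l g -> UE_act g x y -> Phi y = compound_mul g (Phi x)) ->
  [set Phi @` UE_orbit x | x in [set: H]] = orbits_of (pair_deg l) e.
Proof.
move=> kk_lt rP eP.
have E x : Phi @` UE_orbit x = [set map_mx polyC B *m Phi x | B in unitary_blocks (pair_deg l)].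
  apply/seteqP; split=> [_ [y [g gU xy] <-]|_ [B hB <-]].
    have hB : unitary_blocks (pair_deg l) (compound g) by rewrite -compound_UE; exists g.
    by exists (compound g) => //; rewrite (eP _ _ _ gU xy).
  move: hB; rewrite -compound_UE => -[g gU <-]; have [h1 h2 xE] := coordsP kk_lt x.
  have xy : UE_act g x (Theta l (compound_mul g (coords kk_lt x).1) (compound_mul g (coords kk_lt x).2)).
    by rewrite {1}xE; exact/(UE_actP _ _ _ gU).
  exists (Theta l (compound_mul g (coords kk_lt x).1) (compound_mul g (coords kk_lt x).2)); first by exists g.
  exact: (eP _ _ _ gU xy).
apply/seteqP; split=> [_ [x _ <-]|_ [v hv <-]].
  by rewrite E; exists (Phi x) => //; rewrite -rP; exists x.
by move: hv; rewrite -rP => -[x _ <-]; exists x => //; rewrite E.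
Qed.

End Orbits.

Theorem proposition3 (R : realType) (l1 l2 l3 : int)
    (h12 : l1 <= l2) (h23 : l2 <= l3) (hlt : l2 + l3 < - 2) :
  let l : 'I_3 -> int := tnth [tuple l1; l2; l3] in
  let n12 : int := cdeg l1 l2 + ddeg l1 l2 + 1 in
  let n13 : int := cdeg l1 l3 + ddeg l1 l3 + 1 in
  let n23 : int := cdeg l2 l3 + ddeg l2 l3 + 1 in
  (exists h : H1 (Der2_sheaf R l) -> H1 (Der2_sheaf R l) -> R[i],
     invariant_metric h) /\
  forall h : H1 (Der2_sheaf R l) -> H1 (Der2_sheaf R l) -> R[i],
    invariant_metric h ->
    exists Phi : H1 (Der2_sheaf R l) -> 'cV[{poly R[i]}]_3,
      is_identification h Phi /\
      let orbits : set (set 'cV[{poly R[i]}]_3) :=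
        [set Phi @` UE_orbit x | x in [set: H1 (Der2_sheaf R l)]] in
      [/\ l1 = l2 -> l2 = l3 ->
             orbits = orbit_set R 3 n12,
          l1 = l2 -> l2 < l3 ->
             orbits = orbit_prod (orbit_set R 1 n12) (orbit_set R 2 n13),
          l1 < l2 -> l2 = l3 ->
             orbits = orbit_prod (orbit_set R 2 n12) (orbit_set R 1 n23) &
          l1 < l2 -> l2 < l3 ->
             orbits = orbit_prod (orbit_set R 1 n12)
                        (orbit_prod (orbit_set R 1 n13) (orbit_set R 1 n23))].
Proof.
move=> l n12 n13 n23.
have [l0 [la lb]] : l i0 = l1 /\ l i1 = l2 /\ l i2 = l3.
  by rewrite /l !(tnth_nth 0).
pose e r := cdeg (l (pair_of r).1) (l (pair_of r).2) + ddeg (l (pair_of r).1) (l (pair_of r).2) + 1.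
have [k0 [k1 k2]] : pair_deg l i0 = l1 + l2 /\ pair_deg l i1 = l1 + l3 /\ pair_deg l i2 = l2 + l3.
  by rewrite /pair_deg pair_of0 pair_of1 pair_of2 /= l0 la lb.
have [e0 [e1 e2]] : e i0 = n12 /\ e i1 = n13 /\ e i2 = n23.
  by rewrite /e pair_of0 pair_of1 pair_of2 /= l0 la lb.
have kk_lt r : pair_deg l r + 2 < 0 by move: r; apply: ord3_ind; rewrite ?k0 ?k1 ?k2; lia.
(* Each of these numbers is -2(l_i + l_j) - 5 >= 1, so [orbit_set] is in its first branch. *)
have p12 : (0 <= n12)%R by rewrite /n12 /cdeg /ddeg; lia.
have p13 : (0 <= n13)%R by rewrite /n13 /cdeg /ddeg; lia.
have p23 : (0 <= n23)%R by rewrite /n23 /cdeg /ddeg; lia.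
split; first by exists (std_metric kk_lt); exact: std_metricP.
move=> h hh; have [Phi [idPhi eqPhi]] := identification kk_lt hh.
exists Phi; split; first exact: idPhi.
have [_ _ rPhi _] := idPhi.
rewrite /= (orbits_image kk_lt (e := e) rPhi eqPhi).
have kE (r : 'I_3) : pair_deg l r = nth 0 [:: l1 + l2; l1 + l3; l2 + l3] r.
  by move: r; apply: ord3_ind.
have eE (r : 'I_3) : e r = nth 0 [:: n12; n13; n23] r.
  by move: r; apply: ord3_ind.
split=> E1 E2.
- apply: orbits_const => //.
    by move=> [[|[|[|//]]] ?] [[|[|[|//]]] ?]; rewrite !kE /= ?E1 ?E2.
  by move=> [[|[|[|//]]] ?]; rewrite !eE /= /n12 /n13 /n23 ?E1 ?E2.
(* Here l1 + l3 = l2 + l3 exceeds l1 + l2: the pair 12 stands alone before the block of 13 and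
   23. *)
- refine (etrans (@orbits_split R 1 2 (pair_deg l) e _) _).
    by move=> [[|//] ?] [[|[|//]] ?]; rewrite !kE /=; lia.
  congr orbit_prod; apply: orbits_const => //.
  + by move=> [[|//] ?] [[|//] ?]; rewrite /= !kE.
  + by move=> [[|//] ?]; rewrite /= eE.
  + by move=> [[|[|//]] ?] [[|[|//]] ?]; rewrite /= !kE /= ?E1.
  by move=> [[|[|//]] ?]; rewrite /= eE //= /n23 -E1.
(* Here l1 + l2 = l1 + l3 is below l2 + l3: the block of 12 and 13 precedes the pair 23. *)
- refine (etrans (@orbits_split R 2 1 (pair_deg l) e _) _).
    by move=> [[|[|//]] ?] [[|//] ?]; rewrite !kE /=; lia.
  congr orbit_prod; apply: orbits_const => //.
  + by move=> [[|[|//]] ?] [[|[|//]] ?]; rewrite /= !kE /= ?E2.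
  + by move=> [[|[|//]] ?]; rewrite /= eE //= /n13 -E2.
  + by move=> [[|//] ?] [[|//] ?]; rewrite /= !kE.
  by move=> [[|//] ?]; rewrite /= eE.
refine (etrans (@orbits_split R 1 (1 + 1) (pair_deg l) e _) _).
  by move=> [[|//] ?] [[|[|//]] ?]; rewrite !kE /=; lia.
congr orbit_prod.
  apply: orbits_const => //.
    by move=> [[|//] ?] [[|//] ?]; rewrite /= !kE.
  by move=> [[|//] ?]; rewrite /= eE.
refine (etrans (@orbits_split R 1 1 _ _ _) _).
  by move=> [[|//] ?] [[|//] ?]; rewrite /= !kE /=; lia.
congr orbit_prod; apply: orbits_const => //.
- by move=> [[|//] ?] [[|//] ?]; rewrite /= !kE.
- by move=> [[|//] ?]; rewrite /= eE.
- by move=> [[|//] ?] [[|//] ?]; rewrite /= !kE.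
by move=> [[|//] ?]; rewrite /= eE.
Qed.
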